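(* The tropical Burkhardt quartic ${\rm trop}(\mathcal{B})\subset\mathbb{TP}^{39}$ is the fan over a $2$-dimensional simplicial complex with $85$ vertices, $600$ edges and $880$ triangles. The census of its cones, together with the cones of ${\rm Berg}(\mathrm{G}_{32})$ mapping onto them under the linear map $A$, is as follows. Dimension $1$: $40$ rays (a), covered $2$ to $1$ by the $40$ rays (a) and the $40$ rays (ä) of ${\rm Berg}(\mathrm{G}_{32})$; $45$ rays (b), covered $2$ to $1$ by the $90$ rays (b). Dimension $2$: $240$ cones (aa), covered $3$ to $1$ by the $240$ cones (aa) and $480$ cones (aä); $360$ cones (ab), covered $3$ to $1$ by the $360$ cones (ab), $360$ cones (bä) and $360$ cones (ab$^\perp$). Dimension $3$: $720$ cones (aab), covered $4$ to $1$ by the $1440$ cones (aab) and $1440$ cones (abä); $160$ cones (aaa), covered $3$ to $1$ by the $480$ cones (aaä).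
   Context: $K$ is an algebraically closed field of characteristic $0$, $\omega\in K$ a primitive third root of unity, $\sqrt{-3}=\omega-\omega^2$. On $\mathbb{F}_3^4$ use the symplectic form $\langle x,y\rangle=x_1y_3+x_2y_4-x_3y_1-x_4y_2$. ''Line'' means one-dimensional subspace ($40$), ''plane'' two-dimensional subspace ($40$ isotropic ones, on which the form vanishes, each containing $4$ lines, and $90$ non-isotropic ones), ''hyperplane'' a subspace $h^\perp$ with $h$ a line. To each line $\ell$ attach a linear form $u_\ell$ in $c_0,\dots,c_3$ (exponents of $\omega$ in $\mathbb{F}_3$; $i,j\in\mathbb{F}_3$; line given by a spanning vector): $(1,0,0,0)\mapsto\sqrt{-3}\,c_0$, $(0,1,0,0)\mapsto\sqrt{-3}\,c_1$, $(1,2,0,0)\mapsto\sqrt{-3}\,c_2$, $(1,1,0,0)\mapsto\sqrt{-3}\,c_3$, $(i,j,0,1)\mapsto c_1+\omega^{i-j}c_2+\omega^{-i-j}c_3$, $(i,j,1,0)\mapsto c_2-\omega^{j}c_3+\omega^{i-j}c_0$, $(i,j,1,1)\mapsto c_3+\omega^{i}c_0-\omega^{j}c_1$, $(i,j,1,2)\mapsto c_0+\omega^{-i-j}c_1-\omega^{-i}c_2$. These $40$ forms define the complex reflection arrangement $\mathrm{G}_{32}$ and a linear embedding $\mathbb{P}^3\hookrightarrow\mathbb{P}^{39}$. The monomial map $\mathbb{P}^{39}\dashrightarrow\mathbb{P}^{39}$ has coordinates $m_W=\prod_{\ell\subset W}u_\ell$, one for each isotropic plane $W$. The Burkhardt quartic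 $\mathcal{B}\subset\mathbb{P}^{39}$ is the closure of the image of the composition. $\mathbb{TP}^{39}=\mathbb{R}^{40}/\mathbb{R}(1,\dots,1)$; ${\rm trop}(\mathcal{B})$ is the constant-coefficient (trivial valuation, min-convention) tropicalization of $\mathcal{B}\cap\mathbb{G}_m^{39}$. $A:\mathbb{TP}^{39}\to\mathbb{TP}^{39}$ is the linear map $A(e_\ell)=\sum_{W\supset\ell}e_W$. ${\rm Berg}(\mathrm{G}_{32})$ is the tropical linear space of the matroid of the $40$ forms with its coarsest fan structure, and ${\rm trop}(\mathcal{B})=A\cdot{\rm Berg}(\mathrm{G}_{32})$. Cones of ${\rm Berg}(\mathrm{G}_{32})$: rays (a) $e_\ell$ for lines $\ell$; (b) $\sum_{\ell\subset b}e_\ell$ for non-isotropic planes $b$; (ä) $\sum_{\ell\subset h^\perp,\ell\ne h}e_\ell$ for hyperplanes $h^\perp$. Two-dimensional cones: (aa) two distinct orthogonal lines; (ab) a line in a non-isotropic plane; (aä) a line $\ell\ne h$ in a hyperplane $h^\perp$; (bä) a non-isotropic plane in a hyperplane; (ab$^\perp$) a non-isotropic plane $b$ and a line in $b^\perp$. Three-dimensional cones: (aaä) two distinct orthogonal lines, both different from $h$, in a hyperplane $h^\perp$; (abä) a line in a non-isotropic plane in a hyperplane; (aab) a non-isotropic plane $b$, a line in $b$ and a line in $b^\perp$. The types of the cones of ${\rm trop}(\mathcal{B})$ are named by replacing ä with a and b$^\perp$ with b: rays (a) correspond to the lines, rays (b) to the $45$ plane pairs $\{b,b^\perp\}$ of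 orthogonal non-isotropic planes. *)

(* Defs.v *)
From HB Require Import structures.
From mathcomp Require Import all_boot all_order all_algebra.
From mathcomp Require Import boolp classical_sets cardinality reals.
From mathcomp Require Import mpoly.

Set Implicit Arguments.
Unset Strict Implicit.
Unset Printing Implicit Defensive.

Import Order.TTheory GRing.Theory Num.Theory.
Local Open Scope ring_scope.

Definition row4 (T : nzRingType) (a b c d : T) : 'rV[T]_4 :=
  \row_(k < 4) nth 0 [:: a; b; c; d] k.

Definition symp (x y : 'rV['F_3]_4) : 'F_3 :=
  x 0 (inord 0) * y 0 (inord 2) + x 0 (inord 1) * y 0 (inord 3)
  - x 0 (inord 2) * y 0 (inord 0) - x 0 (inord 3) * y 0 (inord 1).

(* Subspaces of F_3^4 are represented by their sets of vectors, so that
   inclusion is \subset. *)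
Definition subspace_of_dim (d : nat) (U : {set 'rV['F_3]_4}) : bool :=
  [exists A : 'M['F_3]_(d, 4), row_free A && (U == [set v | (v <= A)%MS])].

Definition perp (U : {set 'rV['F_3]_4}) : {set 'rV['F_3]_4} :=
  [set y | [forall x in U, symp x y == 0]].

Definition isotropic (U : {set 'rV['F_3]_4}) : bool := U \subset perp U.

Definition line : finType := {l : {set 'rV['F_3]_4} | subspace_of_dim 1 l}.

Definition isoplane : finType :=
  {W : {set 'rV['F_3]_4} | subspace_of_dim 2 W && isotropic W}.

Definition nonisoplane : finType :=
  {b : {set 'rV['F_3]_4} | subspace_of_dim 2 b && ~~ isotropic b}.

(* Pairs (spanning vector of l, coefficients of u_l on c_0, c_1, c_2, c_3).
   Every line contains the first component of exactly one pair. *)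
Definition g32_table (K : fieldType) (w : K) :
    seq ('rV['F_3]_4 * 'rV[K]_4) :=
  let z (a : 'F_3) : K := w ^+ (a : nat) in
  let s : K := w - w ^+ 2 in
  let F3 := enum 'F_3 in
  [:: (row4 1 0 0 0, row4 s 0 0 0);
      (row4 0 1 0 0, row4 0 s 0 0);
      (row4 1 2%:R 0 0, row4 0 0 s 0);
      (row4 1 1 0 0, row4 0 0 0 s)]
  ++ [seq (row4 i j 0 1, row4 0 1 (z (i - j)) (z (- i - j)))
       | i <- F3, j <- F3]
  ++ [seq (row4 i j 1 0, row4 (z (i - j)) 0 1 (- z j)) | i <- F3, j <- F3]
  ++ [seq (row4 i j 1 1, row4 (z i) (- z j) 0 1) | i <- F3, j <- F3]
  ++ [seq (row4 i j 1 2%:R, row4 1 (z (- i - j)) (- z (- i)) 0)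
       | i <- F3, j <- F3].

Definition g32_form (K : fieldType) (w : K) (l : line) : 'rV[K]_4 :=
  let t := g32_table w in
  (nth (0, 0) t (find (fun p => p.1 \in val l) t)).2.

Definition g32_eval (K : fieldType) (w : K) (l : line) (c : 'rV[K]_4) : K :=
  \sum_(k < 4) g32_form w l 0 k * c 0 k.

Definition burkhardt_map (K : fieldType) (w : K) (c : 'rV[K]_4) :
    {ffun isoplane -> K} :=
  [ffun W : isoplane =>
     \prod_(l : line | val l \subset val W) g32_eval w l c].

(* The variable of index i stands for the coordinate m_W, W = enum_val i. *)
Definition coord_poly (K : fieldType) := {mpoly K[#|{: isoplane}|]}.

Definition poly_at (K : fieldType) (f : coord_poly K)
    (y : {ffun isoplane -> K}) : K :=
  f.@[fun i => y (enum_val i)].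

(* Subvarieties of P^39 are given by their nonzero homogeneous coordinate
   vectors.  The rational map is defined at c when burkhardt_map w c != 0. *)
Definition burkhardt (K : fieldType) (w : K) (y : {ffun isoplane -> K}) : Prop :=
  y != 0 /\
  forall (d : nat) (f : coord_poly K), f \is d.-homog ->
    (forall c, burkhardt_map w c != 0 -> poly_at f (burkhardt_map w c) = 0) ->
    poly_at f y = 0.

(* R^X; a subset of TP = R^X / R(1,...,1) is represented by its preimage,
   a subset of R^X stable under translation by R(1,...,1). *)
Definition trop_vec (R : realType) (X : finType) := {ffun X -> R^o}.

Definition ones (R : realType) (X : finType) : trop_vec R X := [ffun=> 1].

Definition unitv (R : realType) (X : finType) (x : X) : trop_vec R X :=
  [ffun y => (y == x)%:R].

Definition weight (R : realType) (v : trop_vec R isoplane)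
    (m : 'X_{1..#|{: isoplane}|}) : R :=
  \sum_i (m i)%:R * v (enum_val i).

(* Constant-coefficient tropicalization of B meet G_m^39.  The torus is
   G_m^40 / G_m, and up to a monomial factor, which does not affect the
   condition, its regular functions are homogeneous polynomials. *)
Definition trop_burkhardt (R : realType) (K : fieldType) (w : K) :
    set (trop_vec R isoplane) :=
  fun v => forall (d : nat) (f : coord_poly K), f \is d.-homog -> f != 0 ->
    (forall y, burkhardt w y -> (forall W, y W != 0) -> poly_at f y = 0) ->
    exists m1 m2, [/\ m1 \in msupp f, m2 \in msupp f, m1 != m2 &
      forall m, m \in msupp f ->
        weight v m1 <= weight v m /\ weight v m2 <= weight v m].
Arguments trop_burkhardt R {K} w.

(* Maps R(1,...,1) into R(1,...,1), since each W contains 4 lines. *)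
Definition mapA (R : realType) (v : trop_vec R line) : trop_vec R isoplane :=
  \sum_(l : line)
    v l *: \sum_(W : isoplane | val l \subset val W) unitv R W.

Definition cone_over (R : realType) (X I : finType) (g : I -> trop_vec R X)
    (s : {set I}) : set (trop_vec R X) :=
  fun v => exists (a : I -> R) (t : R),
    (forall i, i \in s -> 0 <= a i) /\
    v = \sum_(i in s) a i *: g i + t *: ones R X.

Definition polyhedral_cone (R : realType) (X : finType)
    (C : set (trop_vec R X)) : Prop :=
  exists (n : nat) (g : 'I_n -> trop_vec R X), C = cone_over g [set: 'I_n].

Definition face_of (R : realType) (X : finType)
    (F C : set (trop_vec R X)) : Prop :=
  exists a : X -> R,
    (forall v, C v -> 0 <= \sum_x a x * v x) /\
    F = (fun v => C v /\ \sum_x a x * v x = 0).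

Definition support (R : realType) (X : finType)
    (S : set (set (trop_vec R X))) : set (trop_vec R X) :=
  fun v => exists C, S C /\ C v.

Definition is_fan (R : realType) (X : finType)
    (S : set (set (trop_vec R X))) : Prop :=
  [/\ finite_set S,
      (forall C, S C -> polyhedral_cone C),
      (forall C F, S C -> face_of F C -> S F) &
      (forall C D, S C -> S D ->
         face_of (C `&` D)%classic C /\ face_of (C `&` D)%classic D)].

Definition coarsest_fan_structure (R : realType) (X : finType)
    (T : set (trop_vec R X)) (S : set (set (trop_vec R X))) : Prop :=
  [/\ is_fan S, support S = T &
      forall S', is_fan S' -> support S' = T ->
        forall C', S' C' -> exists C, S C /\ (C' `<=` C)%classic].

(* T is the fan over the simplicial complex Delta, the vertex i spanning the
   ray of g i.  The vertices of Delta are the i with [set i] \in Delta. *)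
Definition fan_over (R : realType) (X V : finType) (Delta : {set {set V}})
    (g : V -> trop_vec R X) (T : set (trop_vec R X)) : Prop :=
  [/\ finset.set0 \in Delta,
      (forall s t : {set V}, s \in Delta -> t \subset s -> t \in Delta),
      (forall s, s \in Delta -> forall (a : V -> R) (t : R),
         \sum_(i in s) a i *: g i + t *: ones R X = 0 ->
         forall i, i \in s -> a i = 0),
      (forall s t : {set V}, s \in Delta -> t \in Delta ->
         (cone_over g s `&` cone_over g t)%classic = cone_over g (s :&: t)) &
      T = (fun v => exists s, s \in Delta /\ cone_over g s v)].

Definition faces (V : finType) (Delta : {set {set V}}) (k : nat) :
    {set {set V}} :=
  [set s in Delta | #|s| == k].

Definition g32_independent (K : fieldType) (w : K) (C : {set line}) : bool :=
  \rank (\sum_(l in C) <<g32_form w l>>)%MS == #|C|.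

Definition g32_circuit (K : fieldType) (w : K) (C : {set line}) : bool :=
  minset (fun D => ~~ g32_independent w D) C.

(* Min-convention tropical linear space of the matroid of the 40 forms. *)
Definition berg (R : realType) (K : fieldType) (w : K) :
    set (trop_vec R line) :=
  fun v => forall C, g32_circuit w C ->
    exists l1 l2, [/\ l1 \in C, l2 \in C, l1 != l2 &
      forall l, l \in C -> v l1 <= v l /\ v l2 <= v l].
Arguments berg R {K} w.

(* A ray is the set F of lines such that the ray is spanned by the sum of the
   e_l, l in F; a cone is the set of its rays.  The letter h stands for "ä",
   and bp for the b of a "b^perp" incidence. *)
Definition ray_a (l : line) : {set line} := [set l].
Definition ray_b (b : nonisoplane) : {set line} :=
  [set l : line | val l \subset val b].
Definition ray_h (h : line) : {set line} :=
  [set l : line | (val l \subset perp (val h)) && (l != h)].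

Definition ray_gen (R : realType) (F : {set line}) : trop_vec R line :=
  \sum_(l in F) unitv R l.

Definition cone_type := {set {set {set line}}}.

Definition berg_a : cone_type := [set [set ray_a l] | l : line].
Definition berg_b : cone_type := [set [set ray_b b] | b : nonisoplane].
Definition berg_h : cone_type := [set [set ray_h h] | h : line].

Definition berg_aa : cone_type :=
  [set [set ray_a l; ray_a l'] | l in line, l' in line
     & (l != l') && (val l \subset perp (val l'))].
Definition berg_ab : cone_type :=
  [set [set ray_a l; ray_b b] | l in line, b in nonisoplane
     & val l \subset val b].
Definition berg_ah : cone_type :=
  [set [set ray_a l; ray_h h] | l in line, h in line
     & (l != h) && (val l \subset perp (val h))].
Definition berg_bh : cone_type :=
  [set [set ray_b b; ray_h h] | b in nonisoplane, h in line
     & val b \subset perp (val h)].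
Definition berg_abp : cone_type :=
  [set [set ray_a l; ray_b b] | l in line, b in nonisoplane
     & val l \subset perp (val b)].

Definition berg_aah : cone_type :=
  \bigcup_(h : line)
    [set [set ray_a l; ray_a l'; ray_h h] | l in line, l' in line
       & [&& l != l', val l \subset perp (val l'), l != h, l' != h,
             val l \subset perp (val h) & val l' \subset perp (val h)]].
Definition berg_abh : cone_type :=
  \bigcup_(h : line)
    [set [set ray_a l; ray_b b; ray_h h] | l in line, b in nonisoplane
       & (val l \subset val b) && (val b \subset perp (val h))].
Definition berg_aab : cone_type :=
  \bigcup_(b : nonisoplane)
    [set [set ray_a l; ray_a l'; ray_b b] | l in line, l' in line
       & (val l \subset val b) && (val l' \subset perp (val b))].

Definition berg_cones : cone_type :=
  [set finset.set0]
  :|: (berg_a :|: berg_b :|: berg_h)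
  :|: (berg_aa :|: berg_ab :|: berg_ah :|: berg_bh :|: berg_abp)
  :|: (berg_aah :|: berg_abh :|: berg_aab).

Definition berg_cone (R : realType) (s : {set {set line}}) :
    set (trop_vec R line) :=
  cone_over (@ray_gen R) s.
Arguments berg_cone R s : clear implicits.

Definition berg_fan (R : realType) : set (set (trop_vec R line)) :=
  fun C => exists s, s \in berg_cones /\ C = berg_cone R s.
Arguments berg_fan R : clear implicits.

Definition image_cone (R : realType) (s : {set {set line}}) :
    set (trop_vec R isoplane) :=
  (@mapA R @` berg_cone R s)%classic.
Arguments image_cone R s : clear implicits.

(* A type of cones of trop(B) is given by the Berg cones whose names become
   this type when "ä" is replaced by a and b^perp by b. *)
Definition over_a : cone_type := berg_a :|: berg_h.
Definition over_b : cone_type := berg_b.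
Definition over_aa : cone_type := berg_aa :|: berg_ah.
Definition over_ab : cone_type := berg_ab :|: berg_bh :|: berg_abp.
Definition over_aab : cone_type := berg_aab :|: berg_abh.
Definition over_aaa : cone_type := berg_aah.

Definition trop_cones (R : realType) (P : cone_type) :
    set (set (trop_vec R isoplane)) :=
  fun D => exists s, s \in P /\ D = image_cone R s.
Arguments trop_cones R P : clear implicits.

Definition mapping_onto (R : realType) (D : set (trop_vec R isoplane)) :
    cone_type :=
  [set s in berg_cones | `[< image_cone R s = D >]].

(* mapping_onto ranges over all Berg cones, not only those in P. *)
Definition census (R : realType) (P : cone_type) (n k : nat) : Prop :=
  (trop_cones R P #= `I_n)%card /\
  forall D, trop_cones R P D ->
    mapping_onto D \subset P /\ #|mapping_onto D| = k.

(* Main.v *)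
(** Idea.  A cone of either fan is given by a set of rays, each the indicator
    function of a set of lines (or of isotropic planes).  Both complexes are
    "separated": no ray is covered by the rays of a cone that do not contain it,
    which makes nonnegative representations unique and yields integral
    functionals dual to the rays of a cone.  The fan axioms, and coarsest
    structure (at least three maximal cones meet along each wall), follow from this
    and from a finite verification on explicit tables.

    The points of the tropical linear space are the total preorders of the 40
    forms that come from flags of flats; a greedy choice of four independent
    forms shows that every such flag is refined by one of the listed cones.  The
    flats of rank 3 are recognized by a common zero with coordinates in Z[w].

    A point A(v) with v in a Bergman cone is tropical, because an integral v
    close to it is the order of vanishing of the forms along the curve
    c(t) = sum_j y_j t^(v_j) p_j, where p_j is a generic point of the flat
    {v > v_j}.  Conversely, for a tropical point v the Laurent polynomials of
    nonnegative v-weight in the generic point of the quartic, with the ideal of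
    those of positive weight, form a local pair (a positive element equal to 1
    would be an equation with a unique minimal term), which extends to a
    valuation ring of K(c_0, ..., c_3).  The valuation orders the 40 forms as
    in a flag, hence v satisfies the inequalities of the image of a cone. *)
Require Import Defs.
From HB Require Import structures.
From mathcomp Require Import all_boot all_order all_algebra.
From mathcomp Require Import boolp classical_sets cardinality reals.
From mathcomp Require Import mpoly ring lra zify.

Set Implicit Arguments.
Unset Strict Implicit.
Unset Printing Implicit Defensive.

Import Order.TTheory GRing.Theory Num.Theory.
Local Open Scope ring_scope.

(** * Separated complexes of sets *)

(** Modulo the all-one vector, A sends the ray (ä) of h to twice the image of the ray (a) of h, and
    b and b^perp meet the same sixteen isotropic planes. These two coincidences make Bergman cones
    share their images, so the census compares lists of vertices. Separatedness makes coefficients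
    readable from a point: its minimum over a member G is the constant plus the sum of the
    coefficients of the members containing G. The value group of the valuation is arbitrary, and v
    is not recovered from it. Only the divisibility preorder of the 40 forms is used: it selects a
    cone, and a degree 0 monomial in the coordinates whose exponents pair nonnegatively with the
    rays of the image cone lies in the ring. Negative v-weight would put the inverse monomial into
    the ideal. So v satisfies every integral inequality of the cone, and integral dual functionals
    show that these cut it out. Conversely, a real v may be replaced by an integral point of the
    same cone, because a unique minimum among finitely many monomials survives a small change of
    direction. *)

(** On lines this is convertible with [ray_gen], so results on [indic] apply to [berg_cone] as they
    stand. *)
Definition indic (R : realType) (X : finType) (F : {set X}) : trop_vec R X :=
  \sum_(x in F) unitv R x.

Lemma indicE (R : realType) (X : finType) (F : {set X}) x :
  indic R F x = (x \in F)%:R.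
Proof.
rewrite /indic sum_ffunE /=; under eq_bigr do rewrite ffunE.
have [xF|xF] := boolP (x \in F).
  rewrite (bigD1 x) //= eqxx big1 ?addr0 // => y /andP[_ /negPf].
  by rewrite eq_sym => ->.
rewrite big1 // => y yF; case: eqP => // xy.
by rewrite xy yF in xF.
Qed.

Lemma onesE (R : realType) (X : finType) (x : X) : ones R X x = 1.
Proof. by rewrite ffunE. Qed.

Section Comb.
Variables (R : realType) (X : finType).
Implicit Types (s : {set {set X}}) (F G : {set X}) (v : trop_vec R X).

Definition comb s (a : {set X} -> R) (t : R) : trop_vec R X :=
  \sum_(F in s) a F *: indic R F + t *: ones R X.

Lemma combE s a t x : comb s a t x = \sum_(F in s) a F * (x \in F)%:R + t.
Proof.
rewrite ffunE sum_ffunE ffunE onesE; congr (_ + _); last exact: mulr1.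
by apply: eq_bigr => F _; rewrite ffunE indicE.
Qed.

Lemma combP s (v : trop_vec R X) a t :
  v = comb s a t <-> forall x, v x = \sum_(F in s) a F * (x \in F)%:R + t.
Proof.
split=> [-> x|E]; first exact: combE.
by apply/ffunP => x; rewrite combE.
Qed.

Lemma comb_sub s s' a t : s \subset s' ->
  comb s a t = comb s' (fun F => if F \in s then a F else 0) t.
Proof.
move=> ss'; rewrite /comb; congr (_ + _).
rewrite big_mkcond [RHS]big_mkcond; apply: eq_bigr => F _.
have [Fs|_] := boolP (F \in s); first by rewrite (fintype.subsetP ss' _ Fs).
by case: ifP => // _; rewrite scale0r.
Qed.

Lemma cone_sub s s' v : s \subset s' ->
  cone_over (@indic R X) s v -> cone_over (@indic R X) s' v.
Proof.
move=> ss' [a [t [a0 ->]]]; exists (fun F => if F \in s then a F else 0), t.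
split; last exact: comb_sub.
by move=> F _; case: ifP => // /a0.
Qed.

Lemma combD s a t a' t' : comb s a t + comb s a' t' = comb s (a \+ a') (t + t').
Proof.
rewrite /comb addrACA -big_split /= scalerDl; congr (_ + _).
by apply: eq_bigr => F _; rewrite scalerDl.
Qed.

Lemma combZ k s a t : k *: comb s a t = comb s (k \*o a) (k * t).
Proof.
rewrite /comb scalerDr scaler_sumr scalerA; congr (_ + _).
by apply: eq_bigr => F _; rewrite scalerA.
Qed.

End Comb.

Lemma card_proper_ltn (X : finType) (F G : {set X}) : F \proper G ->
  (#|X| - #|G| < #|X| - #|F|)%N.
Proof.
move=> FG; have lt := proper_card FG; have le := max_card (mem G).
exact: ltn_sub2l (leq_trans lt le) lt.
Qed.

Section Separated.
Variables (R : realType) (X : finType) (Delta : {set {set {set X}}}).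
Implicit Types (s : {set {set X}}) (F G : {set X}) (v : trop_vec R X).
Local Notation cone := (cone_over (@indic R X)).

Definition down_closed :=
  forall s s', s \in Delta -> s' \subset s -> s' \in Delta.

(* No member of [finset.cover Delta] is covered by the members of a cone that do not
   contain it; the second clause is the same for the whole ground set. *)
Definition separated :=
  (forall s G, s \in Delta -> G \in finset.cover Delta ->
     exists2 x, x \in G & forall F, F \in s -> x \in F -> G \subset F) /\
  (forall s, s \in Delta -> exists x, forall F, F \in s -> x \notin F).

Hypothesis sepD : separated.

Lemma comb_min s (a : {set X} -> R) t G : s \in Delta -> G \in finset.cover Delta ->
  (forall F, F \in s -> 0 <= a F) ->
  (forall x, x \in G -> \sum_(F in s | G \subset F) a F + t <= comb s a t x) /\
  exists2 x, x \in G & comb s a t x = \sum_(F in s | G \subset F) a F + t.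
Proof.
move=> sD GD a0; split=> [x xG|].
  rewrite combE lerD2r [leRHS](bigID (fun F => G \subset F)) /=.
  rewrite -[leLHS]addr0 lerD //.
    rewrite le_eqVlt; apply/orP; left; apply/eqP.
    by apply: eq_bigr => F /andP[_ /fintype.subsetP /(_ _ xG) ->]; rewrite mulr1.
  by apply: sumr_ge0 => F /andP[Fs _]; rewrite mulr_ge0 ?a0 ?ler0n.
have [x xG xF] := sepD.1 _ _ sD GD; exists x => //.
rewrite combE; congr (_ + _).
rewrite [RHS]big_mkcondr; apply: eq_bigr => F Fs.
have [GF|GF] := boolP (G \subset F); first by rewrite (fintype.subsetP GF) ?mulr1.
case: (boolP (x \in F)) => [xFF|_]; last by rewrite mulr0.
by rewrite (xF _ Fs xFF) in GF.
Qed.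

Lemma comb_min0 s (a : {set X} -> R) t : s \in Delta -> (forall F, F \in s -> 0 <= a F) ->
  (forall x, t <= comb s a t x) /\ exists x, comb s a t x = t.
Proof.
move=> sD a0; split=> [x|].
  rewrite combE lerDr sumr_ge0 // => F Fs; by rewrite mulr_ge0 ?a0 ?ler0n.
have [x xF] := sepD.2 _ sD; exists x.
by rewrite combE big1 ?add0r // => F Fs; rewrite (negPf (xF _ Fs)) mulr0.
Qed.

Lemma mem_coverD s F : s \in Delta -> F \in s -> F \in finset.cover Delta.
Proof. by move=> sD Fs; apply/finset.bigcupP; exists s. Qed.

(** The constant is the minimum of the vector, and by [comb_min] the sums of coefficients over all
    members containing a given [G] are also determined by the vector. This system is triangular for
    inclusion and is solved from large sets down to small ones. *)
Lemma comb_uniq s s' (a a' : {set X} -> R) t t' : s \in Delta -> s' \in Delta ->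
  (forall F, F \in s -> 0 <= a F) -> (forall F, F \in s' -> 0 <= a' F) ->
  comb s a t = comb s' a' t' ->
  t = t' /\ forall F, (if F \in s then a F else 0) = (if F \in s' then a' F else 0).
Proof.
move=> sD s'D a0 a'0 E.
have tt : t = t'.
  have [m [x xt]] := comb_min0 t sD a0; have [m' [x' xt']] := comb_min0 t' s'D a'0.
  apply/le_anti; rewrite -{1}xt' -E m /=.
  by rewrite -{1}xt E m'.
split=> //.
pose b F := (if F \in s then a F else 0) - (if F \in s' then a' F else 0).
have sumb G : G \in finset.cover Delta -> \sum_(F : {set X} | G \subset F) b F = 0.
  move=> GD.
  have [m [x xG xt]] := comb_min t sD GD a0.
  have [m' [x' x'G xt']] := comb_min t' s'D GD a'0.
  rewrite sumrB !(big_mkcond (fun F => G \subset F)) /=.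
  have conv (r : {set {set X}}) (c : {set X} -> R) :
      \sum_(F : {set X}) (if G \subset F then if F \in r then c F else 0 else 0) =
      \sum_(F in r | G \subset F) c F.
    rewrite [RHS]big_mkcond; apply: eq_bigr => F _.
    by case: (F \in r); case: (G \subset F).
  rewrite !conv; apply/eqP; rewrite subr_eq0 -(inj_eq (addIr t)).
  apply/eqP/le_anti; apply/andP; split.
    by rewrite {2}tt -xt' -E m.
  by rewrite -xt E tt m'.
have bN F : F \notin finset.cover Delta -> b F = 0.
  move=> FD; rewrite /b ifN ?ifN ?subrr //.
    by apply: contra FD; apply: mem_coverD.
  by apply: contra FD; apply: mem_coverD.
suff b0 F : b F = 0 by move=> F; apply/eqP; rewrite -subr_eq0; apply/eqP/b0.
have [n le_n] := ubnP (#|X| - #|F|)%N.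
elim: n F le_n => // n IH F le_n.
have [FD|FD] := boolP (F \in finset.cover Delta); last exact: bN.
have := sumb F FD; rewrite (bigD1 F) //= big1 ?addr0 // => G /andP[FG GF].
have FpG : F \proper G by rewrite finset.properEneq eq_sym GF.
apply: IH; rewrite ltnS in le_n; apply: leq_trans le_n.
exact: card_proper_ltn.
Qed.

Lemma cone_common s s' v : s \in Delta -> s' \in Delta ->
  cone s v -> cone s' v -> cone (s :&: s') v.
Proof.
move=> sD s'D [a [t [a0 vE]]] [a' [t' [a'0 vE']]].
have [tt E] := comb_uniq sD s'D a0 a'0 (etrans (esym vE) vE').
exists a, t; split; first by move=> F /finset.setIP[/a0].
rewrite vE; congr (_ + _).
rewrite big_mkcond [RHS]big_mkcond; apply: eq_bigr => F _.
rewrite inE; have := E F.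
by case: (F \in s); case: (F \in s') => //= ->; rewrite scale0r.
Qed.

Lemma coneI s s' : s \in Delta -> s' \in Delta ->
  (cone s `&` cone s')%classic = cone (s :&: s').
Proof.
move=> sD s'D; apply/seteqP; split=> v /=; first by case; apply: cone_common.
by move=> H; split; apply: cone_sub H; rewrite ?finset.subsetIl ?finset.subsetIr.
Qed.

Lemma cone_inj s s' : s \in Delta -> s' \in Delta ->
  (cone s `<=` cone s')%classic -> s \subset s'.
Proof.
move=> sD s'D sub; apply/fintype.subsetP => F Fs.
(* The point with all coefficients 1 detects every member of [s]. *)
have /sub [a [t [a0 E]]] : cone s (comb s (fun G => 1) 0).
  by exists (fun=> 1), 0.
have [_ /(_ F)] := comb_uniq sD s'D (fun _ _ => ler01) a0 E.
by rewrite Fs; case: ifP => // _ /eqP; rewrite oner_eq0.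
Qed.

Lemma cone_eq s s' : s \in Delta -> s' \in Delta -> cone s = cone s' -> s = s'.
Proof.
move=> sD s'D E; apply/eqP; rewrite finset.eqEsubset.
by rewrite !cone_inj // E.
Qed.

(* Witness: alpha_F = e_{x_F} - e_{x_0} - \sum_{F' > F} alpha_{F'}, where x_F
   lies only in the members of s that contain F, and x_0 in no member. *)
Lemma dual_functional s F : s \in Delta -> F \in s ->
  exists al : X -> int, \sum_x al x = 0 /\
    forall G, G \in s -> \sum_(x in G) al x = (G == F)%:R.
Proof.
move=> sD; have [n le_n] := ubnP (#|X| - #|F|)%N.
elim: n F le_n => // n IH F le_n Fs.
have {IH}IH G : F \proper G -> exists al : X -> int,
    G \in s -> \sum_x al x = 0 /\
    forall H, H \in s -> \sum_(x in H) al x = (H == G)%:R.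
  move=> FG; have [Gs|Gs] := boolP (G \in s); last by exists (fun=> 0).
  have [|//|al alP] := IH G; last by exists al.
  rewrite ltnS in le_n; apply: leq_trans le_n.
  exact: card_proper_ltn.
pose al G : X -> int :=
  if pselect (F \proper G) is left p then projT1 (cid (IH G p)) else fun=> 0.
have alP G : F \proper G -> G \in s -> \sum_x al G x = 0 /\
    forall H, H \in s -> \sum_(x in H) al G x = (H == G)%:R.
  by rewrite /al => FG Gs; case: pselect => // p; case: cid => al' /= /(_ Gs).
have [xF xFF xFP] := sepD.1 _ _ sD (mem_coverD sD Fs).
have [x0 x0P] := sepD.2 _ sD.
have deltaE (A : {set X}) x : \sum_(y in A) ((y == x)%:R : int) = (x \in A)%:R.
  have [xA|xA] := boolP (x \in A).
    by rewrite (bigD1 x) //= eqxx big1 ?addr0 // => y /andP[_ /negPf ->].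
  by rewrite big1 // => y yA; case: eqP => // E; rewrite -E yA in xA.
exists (fun x => (x == xF)%:R - (x == x0)%:R -
         \sum_(G in s | F \proper G) al G x); split.
  rewrite !sumrB exchange_big /= [X in _ - X]big1 ?subr0; last first.
    by move=> G /andP[Gs FG]; case: (alP G FG Gs).
  have deltaT x : \sum_y ((y == x)%:R : int) = 1.
    by rewrite (bigD1 x) //= eqxx big1 ?addr0 // => y /negPf ->.
  by rewrite !deltaT subrr.
move=> G Gs; rewrite !sumrB exchange_big /= !deltaE (negPf (x0P _ Gs)) subr0.
have -> : (xF \in G) = (F \subset G).
  by apply/idP/idP => [/(xFP _ Gs)//|/fintype.subsetP]; apply.
under eq_bigr => H /andP[Hs FH] do rewrite (alP H FH Hs).2 //.
have [FG|FG] := boolP (F \proper G).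
  rewrite (bigD1 G) ?Gs //= eqxx big1 ?addr0; last first.
    by move=> H /andP[_ /negPf]; rewrite eq_sym => ->.
  by rewrite proper_sub // subrr; case: eqP FG => // ->; rewrite fintype.properxx.
rewrite big1 ?subr0; last first.
  by move=> H /andP[_ FH]; case: eqP => // E; rewrite E FH in FG.
by move: FG; rewrite finset.properEneq eq_sym; case: eqP => [->|//]; rewrite ?subxx //= => _ /negPf ->.
Qed.

End Separated.

(** * Closedness of polyhedral cones *)

(** If each index failed below a threshold of its own, all would fail below the smallest one. It is
    applied to a segment inside a finite union of cones: one of them meets it arbitrarily close to
    its origin. *)
Lemma small_pigeon (R : realType) (I : finType) (P : I -> R -> Prop) :
  (forall e0, 0 < e0 -> exists i e, 0 < e <= e0 /\ P i e) ->
  exists i, forall e0, 0 < e0 -> exists e, 0 < e <= e0 /\ P i e.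
Proof.
move=> H; apply: contrapT => nH.
have {}nH i : exists e0, 0 < e0 /\ forall e, 0 < e <= e0 -> ~ P i e.
  apply: contrapT => ni; apply: nH; exists i => e0 e00; apply: contrapT => ne.
  by apply: ni; exists e0; split=> // e ee Pe; apply: ne; exists e.
have [d dP] := choice nH.
have d0 : 0 < \big[Num.min/1]_i d i.
  by apply/bigmin_gtP; split=> // i _; case: (dP i).
have [i [e [/andP[e0 ed] Pie]]] := H _ d0.
have [_ /(_ e)] := dP i; apply=> //; rewrite e0 /=.
exact: le_trans ed (bigmin_le _ _ _).
Qed.

Lemma affine_neg (R : realFieldType) (A M e1 : R) : A + (0 - e1) * M < 0 ->
  exists2 e0, 0 < e0 & forall e, 0 < e <= e0 -> A + (e - e1) * M < 0.
Proof.
move=> neg; have [M0|M0] := leP M 0.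
  exists 1; first exact: ltr01.
  move=> e /andP[e0 _].
  have : e * M <= 0 by rewrite mulr_ge0_le0 // ltW.
  by move: neg; lra.
exists (- (A + (0 - e1) * M) / M / 2).
  by rewrite !divr_gt0 ?oppr_gt0.
move=> e /andP[e0 ele].
have : e * M <= - (A + (0 - e1) * M) / 2.
  by rewrite -ler_pdivlMr // mulrAC.
by move: neg; lra.
Qed.

Section Cones.
Variables (R : realType) (X I : finType) (g : I -> trop_vec R X).
Implicit Types (B : {set I}) (v w z : trop_vec R X).

Lemma cone_overD B v w :
  cone_over g B v -> cone_over g B w -> cone_over g B (v + w).
Proof.
move=> [a [t [a0 ->]]] [b [u [b0 ->]]]; exists (a \+ b), (t + u); split.
  by move=> i iB; rewrite addr_ge0 ?a0 ?b0.
rewrite addrACA -big_split /= scalerDl; congr (_ + _).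
by apply: eq_bigr => i _; rewrite scalerDl.
Qed.

Lemma cone_overZ B k v : 0 <= k -> cone_over g B v -> cone_over g B (k *: v).
Proof.
move=> k0 [a [t [a0 ->]]]; exists (fun i => k * a i), (k * t); split.
  by move=> i iB; rewrite mulr_ge0 ?a0.
rewrite scalerDr scaler_sumr scalerA; congr (_ + _).
by apply: eq_bigr => i _; rewrite scalerA.
Qed.

Lemma cone_over_ones B t : cone_over g B (t *: ones R X).
Proof.
by exists (fun=> 0), t; split=> //; rewrite big1 ?add0r // => i _; rewrite scale0r.
Qed.

Lemma cone_over_gen B i : i \in B -> cone_over g B (g i).
Proof.
move=> iB; exists (fun j => (j == i)%:R), 0; split; first by move=> *; rewrite ler0n.
rewrite scale0r addr0 (bigD1 i) //= eqxx scale1r big1 ?addr0 //.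
by move=> j /andP[_ /negPf ->]; rewrite scale0r.
Qed.

Lemma cone_over_sub B B' v : B \subset B' ->
  cone_over g B v -> cone_over g B' v.
Proof.
move=> BB' [a [t [a0 ->]]]; exists (fun i => if i \in B then a i else 0), t.
split; first by move=> i _; case: ifP => // /a0.
congr (_ + _); rewrite big_mkcond [RHS]big_mkcond; apply: eq_bigr => i _.
have [iB|_] := boolP (i \in B); first by rewrite (fintype.subsetP BB' _ iB).
by case: ifP => // _; rewrite scale0r.
Qed.

(* Caratheodory's argument. *)
Lemma cone_over_dep B (c : I -> R) t i0 : i0 \in B -> c i0 != 0 ->
  \sum_(i in B) c i *: g i + t *: ones R X = 0 ->
  forall v, cone_over g B v -> exists2 i, i \in B & cone_over g (B :\ i) v.
Proof.
wlog c0 : c t / 0 < c i0 => [H|] i0B ci0 E v.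
  have [|neg|/eqP] := ltgtP (c i0) 0; last by rewrite (negPf ci0).
    move=> neg; apply: (H (fun i => - c i) (- t)) => //; rewrite ?oppr_gt0 ?oppr_eq0 //.
    by rewrite scaleNr; under eq_bigr do rewrite scaleNr; rewrite sumrN -opprD E oppr0.
  exact: (H c t).
move=> [a [u [a0 ->]]].
pose Q i := (i \in B) && (0 < c i).
have Pi0 : Q i0 by rewrite /Q i0B.
case: (@Order.TotalTheory.arg_minP _ _ _ _ Q (fun i => a i / c i) Pi0) => j /andP[jB cj] jmin.
exists j => //; pose k := a j / c j.
have k0 : 0 <= k by rewrite divr_ge0 ?a0 // ltW.
exists (fun i => a i - k * c i), (u - k * t); split.
  move=> i /setD1P[_ iB]; rewrite subr_ge0.
  have [ci|ci] := ltP 0 (c i); last first.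
    by apply: le_trans (a0 _ iB); rewrite mulr_ge0_le0.
  by rewrite -ler_pdivlMr // jmin // /Q iB.
have -> : \sum_(i in B :\ j) (a i - k * c i) *: g i =
          \sum_(i in B) (a i - k * c i) *: g i.
  rewrite [RHS](big_setD1 j) //= /k divfK ?subrr ?scale0r ?add0r //.
  by rewrite gt_eqF.
apply/eqP; rewrite -subr_eq0 opprD addrACA -sumrB -scalerBl subKr.
rewrite (eq_bigr (fun i => k *: (c i *: g i))); last first.
  by move=> i _; rewrite -scalerBl subKr scalerA.
by rewrite -scaler_sumr -(scalerA k t) -scalerDr E scaler0.
Qed.

(** Induction on the number of generators. If they are dependent modulo [ones], every point uses one
    generator fewer, and the pigeonhole fixes which. If they are independent, the coefficients of z
    + e w are affine in e, and one that is negative at e = 0 would stay negative for small e. *)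
Lemma cone_over_closed B z w :
  (forall e0, 0 < e0 -> exists e, 0 < e <= e0 /\ cone_over g B (z + e *: w)) ->
  cone_over g B z.
Proof.
have [n le_n] := ubnP #|B|; elim: n B le_n => // n IH B; rewrite ltnS => le_n H.
have [[c [t [E [i0 i0B ci0]]]]|ind] := pselect (exists c t,
    \sum_(i in B) c i *: g i + t *: ones R X = 0 /\ exists2 i, i \in B & c i != 0).
  pose P (i : I) e := i \in B /\ cone_over g (B :\ i) (z + e *: w).
  have [|i iP] := @small_pigeon R I P.
    move=> e0 /H [e [ee /(cone_over_dep i0B ci0 E) [i iB Pi]]].
    by exists i, e; split.
  have [_ [_ [iB _]]] := iP _ ltr01.
  apply: (cone_over_sub (finset.subD1set B i)); apply: IH.
    by apply: leq_trans le_n; rewrite [X in (_ < X)%N](cardsD1 i) iB.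
  by move=> e0 /iP [e [ee [_ Pe]]]; exists e.
have {}ind c t : \sum_(i in B) c i *: g i + t *: ones R X = 0 ->
    forall i, i \in B -> c i = 0.
  move=> E i iB; apply/eqP/negP => /negP ci; apply: ind.
  by exists c, t; split=> //; exists i.
have [e1 [/andP[e1_gt0 _] [a1 [t1 [_ E1]]]]] := H _ ltr01.
have he1 : 0 < e1 / 2 by rewrite divr_gt0.
have [e2 [/andP[e2_gt0 e2le] [a2 [t2 [_ E2]]]]] := H _ he1.
have e12 : e2 < e1 by lra.
have d0 : e1 - e2 != 0 by rewrite subr_eq0 gt_eqF.
(* [m] and [mt] are the slopes of the coefficients, read off from the two parameters [e1] and [e2];
   [L e] is the resulting affine interpolation. *)
pose m i := (a1 i - a2 i) / (e1 - e2).
pose mt := (t1 - t2) / (e1 - e2).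
pose L e := (\sum_(i in B) (a1 i + (e - e1) * m i) *: g i +
      (t1 + (e - e1) * mt) *: ones R X : trop_vec R X).
have LE e : z + e *: w = L e.
  apply: (@scalerI _ _ (e1 - e2)) => //.
  have -> : (e1 - e2) *: (z + e *: w) =
     (e - e2) *: (z + e1 *: w) - (e - e1) *: (z + e2 *: w).
    by apply/ffunP => x; rewrite !ffunE /GRing.scale /=; ring.
  rewrite E1 E2 /L !scalerDr !scaler_sumr !scalerA opprD addrACA -sumrB.
  rewrite -scalerBl; congr (_ + _ *: _).
    apply: eq_bigr => i _; rewrite !scalerA -scalerBl; congr (_ *: _).
    by rewrite /m; field.
  by rewrite /mt; field.
exists (fun i => a1 i + (0 - e1) * m i), (t1 + (0 - e1) * mt); split; last first.
  by rewrite -[LHS]addr0 -[X in _ + X](scale0r w) LE.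
move=> i iB; rewrite leNgt; apply/negP => neg.
have [e0 e00 eneg] := affine_neg neg.
have [e [ee [a [t [a0 E]]]]] := H _ e00.
suff ai : a i = a1 i + (e - e1) * m i by have := eneg _ ee; rewrite -ai ltNge a0.
apply/eqP; rewrite -subr_eq0; apply/eqP.
apply: (ind (fun i => a i - (a1 i + (e - e1) * m i)) (t - (t1 + (e - e1) * mt)));
  last exact: iB.
rewrite scalerBl; under eq_bigr do rewrite scalerBl.
by rewrite sumrB addrACA -opprD -E LE /L subrr.
Qed.

End Cones.

(** * The fan of a separated complex *)

Section Fans.
Variables (R : realType) (X : finType) (Delta : {set {set {set X}}}).
Implicit Types (s : {set {set X}}) (F G : {set X}) (v : trop_vec R X).
Local Notation cone := (cone_over (@indic R X)).
Hypothesis sepD : separated Delta.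
Hypothesis downD : down_closed Delta.

Lemma pair_comb (al : X -> R) s a t :
  \sum_x al x * comb s a t x =
  \sum_(F in s) a F * (\sum_(x in F) al x) + t * \sum_x al x.
Proof.
under eq_bigr => x _ do rewrite combE mulrDr mulr_sumr.
rewrite big_split /= exchange_big /= mulr_sumr; congr (_ + _).
  apply: eq_bigr => F _; rewrite mulr_sumr [RHS]big_mkcond.
  by apply: eq_bigr => x _; case: (x \in F); rewrite ?mulr1 ?mulr0 // mulrC.
by apply: eq_bigr => x _; rewrite mulrC.
Qed.

Lemma dual_functionalR s F : s \in Delta -> F \in s ->
  exists al : X -> R, \sum_x al x = 0 /\
    forall G, G \in s -> \sum_(x in G) al x = (G == F)%:R.
Proof.
move=> sD Fs; have [al [al0 alP]] := dual_functional sepD sD Fs.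
exists (fun x => (al x)%:~R); split; first by rewrite -rmorph_sum al0.
by move=> G Gs; rewrite -rmorph_sum alP //= natz -pmulrn.
Qed.

Lemma comb_coef s (a a' : {set X} -> R) t t' : s \in Delta ->
  comb s a t = comb s a' t' -> forall F, F \in s -> a F = a' F.
Proof.
move=> sD E F Fs; have [al [al0 alP]] := dual_functionalR sD Fs.
have key (b : {set X} -> R) u : \sum_x al x * comb s b u x = b F.
  rewrite pair_comb al0 mulr0 addr0 (bigD1 F) //= alP // eqxx mulr1.
  rewrite big1 ?addr0 // => G /andP[Gs GF].
  by rewrite alP // (negPf GF) mulr0.
by rewrite -(key a t) E key.
Qed.

Lemma separated_fan_over T : finset.set0 \in Delta ->
  T = (fun v => exists s, s \in Delta /\ cone s v) ->
  fan_over Delta (@indic R X) T.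
Proof.
move=> D0 TE; split=> //; last by move=> s s' sD s'D; apply: (coneI R sepD).
move=> s sD a t E i si.
have E' : comb s a t = comb s (fun=> 0) 0.
  rewrite [LHS]E /comb scale0r addr0. by rewrite big1 // => ? *; exact: scale0r.
exact: (comb_coef sD E').
Qed.

Definition fan_of : set (set (trop_vec R X)) :=
  fun C => exists s, s \in Delta /\ C = cone s.

Lemma polyhedral_cone_over s : polyhedral_cone (cone s).
Proof.
exists #|s|, (fun i => indic R (enum_val i)); apply/seteqP; split=> v /=.
  move=> [a [t [a0 ->]]]; exists (fun i => a (enum_val i)), t; split.
    by move=> i _; rewrite a0 ?enum_valP.
  congr (_ + _); rewrite (big_enum_val (fun F => a F *: indic R F)) /=.
  by apply: eq_bigl => i; rewrite inE.
move=> [a [t [a0 ->]]]; exists (fun F => \sum_(i | enum_val i == F) a i), t; split.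
  by move=> F _; apply: sumr_ge0 => i _; rewrite a0 ?inE.
congr (_ + _); rewrite (big_enum_val (fun F => (\sum_(i | enum_val i == F) a i) *: indic R F)) /=.
apply: eq_big => [i|i _]; first by rewrite inE.
congr (_ *: _).
rewrite (bigD1 i) //= big1 ?addr0 // => j /andP[/eqP /enum_val_inj ->].
by rewrite eqxx.
Qed.

Lemma cone_onesN s t : cone s (t *: ones R X).
Proof. exact: cone_over_ones. Qed.

(** Both [ones] and its opposite lie in every cone. *)
Lemma face_ones (al : X -> R) s : (forall v, cone s v -> 0 <= \sum_x al x * v x) ->
  \sum_x al x = 0.
Proof.
move=> H; have E t : \sum_x al x * (t *: ones R X) x = t * \sum_x al x.
  by rewrite mulr_sumr; apply: eq_bigr => x _; rewrite !ffunE [_ *: _]mulr1 mulrC.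
have := H _ (cone_onesN s 1); have := H _ (cone_onesN s (-1)).
by rewrite !E mul1r mulN1r oppr_ge0 => le0 ge0; apply/le_anti/andP.
Qed.

(** The functional is a sum of nonnegative terms on the cone, so it vanishes exactly where the
    members of [s] with positive value have coefficient 0. *)
Lemma face_cone s (F : set (trop_vec R X)) : face_of F (cone s) ->
  exists2 s' : {set {set X}}, s' \subset s & F = cone s'.
Proof.
move=> [al [al0 ->]]; have al1 := face_ones al0.
pose s' := [set G in s | \sum_(x in G) al x == 0].
have gen G : G \in s -> 0 <= \sum_(x in G) al x.
  move=> Gs; have := al0 _ (cone_over_gen (@indic R X) Gs).
  congr (0 <= _); rewrite [RHS]big_mkcond; apply: eq_bigr => x _.
  by rewrite indicE; case: (x \in G); rewrite ?mulr1 ?mulr0.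
have ss' : s' \subset s by apply/fintype.subsetP => G; rewrite inE => /andP[].
exists s' => //; apply/seteqP; split=> v /=.
  move=> [[a [t [a0 ->]]]]; rewrite -/(comb s a t) pair_comb al1 mulr0 addr0 => E.
  exists a, t; split; first by move=> G /(fintype.subsetP ss')/a0.
  congr (_ + _); rewrite big_mkcond [RHS]big_mkcond; apply: eq_bigr => G _.
  rewrite inE; case: (boolP (G \in s)) => //= Gs; case: ifP => // /negP nz.
  have -> : a G = 0; last by rewrite scale0r.
  move/eqP: E; rewrite psumr_eq0; last by move=> H Hs; rewrite mulr_ge0 ?a0 ?gen.
  by move=> /allP /(_ G); rewrite mem_index_enum Gs mulf_eq0 => /(_ isT) /orP[/eqP|].
move=> cv; split; first exact: cone_sub cv.
move: cv => [a [t [a0 ->]]]; rewrite -/(comb s' a t) pair_comb al1 mulr0 addr0.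
by apply: big1 => G; rewrite inE => /andP[_ /eqP ->]; rewrite mulr0.
Qed.

(** The supporting functional is the sum of the functionals dual to the members of [s] outside [s'];
    its value at a point is the sum of their coefficients. *)
Lemma cone_face s s' : s \in Delta -> s' \subset s -> face_of (cone s') (cone s).
Proof.
move=> sD ss'.
pose al F := if pselect (F \in s) is left p
  then projT1 (cid (dual_functionalR sD p)) else fun=> 0.
have alP F : F \in s -> \sum_x al F x = 0 /\
    forall G, G \in s -> \sum_(x in G) al F x = (G == F)%:R.
  by rewrite /al => Fs; case: pselect => // p; case: cid.
pose be x := \sum_(F in s :\: s') al F x.
have be0 : \sum_x be x = 0.
  rewrite exchange_big big1 // => F /finset.setDP[Fs _]; exact: (alP F Fs).1.
have beP G : G \in s -> \sum_(x in G) be x = (G \notin s')%:R.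
  move=> Gs; rewrite exchange_big /=.
  rewrite (eq_bigr (fun F => (G == F)%:R)); last first.
    by move=> F /finset.setDP[Fs _]; rewrite (alP F Fs).2.
  have [Gs'|Gs'] := boolP (G \in s').
    by rewrite big1 // => F /finset.setDP[_ Fs']; case: eqP => // E; rewrite -E Gs' in Fs'.
  rewrite (bigD1 G) ?inE ?Gs ?Gs' //= eqxx big1 ?addr0 // => F /andP[_ /negPf].
  by rewrite eq_sym => ->.
have val a t : \sum_x be x * comb s a t x = \sum_(F in s :\: s') a F.
  rewrite pair_comb be0 mulr0 addr0 big_mkcond [RHS]big_mkcond; apply: eq_bigr => F _.
  rewrite inE andbC; case: (boolP (F \in s)) => //= Fs.
  by rewrite beP //; case: (F \in s'); rewrite ?mulr0 ?mulr1.
exists be; split.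
  move=> v [a [t [a0 ->]]]; rewrite -/(comb s a t) val.
  by apply: sumr_ge0 => F /finset.setDP[/a0].
apply/seteqP; split=> v /=; last first.
  move=> [[a [t [a0 ->]]]]; rewrite -/(comb s a t) val => /eqP.
  rewrite psumr_eq0; last by move=> F /finset.setDP[/a0].
  move=> /allP az; exists a, t; split; first by move=> F /(fintype.subsetP ss')/a0.
  congr (_ + _); rewrite big_mkcond [RHS]big_mkcond; apply: eq_bigr => F _.
  have := az F; rewrite mem_index_enum inE => /(_ isT).
  case: (boolP (F \in s')) => [/(fintype.subsetP ss') ->|] //= _.
  by case: (F \in s) => //= /eqP ->; rewrite scale0r.
move=> cv; split; first exact: cone_sub cv.
move: cv => [a [t [a0 ->]]]; rewrite -/(comb s' a t) (comb_sub _ _ ss') val.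
by apply: big1 => F /finset.setDP[_ /negPf ->].
Qed.

Lemma separated_is_fan : is_fan fan_of.
Proof.
split.
- have -> : fan_of = (cone @` [set` Delta])%classic.
    apply/seteqP; split=> C /=; first by move=> [s [sD ->]]; exists s.
    by move=> [s sD <-]; exists s.
  by apply: finite_image.
- by move=> C [s [_ ->]]; apply: polyhedral_cone_over.
- move=> C F [s [sD ->]] /face_cone [s' ss' ->]; exists s'; split=> //.
  exact: downD ss'.
- move=> C D [s [sD ->]] [s' [s'D ->]]; rewrite (coneI R sepD) //.
  by split; apply: cone_face; rewrite ?finset.subsetIl ?finset.subsetIr.
Qed.

End Fans.

(** * Coarsest fan structure *)

Section Coarsest.
Variables (R : realType) (X : finType) (Delta : {set {set {set X}}}).
Implicit Types (s : {set {set X}}) (F G : {set X}) (v : trop_vec R X).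
Local Notation cone := (cone_over (@indic R X)).
Hypothesis sepD : separated Delta.
Hypothesis downD : down_closed Delta.

(** Together with [s] this gives three cones along the wall opposite to each [F]. *)
Definition branching s := forall F, F \in s -> exists G G',
  [/\ G != G', G \notin s /\ G' \notin s, G |: (s :\ F) \in Delta
    & G' |: (s :\ F) \in Delta].

Hypothesis facetD : forall s, s \in Delta -> exists t : {set {set X}},
  [/\ t \in Delta, s \subset t,
      forall t', t' \in Delta -> t \subset t' -> t' = t & branching t].

(* Moving the negative coefficients to the other side makes the uniqueness of
   nonnegative representations applicable. *)
Lemma comb_new_ray r s G (b : R) (d : {set X} -> R) t :
  G |: r \in Delta -> s \in Delta -> r \subset s -> G \notin s -> 0 < b ->
  (forall F, F \in s -> F \notin r -> 0 <= d F) ->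
  b *: indic R G = comb s d t -> False.
Proof.
move=> GrD sD rs Gs b0 d0 E.
have Gr : G \notin r by apply: contra Gs; apply: (fintype.subsetP rs).
pose dn F := if F == G then b else Num.max 0 (- d F).
pose dp F := Num.max 0 (d F).
have dn0 F : F \in G |: r -> 0 <= dn F.
  by move=> _; rewrite /dn; case: ifP => _; rewrite ?(ltW b0) // le_max lexx.
have dp0 F : F \in s -> 0 <= dp F by move=> _; rewrite /dp le_max lexx.
have EE : comb (G |: r) dn 0 = comb s dp t.
  have -> : comb s dp t = comb s d t + comb s (fun F => Num.max 0 (- d F)) 0.
    rewrite combD addr0; congr (_ + _); apply: eq_bigr => F _; congr (_ *: _).
    rewrite /dp /=; have [dF|dF] := leP 0 (d F).
      by rewrite !max_l ?addr0 // oppr_le0.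
    by rewrite !max_r ?subrr ?ltW ?oppr_gt0.
  rewrite -E /comb scale0r !addr0 big_setU1 //= /dn eqxx; congr (_ + _).
  rewrite [RHS](big_setID r) /= (finset.setIidPr rs) [X in _ + X]big1 ?addr0.
    apply: eq_bigr => F Fr; case: eqP => // E'; by rewrite -E' Fr in Gr.
  move=> F /finset.setDP[Fs Fr]; rewrite max_l ?scale0r // oppr_le0 d0 //.
have [_ /(_ G)] := comb_uniq sepD GrD sD dn0 dp0 EE.
rewrite !inE eqxx /= (negPf Gs) /dn eqxx => b00.
by rewrite b00 ltxx in b0.
Qed.

(** By [comb_new_ray] the coefficient of [F] must be negative both in [G] and in [G']. Eliminating
    [F] between the two expressions writes a positive multiple of [G] as a positive multiple of [G']
    plus a combination of the wall, which [comb_new_ray] excludes for the cone of [G']. *)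
Lemma branch_not_span s F G G' (b b' : {set X} -> R) t t' :
  s \in Delta -> F \in s -> G != G' -> G \notin s -> G' \notin s ->
  G |: (s :\ F) \in Delta -> G' |: (s :\ F) \in Delta ->
  indic R G = comb s b t -> indic R G' = comb s b' t' -> False.
Proof.
move=> sD Fs GG' Gs G's GD G'D E E'.
have subs : s :\ F \subset s := finset.subD1set s F.
have onlyF (d : {set X} -> R) : 0 <= d F ->
    forall H, H \in s -> H \notin s :\ F -> 0 <= d H.
  by move=> dF H Hs; rewrite !inE Hs andbT negbK => /eqP ->.
have [bF|bF] := leP 0 (b F).
  apply: (comb_new_ray GD sD subs Gs ltr01 (onlyF _ bF)).
  by rewrite scale1r E.
have [b'F|b'F] := leP 0 (b' F).
  apply: (comb_new_ray G'D sD subs G's ltr01 (onlyF _ b'F)).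
  by rewrite scale1r E'.
pose d H := if H == G' then - b F else - b' F * b H + b F * b' H.
have G'sF : G' \notin s :\ F by apply: contra G's; apply: (fintype.subsetP subs).
apply: (@comb_new_ray (s :\ F) (G' |: (s :\ F)) G (- b' F) d (- b' F * t + b F * t')
  GD G'D (finset.subsetUr _ _)).
- rewrite !inE negb_or GG' /= negb_and negbK; by rewrite Gs orbT.
- by rewrite oppr_gt0.
- move=> H; rewrite !inE => /orP[/eqP ->|/= ->]; last by [].
  by rewrite /d eqxx oppr_ge0 ltW.
have -> : - b' F *: indic R G = (- b' F *: comb s b t + b F *: comb s b' t') -
   b F *: indic R G'.
  by rewrite -E -E' addrK.
rewrite !combZ combD /comb big_setU1 //= [X in _ + X - _ = _](_ : _ = (- b' F * t + b F * t') *: ones R X) //.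
rewrite addrAC; congr (_ + _).
rewrite {1}/d eqxx (big_setD1 F) //= [X in X *: indic R F](_ : _ = 0); last by ring.
rewrite scale0r add0r addrC scaleNr; congr (_ + _).
by apply: eq_bigr => H HsF; rewrite /d; case: eqP => // HG; rewrite -HG HsF in G'sF.
Qed.

Definition relint (M : set (trop_vec R X)) z :=
  M z /\ forall y, M y -> exists2 e, 0 < e & M (z - e *: y).

(** Let [M] be a maximal cone of another fan with the same support. Near its relative interior the
    support is [M], so [M] spans the same space as some facet [s]. If [M] left the cone of [s], it
    would cross a wall of [s] in its relative interior and contain directions into two further cones
    along that wall, which do not both lie in the span of [s]. *)
Lemma separated_coarsest T : T = Defs.support (@fan_of R X Delta) ->
  coarsest_fan_structure T (@fan_of R X Delta).
Proof.
move=> TE; split; rewrite ?TE //; first exact: separated_is_fan.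
move=> S' [finS' polS' faceS' capS'] suppS' C' S'C'.
have coneT s : s \in Delta -> (cone s `<=` Defs.support S')%classic.
  move=> sD v cv; rewrite suppS'; exists (cone s); split=> //; by exists s.
have [l lE] := (finite_seqP S').1 finS'.
pose f (i : 'I_(size l)) := nth classical_sets.set0 l i.
have fP i : S' (f i) by rewrite lE /=; apply: mem_nth.
have fS C : S' C -> exists i, C = f i.
  rewrite {1}lE /= => Cl; have i0 : (index C l < size l)%N by rewrite index_mem.
  by exists (Ordinal i0); rewrite /f /= nth_index.
have [i0 Ci0] := fS _ S'C'.
pose ups i := [set j | `[< (f i `<=` f j)%classic >]].
have Pi0 : `[< (C' `<=` f i0)%classic >] by apply/asboolP; rewrite Ci0.
(* A cone containing [C'] with the fewest cones of [S'] above it is maximal. *)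
case: (@arg_minnP _ i0 (fun i => `[< (C' `<=` f i)%classic >]) (fun i => #|ups i|) Pi0).
move=> iM /asboolP CM iMmin; set M := f iM in CM *.
have S'M : S' M := fP iM.
have Mmax D : S' D -> (M `<=` D)%classic -> D = M.
  move=> /fS [j ->] Mj; apply/seteqP; split=> //.
  have : (ups j == ups iM).
    rewrite eqEcard iMmin ?andbT; last first.
      by apply/asboolP; apply: classical_sets.subset_trans CM Mj.
    apply/fintype.subsetP => k; rewrite !finset.in_set => /asboolP jk; apply/asboolP.
    exact: classical_sets.subset_trans Mj jk.
  move=> /eqP /setP /(_ iM); rewrite !finset.in_set.
  by rewrite [X in _ = X](asboolT (@classical_sets.subset_refl _ _)) => /asboolP.
have [n [g ME]] := polS' _ S'M.
have MD v w : M v -> M w -> M (v + w) by rewrite ME; apply: cone_overD.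
have MZ k v : 0 <= k -> M v -> M (k *: v) by rewrite ME; apply: cone_overZ.
(* The sum of the generators is a relative interior point: dividing y by 1 plus the sum of its
   coefficients makes it small enough to be subtracted. *)
have [z0 z0M] : exists z, relint M z.
  exists (\sum_i g i); split.
    rewrite ME; elim/big_ind: _ => [|v w|i _]; last by apply: cone_over_gen; rewrite inE.
      by rewrite -(scale0r (ones R X)); apply: cone_over_ones.
    exact: cone_overD.
  move=> y; rewrite ME => -[a [t [a0 ->]]].
  exists (1 + \sum_(i in [set: 'I_n]) a i)^-1.
    by rewrite invr_gt0 ltr_wpDr // sumr_ge0.
  set S := 1 + _; have S0 : 0 < S by rewrite ltr_wpDr // sumr_ge0.
  exists (fun i => 1 - S^-1 * a i), (- (S^-1 * t)); split.
    move=> i iT; rewrite subr_ge0 mulrC ler_pdivrMr // mul1r /S (bigD1 i) //=.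
    rewrite addrCA lerDl addr_ge0 // sumr_ge0 // => j /andP[jT _]; exact: a0.
  rewrite scalerDr opprD addrA scalerA scaleNr; congr (_ + _).
  rewrite scaler_sumr [X in X - _](eq_bigl (fun i => i \in [set: 'I_n])); last first.
    by move=> i; rewrite inE.
  by rewrite -sumrB; apply: eq_bigr => i _; rewrite scalerA scalerBl scale1r.
have relD x y : relint M x -> M y -> relint M (x + y).
  move=> [Mx xM] My; split; first exact: MD.
  by move=> y' /xM [e e0 Me]; exists e => //; rewrite addrAC; apply: MD.
have relZ k x : 0 < k -> relint M x -> relint M (k *: x).
  move=> k0 [Mx xM]; split; first by apply: MZ => //; apply: ltW.
  move=> y /xM [e e0 Me]; exists (k * e); first exact: mulr_gt0.
  by rewrite -scalerA -scalerBr; apply: MZ => //; apply: ltW.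
(* The intersection with [D] is a face of [M], and a face containing a relative interior point is
   all of [M]. *)
have rel_sub z D : relint M z -> S' D -> D z -> (M `<=` D)%classic.
  move=> [Mz zM] S'D Dz y My; have [[al [al0 E]] _] := capS' _ _ S'M S'D.
  have : (M `&` D)%classic z by [].
  rewrite E => -[_ az].
  have [e e0 Me] := zM _ My.
  suff : (M `&` D)%classic y by case.
  rewrite E; split=> //; apply/le_anti; rewrite al0 // andbT.
  have := al0 _ Me.
  have -> : \sum_x al x * (z - e *: y) x =
      \sum_x al x * z x - e * \sum_x al x * y x.
    rewrite mulr_sumr -sumrB; apply: eq_bigr => x _.
    by rewrite !ffunE /GRing.scale /=; ring.
  rewrite az sub0r.
  by rewrite oppr_ge0 pmulr_rle0.
(* Some cone of [S'] contains points z + e w with e arbitrarily small. It contains z by closedness,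
   hence contains [M], hence is [M]. *)
have local z w : relint M z ->
    (forall e, 0 < e -> Defs.support S' (z + e *: w)) ->
    exists2 e, 0 < e & M (z + e *: w).
  move=> zM H; pose P i e := f i (z + e *: w).
  have [|i iP] := @small_pigeon R 'I_(size l) P.
    move=> e0 e00; have [C [/fS [i ->] Ci]] := H _ e00.
    by exists i, e0; rewrite e00 lexx.
  have Di : f i z.
    have [m [h hE]] := polS' _ (fP i); rewrite hE; apply: (@cone_over_closed _ _ _ _ _ z w).
    by move=> e0 /iP; rewrite /P hE.
  have -> : M = f i by rewrite (Mmax _ (fP i) (rel_sub _ _ zM (fP i) Di)).
  by have [e [/andP[e0 _] Pe]] := iP _ ltr01; exists e.
have local_rel z w : relint M z ->
    (forall e, 0 < e -> Defs.support S' (z + e *: w)) ->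
    exists2 e, 0 < e & relint M (z + e *: w).
  move=> zM /(local _ _ zM) [e e0 Me]; exists (2^-1 * e).
    by rewrite mulr_gt0 // invr_gt0 ltr0n.
  have -> : z + (2^-1 * e) *: w = 2^-1 *: z + 2^-1 *: (z + e *: w).
    by apply/ffunP => x; rewrite !ffunE /GRing.scale /=; field.
  by apply: relD; [apply: relZ|apply: MZ]; rewrite ?invr_ge0 ?invr_gt0 ?ler0n ?ltr0n.
have z0T : Defs.support S' z0 by exists M; split=> //; case: z0M.
move: z0T; rewrite suppS' => -[_ [[s0 [s0D ->]] z0s0]].
have [s [sD s0s smax sbr]] := facetD s0D.
have coneDs e (F : {set {set X}}) z : F \subset s -> cone s z -> 0 < e ->
    cone s (z + e *: \sum_(G in F) indic R G).
  move=> Fs cz e0; apply: cone_overD => //; apply: cone_overZ; first exact: ltW.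
  elim/big_ind: _ => [|v w|G GF].
  - by rewrite -(scale0r (ones R X)); apply: cone_over_ones.
  - exact: cone_overD.
  by apply: cone_over_gen; apply: (fintype.subsetP Fs).
have sumE (F : {set {set X}}) : F \subset s ->
    \sum_(G in F) indic R G = comb s (fun G => (G \in F)%:R) 0.
  move=> Fs; rewrite /comb scale0r addr0 big_mkcond [RHS]big_mkcond.
  apply: eq_bigr => G _; have [GF|] := boolP (G \in F).
    by rewrite (fintype.subsetP Fs) // scale1r.
  by case: ifP => // _; rewrite scale0r.
have z0s : cone s z0 := cone_sub s0s z0s0.
(* Moving [z0] slightly along the sum of the members of [s] makes all its coefficients positive
   without leaving the relative interior of [M]. *)
have [x [xM [a [t [a0 xE]]]]] : exists x, relint M x /\
    exists a t, (forall F, F \in s -> 0 < a F) /\ x = comb s a t.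
  have [|e e0 eM] := local_rel _ (\sum_(G in s) indic R G) z0M.
    by move=> e e0; apply: (coneT s) => //; apply: coneDs.
  exists (z0 + e *: \sum_(G in s) indic R G); split=> //.
  move: z0s => [a [t [a0 ->]]]; rewrite sumE // combZ -/(comb s a t) combD.
  exists (fun G => a G + e * (G \in s)%:R), (t + e * 0); split=> // F Fs /=.
  by rewrite Fs mulr1 ltr_wpDl ?a0.
(* The points x + e y with e small lie in a common cone [r], which then contains x. The coefficients
   of x on [s] are positive, so [r] contains [s] and equals it by maximality. *)
have Mspan y : M y -> exists b u, y = comb s b u.
  move=> My; pose P (r : {set {set X}}) e := r \in Delta /\ cone r (x + e *: y).
  have [|r rP] := @small_pigeon R {set {set X}} P.
    move=> e0 e00; have : Defs.support S' (x + e0 *: y).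
      by exists M; split=> //; apply: MD; [case: xM|apply: MZ => //; apply: ltW].
    rewrite suppS' => -[_ [[r [rD ->]] cr]].
    by exists r, e0; rewrite e00 lexx.
  have [_ [_ [rD _]]] := rP _ ltr01.
  have cr : cone r x.
    apply: (@cone_over_closed _ _ _ _ _ x y) => e0 /rP [e [ee [_ Pe]]].
    by exists e.
  have sr : s \subset r.
    move: cr => [c [v [c0 E]]]; apply/fintype.subsetP => F Fs.
    have [_ /(_ F)] := comb_uniq sepD sD rD (fun F Fs => ltW (a0 F Fs)) c0 (etrans (esym xE) E).
    by rewrite Fs; case: ifP => // _ aF; move: (a0 _ Fs); rewrite aF ltxx.
  have rs := smax _ rD sr; rewrite rs in rP.
  have [e [/andP[e0 _] [_ [c [v [_ E]]]]]] := rP _ ltr01.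
  exists (fun F => e^-1 * (c F - a F)), (e^-1 * (v - t)).
  apply: (@scalerI _ _ e); first by rewrite gt_eqF.
  rewrite combZ.
  have -> : e *: y = comb s c v + (-1) *: comb s a t.
    by rewrite scaleN1r -xE /comb -E addrC addKr.
  rewrite combZ combD; congr (_ + _ *: _).
    by apply: eq_bigr => F _; congr (_ *: _) => /=; field; rewrite gt_eqF.
  by field; rewrite gt_eqF.
exists (cone s); split; first by exists s.
move=> y C'y; have My := CM _ C'y; apply: contrapT => ns.
have [b [u yE]] := Mspan _ My.
have [F0 F0s bF0] : exists2 F, F \in s & b F < 0.
  apply: contrapT => nF; apply: ns; exists b, u; split=> // F Fs.
  by rewrite leNgt; apply/negP => bF; apply: nF; exists F.
pose Q F := (F \in s) && (b F < 0).
have QF0 : Q F0 by rewrite /Q F0s.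
(* On the way from x in direction y, [F1] is a member of [s] whose coefficient vanishes first, at
   time [la]. *)
case: (@Order.TotalTheory.arg_minP _ _ _ _ Q (fun F => a F / - b F) QF0).
move=> F1 /andP[F1s bF1] F1min; pose la := a F1 / - b F1.
have la0 : 0 < la by rewrite divr_gt0 ?a0 ?oppr_gt0.
have z1M : relint M (x + la *: y) by apply: relD => //; apply: MZ => //; apply: ltW.
have z1E : x + la *: y = comb s (fun F => a F + la * b F) (t + la * u).
  by rewrite xE yE combZ combD.
have F10 : a F1 + la * b F1 = 0.
  by rewrite /la; field; rewrite lt_eqF.
have z1ge F : F \in s -> 0 <= a F + la * b F.
  move=> Fs; have [bF|bF] := leP 0 (b F).
    by rewrite addr_ge0 ?(ltW (a0 _ Fs)) // mulr_ge0 // ltW.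
  have := F1min F; rewrite /Q Fs bF => /(_ isT).
  rewrite -/la ler_pdivlMr ?oppr_gt0 // mulrN; lra.
have z1s : cone s (x + la *: y) by rewrite z1E; exists (fun F => a F + la * b F), (t + la * u).
(* [z2] has positive coefficients on the whole wall opposite to [F1] and is still in the relative
   interior of [M]. *)
have [|e e0 z2M] := local_rel _ (\sum_(G in s :\ F1) indic R G) z1M.
  by move=> e e0; apply: (coneT s) => //; apply: coneDs => //; apply: finset.subD1set.
set z2 := _ + _ in z2M.
have z2E : z2 = comb (s :\ F1) (fun F => a F + la * b F + e) (t + la * u).
  rewrite /z2 z1E sumE ?finset.subD1set // combZ combD mulr0 addr0.
  rewrite /comb [in LHS](big_setD1 F1) //= F10 add0r setD11 mulr0 scale0r add0r.
  by congr (_ + _); apply: eq_bigr => F ->; rewrite mulr1.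
have [G [G' [GG' [Gs G's] GD G'D]]] := sbr _ F1s.
(* From [z2] a step towards [H] stays in the support, hence in [M] when short, and [M] lies in the
   span of [s]. *)
have spanG H : H |: (s :\ F1) \in Delta -> exists b' u', indic R H = comb s b' u'.
  move=> HD; have [|e' e'0 Me'] := local _ (indic R H) z2M.
    move=> e' e'0; apply: (coneT _ HD); apply: cone_overD; last first.
      by apply: cone_overZ (ltW e'0) (cone_over_gen _ _); rewrite !inE eqxx.
    apply: (@cone_over_sub _ _ _ _ (s :\ F1)); first exact: finset.subsetUr.
    rewrite z2E; exists (fun F => a F + la * b F + e), (t + la * u); split=> //.
    by move=> F /setD1P[_ Fs]; rewrite addr_ge0 ?z1ge // ltW.
  have [c1 [u1 E1]] := Mspan _ Me'; have [c2 [u2 E2]] := Mspan _ z2M.1.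
  exists (fun F => e'^-1 * (c1 F - c2 F)), (e'^-1 * (u1 - u2)).
  apply: (@scalerI _ _ e'); first by rewrite gt_eqF.
  rewrite combZ.
  have -> : e' *: indic R H = comb s c1 u1 + (-1) *: comb s c2 u2.
    by rewrite scaleN1r -E1 -E2 addrC addKr.
  rewrite combZ combD; congr (_ + _ *: _).
    by apply: eq_bigr => F _; congr (_ *: _) => /=; field; rewrite gt_eqF.
  by field; rewrite gt_eqF.
have [b1 [u1 E1]] := spanG _ GD; have [b2 [u2 E2]] := spanG _ G'D.
exact: (branch_not_span sD F1s GG' Gs G's GD G'D E1 E2).
Qed.

End Coarsest.

(** * Lines and planes of F_3^4 *)
Definition digits3 : seq nat := [:: 0; 1; 2]%N.

(** The order is that of [g32_table], so the number of a line is also the number of its form. *)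
Definition reps : seq (seq nat) :=
  [:: [:: 1; 0; 0; 0]; [:: 0; 1; 0; 0]; [:: 1; 2; 0; 0]; [:: 1; 1; 0; 0]]%N
  ++ [seq [:: i; j; 0; 1]%N | i <- digits3, j <- digits3]
  ++ [seq [:: i; j; 1; 0]%N | i <- digits3, j <- digits3]
  ++ [seq [:: i; j; 1; 1]%N | i <- digits3, j <- digits3]
  ++ [seq [:: i; j; 1; 2]%N | i <- digits3, j <- digits3].

Definition rep k : seq nat := nth [::] reps k.

Definition vectors : seq (seq nat) :=
  [seq x :: s | x <- digits3, s <-
    [seq x :: s | x <- digits3, s <- [seq [:: x; y] | x <- digits3, y <- digits3]]].

Definition vlin (a : nat) (s : seq nat) (b : nat) (t : seq nat) : seq nat :=
  [seq ((a * nth 0 s k + b * nth 0 t k) %% 3)%N | k <- iota 0 4].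

(** All finite verifications run on lists of natural numbers; [dvec] and [digits] carry their
    results to row vectors over F_3. *)
Definition dvec (s : seq nat) : 'rV['F_3]_4 :=
  row4 (nth 0%N s 0)%:R (nth 0%N s 1)%:R (nth 0%N s 2)%:R (nth 0%N s 3)%:R.

Definition digits (v : 'rV['F_3]_4) : seq nat :=
  [:: v 0 (inord 0) : nat; v 0 (inord 1) : nat; v 0 (inord 2) : nat;
      v 0 (inord 3) : nat].

Lemma mem_iota0 n k : (k \in iota 0 n) = (k < n)%N.
Proof. by rewrite mem_iota. Qed.

Lemma row4E (T : nzRingType) (a b c d : T) (k : 'I_4) :
  row4 a b c d 0 k = nth 0 [:: a; b; c; d] k.
Proof. by rewrite mxE. Qed.

Lemma ord4P (P : 'I_4 -> Prop) :
  P (inord 0) -> P (inord 1) -> P (inord 2) -> P (inord 3) -> forall k, P k.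
Proof.
move=> P0 P1 P2 P3 k; rewrite -(inord_val k).
by case: k => [[|[|[|[|]]]]].
Qed.

Lemma row4P (T : nzRingType) (u v : 'rV[T]_4) :
  (forall k, u 0 k = v 0 k) <-> u = v.
Proof. by split=> [E|->//]; apply/rowP => k; rewrite E. Qed.

Lemma F3_nat (x : 'F_3) : (x : nat)%:R = x.
Proof. exact: natr_Zp. Qed.

Lemma F3_nat_lt (x : 'F_3) : ((x : nat) < 3)%N.
Proof. exact: (ltn_ord x). Qed.

Lemma nat_F3 n : ((n%:R : 'F_3) : nat) = (n %% 3)%N.
Proof. exact: (val_Fp_nat (isT : prime 3)). Qed.

Lemma F3_eq m n : ((m%:R : 'F_3) == n%:R) = (m == n %[mod 3])%N.
Proof. by rewrite -val_eqE /= !nat_F3. Qed.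

Lemma F3_mod n : ((n %% 3)%N%:R : 'F_3) = n%:R.
Proof. exact: (Fp_nat_mod (isT : prime 3)). Qed.

Lemma dvecE s k : dvec s 0 (inord k) = if (k < 4)%N then (nth 0%N s k)%:R else (nth 0%N s 0)%:R.
Proof.
rewrite row4E; case: (ltnP k 4) => k4; first by rewrite inordK //; case: k k4 => [|[|[|[|]]]].
by rewrite /inord /insubd insubN // -leqNgt.
Qed.

Lemma dvecEn s k : (k < 4)%N -> dvec s 0 (inord k) = (nth 0%N s k)%:R.
Proof. by move=> k4; rewrite dvecE k4. Qed.

Lemma digitsK v : dvec (digits v) = v.
Proof. by apply/row4P; apply: ord4P; rewrite dvecEn //= F3_nat. Qed.

Lemma mem_vectors s : (s \in vectors) = (size s == 4) && all (fun x => x < 3)%N s.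
Proof.
apply/idP/idP.
  by apply/allP : s; vm_compute.
case: s => [|a [|b [|c [|d []]]]] //=.
by case: a => [|[|[|]]] //; case: b => [|[|[|]]] //; case: c => [|[|[|]]] //;
  case: d => [|[|[|]]].
Qed.

Lemma digits_vectors v : digits v \in vectors.
Proof. by rewrite mem_vectors /= !F3_nat_lt. Qed.

Lemma dvec_vlin a s b t : dvec (vlin a s b t) = a%:R *: dvec s + b%:R *: dvec t.
Proof.
by apply/row4P; apply: ord4P; rewrite !mxE !inordK //= F3_mod natrD !natrM.
Qed.

Lemma dvec_inj : {in vectors &, injective dvec}.
Proof.
move=> s t; rewrite !mem_vectors.
case: s => [|a [|b [|c [|d []]]]] //= /and5P[a3 b3 c3 d3 _].
case: t => [|a' [|b' [|c' [|d' []]]]] //= /and5P[a3' b3' c3' d3' _].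
move/row4P => E.
have H k : (k < 4)%N -> nth 0%N [:: a; b; c; d] k = nth 0%N [:: a'; b'; c'; d'] k %[mod 3].
  by move=> k4; apply/eqP; rewrite -F3_eq -!dvecEn // E.
have := (H 0%N isT, H 1%N isT, H 2%N isT, H 3%N isT); rewrite /= !modn_small //.
by case=> -[[-> -> -> ->]].
Qed.

Lemma reps_vectors k : (k < 40)%N -> rep k \in vectors.
Proof.
move=> k40; have : all (fun k => rep k \in vectors) (iota 0 40) by vm_compute.
by move/allP; apply; rewrite mem_iota.
Qed.

Lemma vlin_vectors a s b t : vlin a s b t \in vectors.
Proof. by rewrite mem_vectors /= !ltn_pmod. Qed.

Definition nidx (s : seq nat) : nat :=
  find (fun r => (r == s) || (vlin 2 r 0 [::] == s)) reps.

Lemma dvec0 : dvec [::] = 0.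
Proof. by apply/row4P; apply: ord4P; rewrite dvecEn // mxE nth_nil. Qed.

Lemma dvec_eq0 s : s \in vectors -> (dvec s == 0) = (s == [:: 0; 0; 0; 0]%N).
Proof.
move=> sv; apply/eqP/eqP => [E|->]; last first.
  by apply/row4P; apply: ord4P; rewrite dvecEn // mxE.
apply: dvec_inj => //; rewrite E.
by apply/row4P; apply: ord4P; rewrite dvecEn // mxE.
Qed.

Lemma nidxP v : v != 0 -> let k := nidx (digits v) in
  (k < 40)%N /\ exists2 c : 'F_3, c != 0 & v = c *: dvec (rep k).
Proof.
move=> v0 k.
have dv := digits_vectors v.
have chk : all (fun s => (s == [:: 0; 0; 0; 0]%N) || (let k := nidx s in
   (k < 40)%N && ((rep k == s) || (vlin 2 (rep k) 0 [::] == s)))) vectors.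
  by vm_compute.
have := allP chk _ dv; rewrite -dvec_eq0 // digitsK (negPf v0) /= -/k.
move=> /andP[k40 /orP[/eqP E|/eqP E]]; split=> //.
  by exists 1; rewrite ?oner_eq0 // scale1r E digitsK.
exists 2%:R; first by rewrite (F3_eq 2 0).
by rewrite -[LHS]digitsK -E dvec_vlin dvec0 scaler0 addr0.
Qed.

Definition span_rep k : {set 'rV['F_3]_4} := [set v | (v <= dvec (rep k))%MS].

Lemma rep_neq0 k : (k < 40)%N -> dvec (rep k) != 0.
Proof.
move=> k40; rewrite dvec_eq0 ?reps_vectors //.
have : all (fun k => rep k != [:: 0; 0; 0; 0]%N) (iota 0 40) by vm_compute.
by move/allP; apply; rewrite mem_iota.
Qed.

Lemma rep_span j k : (j < 40)%N -> (k < 40)%N ->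
  (dvec (rep j) <= dvec (rep k))%MS = (j == k).
Proof.
move=> j40 k40; apply/idP/eqP => [|->]; last exact: submx_refl.
move=> /sub_rVP [c E].
have {}E : dvec (rep j) = dvec (vlin (c : nat) (rep k) 0 [::]).
  by rewrite dvec_vlin dvec0 scaler0 addr0 F3_nat.
have {E} := dvec_inj (reps_vectors j40) (vlin_vectors _ _ _ _) E.
have chk : all (fun j => all (fun k => all (fun c =>
   (rep j == vlin c (rep k) 0 [::]) ==> (j == k)) digits3) (iota 0 40)) (iota 0 40).
  by vm_compute.
move=> E; have cd : (c : nat) \in digits3.
  by case: (c : nat) (F3_nat_lt c) => [|[|[|]]].
have := allP (allP (allP chk j _) k _) _ cd; rewrite !mem_iota j40 k40 => /(_ isT isT).
by rewrite -E eqxx => /eqP.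
Qed.

Lemma subspace_line k : (k < 40)%N -> subspace_of_dim 1 (span_rep k).
Proof.
move=> k40; apply/existsP; exists (dvec (rep k)); rewrite eqxx andbT.
by rewrite /row_free rank_rV rep_neq0.
Qed.

Definition lineN k (k40 : (k < 40)%N) : line :=
  exist (fun l => is_true (subspace_of_dim 1 l)) (span_rep k) (subspace_line k40).

Lemma line_rep (l : line) : exists2 k, (k < 40)%N & val l = span_rep k.
Proof.
case: l => U /=; rewrite /subspace_of_dim => /existsP[A /andP[Af /eqP ->]].
have A0 : A != 0 by apply: contraTneq Af => ->; rewrite /row_free mxrank0.
have [k40 [c c0 E]] := nidxP A0; exists (nidx (digits A)) => //.
by apply/setP => v; rewrite !inE [in LHS]E (eqmx_scale _ c0).
Qed.

(* The index functions and the decoding of rays are defined through opaque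
   existence proofs: otherwise unification evaluates them. *)
Lemma idx_sig :
  {f : line -> nat | forall l, f l = find (fun s => dvec s \in val l) reps}.
Proof. by exists (fun l : line => find (fun s => dvec s \in val l) reps). Qed.

Definition idx : line -> nat := sval idx_sig.

Lemma idx_find l : idx l = find (fun s => dvec s \in val l) reps.
Proof. exact: (svalP idx_sig). Qed.

Lemma idx_span (l : line) k : (k < 40)%N -> val l = span_rep k -> idx l = k.
Proof.
move=> k40 E; rewrite idx_find E.
have sz : size reps = 40%N by [].
have hasr : has (fun s => dvec s \in span_rep k) reps.
  apply/hasP; exists (rep k); first by rewrite mem_nth ?sz.
  by rewrite inE submx_refl.
have lt := hasr; rewrite has_find sz in lt.
have := nth_find [::] hasr; rewrite inE -/(rep _) rep_span //.
by move/eqP.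
Qed.

Lemma idxP (l : line) : (idx l < 40)%N /\ val l = span_rep (idx l).
Proof. by have [k k40 E] := line_rep l; rewrite (idx_span k40 E). Qed.

Lemma idx_lt l : (idx l < 40)%N. Proof. by case: (idxP l). Qed.

Lemma idxE l : val l = span_rep (idx l). Proof. by case: (idxP l). Qed.

Lemma idx_inj : injective idx.
Proof. by move=> l l' E; apply: val_inj; rewrite !idxE E. Qed.

Lemma idx_lineN k (k40 : (k < 40)%N) : idx (lineN k40) = k.
Proof. exact: idx_span. Qed.

Lemma idx_onto k : (k < 40)%N -> exists l, idx l = k.
Proof. by move=> k40; exists (lineN k40); rewrite idx_lineN. Qed.

From mathcomp Require Import ring.

(** * Orthogonality, planes and rays as tables *)

(** The factor 2 stands for -1 modulo 3, which keeps the form in the natural numbers. *)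
Definition sympn (s t : seq nat) : nat :=
  (nth 0 s 0 * nth 0 t 2 + nth 0 s 1 * nth 0 t 3
   + 2 * (nth 0 s 2 * nth 0 t 0) + 2 * (nth 0 s 3 * nth 0 t 1))%N.

(* The tables are locked, as otherwise unification evaluates them. *)
Definition orth_tbl : seq bitseq :=
  mkseq (fun i => mkseq (fun j => 3 %| sympn (rep i) (rep j))%N 40) 40.

Definition orth_table := locked orth_tbl.

Definition orthn i j : bool := nth false (nth [::] orth_table i) j.

Lemma orthnE i j : (i < 40)%N -> (j < 40)%N ->
  orthn i j = (3 %| sympn (rep i) (rep j))%N.
Proof. by move=> i40 j40; rewrite /orthn /orth_table -lock !nth_mkseq. Qed.

Lemma symp_dvec s t : symp (dvec s) (dvec t) = (sympn s t)%:R.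
Proof.
have F3_2 n : ((2 * n)%N%:R : 'F_3) = - n%:R.
  apply/eqP; rewrite -addr_eq0 -natrD -mulSnr -[0]/(0%:R) F3_eq.
  by rewrite modnMr.
by rewrite /symp !dvecEn // 3!natrD !F3_2 !natrM.
Qed.

Lemma symp_rep i j : (i < 40)%N -> (j < 40)%N ->
  (symp (dvec (rep i)) (dvec (rep j)) == 0) = orthn i j.
Proof.
move=> i40 j40; rewrite symp_dvec orthnE // -[0]/(0%:R) F3_eq mod0n.
by rewrite /dvdn.
Qed.

Lemma sympZl a x y : symp (a *: x) y = a * symp x y.
Proof. by rewrite /symp !mxE; ring. Qed.

Lemma sympZr a x y : symp x (a *: y) = a * symp x y.
Proof. by rewrite /symp !mxE; ring. Qed.

Lemma symp0l y : symp 0 y = 0.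
Proof. by rewrite -(scale0r 0) sympZl mul0r. Qed.

Lemma symp0r y : symp y 0 = 0.
Proof. by rewrite -(scale0r 0) sympZr mul0r. Qed.

Definition subspace (U : {set 'rV['F_3]_4}) := exists d, subspace_of_dim d U.

Lemma subspaceP (U : {set 'rV['F_3]_4}) : subspace U ->
  exists d (A : 'M['F_3]_(d, 4)), U = [set v | (v <= A)%MS].
Proof. by move=> [d /existsP[A /andP[_ /eqP ->]]]; exists d, A. Qed.

Lemma subspace_val_line (l : line) : subspace (val l).
Proof. by exists 1%N; apply: (valP l). Qed.

Lemma subspace_val_iso (W : isoplane) : subspace (val W).
Proof. by exists 2%N; case/andP: (valP W). Qed.

Lemma subspace_val_noniso (b : nonisoplane) : subspace (val b).
Proof. by exists 2%N; case/andP: (valP b). Qed.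

Lemma subspaceZ U c v : subspace U -> v \in U -> c *: v \in U.
Proof. by move=> /subspaceP[d [A ->]]; rewrite !inE; apply: scalemx_sub. Qed.

Lemma nidx_mem U v : subspace U -> v != 0 ->
  (dvec (rep (nidx (digits v))) \in U) = (v \in U).
Proof.
move=> sU v0; have [_ [c c0 E]] := nidxP v0.
apply/idP/idP => [H|H]; first by rewrite E subspaceZ.
by rewrite -(scalerK c0 (dvec _)) -E subspaceZ.
Qed.

Lemma line_subset (l : line) U : subspace U ->
  (val l \subset U) = (dvec (rep (idx l)) \in U).
Proof.
move=> sU; rewrite idxE; apply/fintype.subsetP/idP => [|H v].
  by apply; rewrite inE submx_refl.
by rewrite inE => /sub_rVP[c ->]; apply: subspaceZ.
Qed.

Lemma sub_perpP U V : subspace U -> subspace V ->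
  reflect (forall j k, (j < 40)%N -> (k < 40)%N -> dvec (rep j) \in V ->
             dvec (rep k) \in U -> orthn j k)
    (U \subset perp V).
Proof.
move=> sU sV; apply: (iffP fintype.subsetP) => [H j k j40 k40 jV kU|H y yU].
  have := H _ kU; rewrite inE => /forallP /(_ (dvec (rep j))).
  by rewrite jV symp_rep.
rewrite inE; apply/forallP => x; apply/implyP => xV.
have [->|x0] := eqVneq x 0; first by rewrite symp0l.
have [->|y0] := eqVneq y 0; first by rewrite symp0r.
have [j40 [c c0 ->]] := nidxP x0; have [k40 [d d0 ->]] := nidxP y0.
rewrite sympZl sympZr !mulf_eq0 (negPf c0) (negPf d0) /= symp_rep //.
by apply: H; rewrite // nidx_mem.
Qed.

Lemma rep_line (l : line) k : (k < 40)%N -> (dvec (rep k) \in val l) = (k == idx l).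
Proof. by move=> k40; rewrite idxE inE rep_span // idx_lt. Qed.

Lemma orthE (l l' : line) : (val l \subset perp (val l')) = orthn (idx l') (idx l).
Proof.
apply/sub_perpP/idP; rewrite ?[subspace _]subspace_val_line //.
- exact: subspace_val_line.
- exact: subspace_val_line.
- by apply; rewrite ?idx_lt // rep_line ?idx_lt.
by move=> H j k j40 k40; rewrite !rep_line // => /eqP -> /eqP ->.
Qed.

Definition bmask (U : {set 'rV['F_3]_4}) : bitseq :=
  mkseq (fun k => dvec (rep k) \in U) 40.

Lemma nth_bmask U k : (k < 40)%N -> nth false (bmask U) k = (dvec (rep k) \in U).
Proof. by move=> k40; rewrite nth_mkseq. Qed.

Lemma line_subset_mask (l : line) U : subspace U ->
  (val l \subset U) = nth false (bmask U) (idx l).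
Proof. by move=> sU; rewrite line_subset // nth_bmask ?idx_lt. Qed.

Definition mask_elems (m : bitseq) : seq nat :=
  [seq k <- iota 0 40 | nth false m k].

Lemma mem_mask_elems U k :
  (k \in mask_elems (bmask U)) = (k < 40)%N && (dvec (rep k) \in U).
Proof.
rewrite mem_filter mem_iota /= andbC.
by case: ltnP => //= k40; rewrite nth_bmask.
Qed.

Lemma sub_perp_mask U V : subspace U -> subspace V ->
  (U \subset perp V) = all (fun j => all (orthn j) (mask_elems (bmask U)))
    (mask_elems (bmask V)).
Proof.
move=> sU sV; apply/sub_perpP/allP => // [H j|H j k j40 k40 jV kU].
  rewrite mem_mask_elems => /andP[j40 jV]; apply/allP => k.
  by rewrite mem_mask_elems => /andP[k40 kU]; apply: H.
have := H j; rewrite mem_mask_elems j40 => /(_ jV) /allP /(_ k).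
by rewrite mem_mask_elems k40; apply.
Qed.

Definition pmask i j : bitseq :=
  let l := [seq vlin a (rep i) b (rep j) | a <- digits3, b <- digits3] in
  mkseq (fun k => rep k \in l) 40.

Lemma F3_digits (x : 'F_3) : (x : nat) \in digits3.
Proof. by case: (x : nat) (F3_nat_lt x) => [|[|[|]]]. Qed.

Lemma mem_plane i j k : (i < 40)%N -> (j < 40)%N -> (k < 40)%N ->
  (dvec (rep k) <= dvec (rep i) + dvec (rep j))%MS = nth false (pmask i j) k.
Proof.
move=> i40 j40 k40; rewrite nth_mkseq //; apply/sub_addsmxP/allpairsP.
  move=> [[x y] E]; exists (x 0 0 : nat, y 0 0 : nat); split; try exact: F3_digits.
  apply/dvec_inj; rewrite ?vlin_vectors ?reps_vectors // dvec_vlin !F3_nat.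
  by rewrite E -!mul_scalar_mx -!mx11_scalar.
move=> [[a b] [_ _ E]]; exists ((a%:R)%:M, (b%:R)%:M).
by rewrite E !mul_scalar_mx -dvec_vlin.
Qed.

Definition span2 i j : {set 'rV['F_3]_4} :=
  [set v | (v <= dvec (rep i) + dvec (rep j))%MS].

Lemma bmask_span2 i j : (i < 40)%N -> (j < 40)%N -> bmask (span2 i j) = pmask i j.
Proof.
move=> i40 j40; apply: (@eq_from_nth _ false); first by rewrite !size_mkseq.
move=> k; rewrite size_mkseq => k40.
by rewrite nth_bmask // inE mem_plane.
Qed.

Lemma subspace_span2 i j : (i < 40)%N -> (j < 40)%N -> i != j ->
  subspace_of_dim 2 (span2 i j).
Proof.
move=> i40 j40 ij; apply/existsP.
exists (col_mx (dvec (rep i)) (dvec (rep j)) : 'M_(1 + 1, 4)); apply/andP; split.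
  apply: (@inj_row_free _ (1 + 1)%N) => v.
  rewrite -[X in X *m _]hsubmxK -[X in _ -> X = _]hsubmxK mul_row_col.
  set x := lsubmx v; set y := rsubmx v => E.
  have x0 : x = 0.
    apply/eqP; apply: contraNT ij => x0; rewrite -(rep_span i40 j40).
    have x00 : x 0 0 != 0.
      by apply: contra x0 => /eqP xz; rewrite [x]mx11_scalar xz -scalemx1 scale0r.
    apply/sub_rVP; exists (- (x 0 0)^-1 * y 0 0).
    have {}E : x 0 0 *: dvec (rep i) = - (y 0 0 *: dvec (rep j)).
      by apply/eqP; rewrite -addr_eq0 -!mul_scalar_mx -!mx11_scalar E.
    by rewrite mulNr scaleNr -scalerA -scalerN -E scalerK.
  move/eqP: E; rewrite x0 mul0mx add0r [y]mx11_scalar mul_scalar_mx scaler_eq0.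
  rewrite (negPf (rep_neq0 j40)) orbF => /eqP ->.
  by rewrite -scalemx1 scale0r row_mx0.
by apply/eqP/setP => v; rewrite !inE addsmxE.
Qed.

Lemma plane_span2 U : subspace_of_dim 2 U ->
  exists i j, [/\ (i < 40)%N, (j < 40)%N, i != j & U = span2 i j].
Proof.
move=> /existsP[A /andP[Af /eqP UE]].
have {UE} : U = [set v | (v <= usubmx (A : 'M_(1 + 1, 4)) + dsubmx (A : 'M_(1 + 1, 4)))%MS].
  by apply/setP => v; rewrite UE !inE addsmxE vsubmxK.
set x := usubmx _; set y := dsubmx _ => UE.
have E : A = col_mx x y :> 'M_(1 + 1, 4) by rewrite vsubmxK.
have Ainj (a b : 'F_3) : a *: x + b *: y = 0 -> a = 0 /\ b = 0.
  move=> E0; have : row_mx a%:M b%:M *m (A : 'M_(1 + 1, 4)) = 0 *m (A : 'M_(1 + 1, 4)).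
    by rewrite E mul_row_col !mul_scalar_mx E0 mul0mx.
  move/(row_free_inj Af); rewrite -row_mx0 => H.
  have {}H : row_mx a%:M b%:M = row_mx 0 0 :> 'rV['F_3]_(1 + 1) := H.
  have Hl := congr1 (fun M => (lsubmx M : 'M['F_3]_1) 0 0) H.
  have Hr := congr1 (fun M => (rsubmx M : 'M['F_3]_1) 0 0) H.
  by split; [move: Hl; rewrite !row_mxKl|move: Hr; rewrite !row_mxKr];
    rewrite !mxE eqxx mulr1n.
have x0 : x != 0.
  apply/eqP => x0; have [|/eqP] := Ainj 1 0; first by rewrite x0 scaler0 scale0r addr0.
  by rewrite oner_eq0.
have y0 : y != 0.
  apply/eqP => y0; have [|_ /eqP] := Ainj 0 1; first by rewrite y0 scaler0 scale0r addr0.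
  by rewrite oner_eq0.
have [i40 [c c0 xE]] := nidxP x0; have [j40 [d d0 yE]] := nidxP y0.
exists (nidx (digits x)), (nidx (digits y)); split=> //.
  apply/eqP => ij; have [|/eqP] := Ainj d (- c).
    by rewrite xE yE -ij !scalerA mulrC mulNr scaleNr subrr.
  by rewrite (negPf d0).
apply/setP => v; rewrite UE !inE.
by rewrite [in LHS]xE [in LHS]yE (adds_eqmx (eqmx_scale _ c0) (eqmx_scale _ d0)).
Qed.

Lemma plane_span2_lt U : subspace_of_dim 2 U ->
  exists i j, [/\ (i < 40)%N, (j < 40)%N, (i < j)%N & U = span2 i j].
Proof.
move=> /plane_span2[i [j [i40 j40 ij UE]]].
have := ij; rewrite neq_ltn => /orP[lt|lt]; [by exists i, j|exists j, i; split=> //].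
by apply/setP => v; rewrite UE !inE addsmxC.
Qed.

Definition pairs40 : seq (nat * nat) := [seq (i, j) | i <- iota 0 40, j <- iota 0 40].

Lemma mem_pairs40 i j : ((i, j) \in pairs40) = (i < 40)%N && (j < 40)%N.
Proof.
apply/allpairsP/andP => [[[a b] [aI bI [-> ->]]]|[i40 j40]].
  by move: aI bI; rewrite !mem_iota.
by exists (i, j); rewrite !mem_iota.
Qed.

(** The names in [_raw] are the unlocked tables and relations on which the virtual machine computes;
    the equations in [_rawE] restore the locked ones used in proofs. *)
Definition orth_raw i j : bool := nth false (nth [::] orth_tbl i) j.

Lemma orth_rawE : orth_raw = orthn.
Proof. by rewrite /orthn /orth_table -lock. Qed.

(** Each plane arises from the six pairs among its four lines, hence [undup]. *)
Definition noniso_raw : seq bitseq :=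
  undup [seq pmask p.1 p.2 | p <- pairs40 & (p.1 < p.2)%N && ~~ orth_raw p.1 p.2].

Definition iso_raw : seq bitseq :=
  undup [seq pmask p.1 p.2 | p <- pairs40 & (p.1 < p.2)%N && orth_raw p.1 p.2].

Definition noniso_masks := locked noniso_raw.
Definition iso_masks := locked iso_raw.

Lemma noniso_masksE : noniso_masks =
  undup [seq pmask p.1 p.2 | p <- pairs40 & (p.1 < p.2)%N && ~~ orthn p.1 p.2].
Proof. by rewrite /noniso_masks -lock -orth_rawE. Qed.

Lemma iso_masksE : iso_masks =
  undup [seq pmask p.1 p.2 | p <- pairs40 & (p.1 < p.2)%N && orthn p.1 p.2].
Proof. by rewrite /iso_masks -lock -orth_rawE. Qed.

Definition noniso_mask k : bitseq := nth [::] noniso_masks k.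

Definition isotropic_mask (m : bitseq) : bool :=
  let l := mask_elems m in all (fun j => all (orthn j) l) l.

Lemma isotropic_maskE U : subspace U -> isotropic U = isotropic_mask (bmask U).
Proof. by move=> sU; apply: sub_perp_mask. Qed.

(** An alternating form on a plane is determined by its value on a basis; here this is simply
    checked on all pairs. *)
Lemma pmask_isotropic i j : (i < 40)%N -> (j < 40)%N -> i != j ->
  isotropic_mask (pmask i j) = orthn i j.
Proof.
move=> i40 j40 ij.
have chk : all (fun p => (p.1 == p.2) || (isotropic_mask (pmask p.1 p.2) == orthn p.1 p.2)) pairs40.
  by rewrite /isotropic_mask -orth_rawE; vm_compute.
have := allP chk (i, j); rewrite mem_pairs40 i40 j40 => /(_ isT) /=.
by rewrite (negPf ij) => /eqP.
Qed.

Lemma orthnC i j : (i < 40)%N -> (j < 40)%N -> orthn i j = orthn j i.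
Proof.
move=> i40 j40.
have chk : all (fun p => orthn p.1 p.2 == orthn p.2 p.1) pairs40.
  by rewrite -orth_rawE; vm_compute.
by apply/eqP; apply: (allP chk (i, j)); rewrite mem_pairs40 i40.
Qed.

Lemma subspaceI d U : subspace_of_dim d U -> subspace U.
Proof. by move=> Ud; exists d. Qed.

Lemma mask_noniso (b : nonisoplane) : bmask (val b) \in noniso_masks.
Proof.
case: b => U /= /andP[U2 Uiso]; have [i [j [i40 j40 ij UE]]] := plane_span2_lt U2.
have ij' : i != j by rewrite ltn_eqF.
have Um : bmask U = pmask i j by rewrite UE bmask_span2.
rewrite Um (noniso_masksE, iso_masksE) mem_undup; apply/mapP; exists (i, j) => //.
rewrite mem_filter mem_pairs40 i40 j40 andbT /= ij -pmask_isotropic // -Um.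
by rewrite -isotropic_maskE ?Uiso //; apply: (subspaceI U2).
Qed.

Lemma noniso_of_mask m : m \in noniso_masks -> exists b : nonisoplane, bmask (val b) = m.
Proof.
rewrite (noniso_masksE, iso_masksE) mem_undup => /mapP[[i j]]; rewrite mem_filter mem_pairs40 /=.
move=> /andP[/andP[lij nij] /andP[i40 j40]] ->.
have ij : i != j by rewrite ltn_eqF.
have UP : subspace_of_dim 2 (span2 i j) && ~~ isotropic (span2 i j).
  rewrite subspace_span2 // isotropic_maskE ?bmask_span2 ?pmask_isotropic //.
  exact: subspaceI (subspace_span2 i40 j40 ij).
by exists (exist (fun b => is_true (subspace_of_dim 2 b && ~~ isotropic b)) (span2 i j) UP); rewrite /= bmask_span2.
Qed.

Lemma mask_iso (W : isoplane) : bmask (val W) \in iso_masks.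
Proof.
case: W => U /= /andP[U2 Uiso]; have [i [j [i40 j40 ij UE]]] := plane_span2_lt U2.
have ij' : i != j by rewrite ltn_eqF.
have Um : bmask U = pmask i j by rewrite UE bmask_span2.
rewrite Um (noniso_masksE, iso_masksE) mem_undup; apply/mapP; exists (i, j) => //.
rewrite mem_filter mem_pairs40 i40 j40 andbT /= ij -pmask_isotropic // -Um.
by rewrite -isotropic_maskE ?Uiso //; apply: (subspaceI U2).
Qed.

Lemma iso_of_mask m : m \in iso_masks -> exists W : isoplane, bmask (val W) = m.
Proof.
rewrite (noniso_masksE, iso_masksE) mem_undup => /mapP[[i j]]; rewrite mem_filter mem_pairs40 /=.
move=> /andP[/andP[lij oij] /andP[i40 j40]] ->.
have ij : i != j by rewrite ltn_eqF.
have UP : subspace_of_dim 2 (span2 i j) && isotropic (span2 i j).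
  rewrite subspace_span2 // isotropic_maskE ?bmask_span2 ?pmask_isotropic //.
  exact: subspaceI (subspace_span2 i40 j40 ij).
by exists (exist (fun b => is_true (subspace_of_dim 2 b && isotropic b)) (span2 i j) UP); rewrite /= bmask_span2.
Qed.

Lemma size_noniso : size noniso_masks = 90%N.
Proof. by rewrite /noniso_masks -lock; vm_compute. Qed.
Lemma size_iso : size iso_masks = 40%N.
Proof. by rewrite /iso_masks -lock; vm_compute. Qed.

Lemma noniso_uniq : uniq noniso_masks.
Proof. by rewrite noniso_masksE undup_uniq. Qed.

Lemma iso_uniq : uniq iso_masks.
Proof. by rewrite iso_masksE undup_uniq. Qed.

Lemma idxb_sig :
  {f : nonisoplane -> nat | forall b, f b = index (bmask (val b)) noniso_masks}.
Proof. by exists (fun b : nonisoplane => index (bmask (val b)) noniso_masks). Qed.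

Lemma idxW_sig :
  {f : isoplane -> nat | forall W, f W = index (bmask (val W)) iso_masks}.
Proof. by exists (fun W : isoplane => index (bmask (val W)) iso_masks). Qed.

Definition idxb : nonisoplane -> nat := sval idxb_sig.
Definition idxW : isoplane -> nat := sval idxW_sig.

Lemma idxb_index b : idxb b = index (bmask (val b)) noniso_masks.
Proof. exact: (svalP idxb_sig). Qed.

Lemma idxW_index W : idxW W = index (bmask (val W)) iso_masks.
Proof. exact: (svalP idxW_sig). Qed.

Lemma idxb_lt b : (idxb b < 90)%N.
Proof. by rewrite idxb_index -size_noniso index_mem mask_noniso. Qed.

Lemma idxW_lt b : (idxW b < 40)%N.
Proof. by rewrite idxW_index -size_iso index_mem mask_iso. Qed.

Lemma idxbE b : noniso_mask (idxb b) = bmask (val b).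
Proof. by rewrite /noniso_mask idxb_index nth_index ?mask_noniso. Qed.

Lemma idxWE b : nth [::] iso_masks (idxW b) = bmask (val b).
Proof. by rewrite idxW_index nth_index ?mask_iso. Qed.

Lemma idxb_onto k : (k < 90)%N -> exists b, idxb b = k.
Proof.
rewrite -size_noniso => k90; have [b E] := noniso_of_mask (mem_nth [::] k90).
by exists b; rewrite idxb_index E (index_uniq [::] k90 noniso_uniq).
Qed.

Lemma idxW_onto k : (k < 40)%N -> exists b, idxW b = k.
Proof.
rewrite -{1}size_iso => k40; have [b E] := iso_of_mask (mem_nth [::] k40).
by exists b; rewrite idxW_index E (index_uniq [::] k40 iso_uniq).
Qed.

(* The rays of the Bergman fan: 0..39 are of type (a), 40..79 of type (ä), and
   80..169 of type (b); a ray is encoded by its characteristic sequence. *)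
Definition rays_raw : seq bitseq :=
  [seq mkseq (fun k => k == i) 40 | i <- iota 0 40]
  ++ [seq mkseq (fun k => orth_raw h k && (k != h)) 40 | h <- iota 0 40]
  ++ noniso_raw.

Definition rays := locked rays_raw.

Lemma raysE : rays = [seq mkseq (fun k => k == i) 40 | i <- iota 0 40]
  ++ [seq mkseq (fun k => orthn h k && (k != h)) 40 | h <- iota 0 40]
  ++ noniso_masks.
Proof. by rewrite /rays -lock /rays_raw orth_rawE /noniso_masks -lock. Qed.

Definition decode (X : finType) (ix : X -> nat) (m : bitseq) : {set X} :=
  [set x | nth false m (ix x)].

Lemma rset_sig :
  {f : nat -> {set line} | forall r, f r = decode idx (nth [::] rays r)}.
Proof. by exists (fun r => decode idx (nth [::] rays r)). Qed.

Definition rset : nat -> {set line} := sval rset_sig.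

Lemma rsetE r : rset r = decode idx (nth [::] rays r).
Proof. exact: (svalP rset_sig). Qed.

Lemma nth_rays_a i : (i < 40)%N -> nth [::] rays i = mkseq (fun k => k == i) 40.
Proof.
move=> i40; rewrite raysE nth_cat size_map size_iota i40.
by rewrite (nth_map 0%N) ?size_iota // nth_iota.
Qed.

Lemma nth_rays_h h : (h < 40)%N ->
  nth [::] rays (40 + h) = mkseq (fun k => orthn h k && (k != h)) 40.
Proof.
move=> h40; rewrite raysE -nth_drop drop_size_cat ?size_map ?size_iota //.
by rewrite nth_cat size_map size_iota h40 (nth_map 0%N) ?size_iota // nth_iota.
Qed.

Lemma nth_rays_b k : nth [::] rays (80 + k) = noniso_mask k.
Proof.
by rewrite raysE -(addnA 40 40) -nth_drop drop_size_cat ?size_map ?size_iota.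
Qed.

Lemma rset_a l : rset (idx l) = ray_a l.
Proof.
rewrite rsetE; apply/setP => l'; rewrite !inE nth_rays_a ?idx_lt // nth_mkseq ?idx_lt //.
by rewrite (inj_eq idx_inj).
Qed.

Lemma rset_h h : rset (40 + idx h) = ray_h h.
Proof.
rewrite rsetE; apply/setP => l'; rewrite !inE nth_rays_h ?idx_lt // nth_mkseq ?idx_lt //.
by rewrite (inj_eq idx_inj) orthE.
Qed.

Lemma rset_b b : rset (80 + idxb b) = ray_b b.
Proof.
rewrite rsetE; apply/setP => l'; rewrite !inE nth_rays_b idxbE line_subset_mask //.
exact: subspace_val_noniso.
Qed.

Definition dset (c : seq nat) : {set {set line}} := [set F in [seq rset r | r <- c]].

Lemma dsetP c F : reflect (exists2 r, r \in c & F = rset r) (F \in dset c).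
Proof. by rewrite inE; apply: mapP. Qed.

Definition mask_perp (m : bitseq) i : bool := all (orthn i) (mask_elems m).

Definition perp_raw : seq bitseq :=
  [seq mkseq (fun i => all (orth_raw i) (mask_elems m)) 40 | m <- noniso_raw].

Definition perp_table := locked perp_raw.

(** One relation serves two incidences, a plane inside the hyperplane h^perp and a line inside
    b^perp, because orthogonality is symmetric. *)
Definition perpb k i : bool := nth false (nth [::] perp_table k) i.
Definition memb k i : bool := nth false (noniso_mask k) i.

Definition memb_raw k i : bool := nth false (nth [::] noniso_raw k) i.
Definition perpb_raw k i : bool := nth false (nth [::] perp_raw k) i.

Lemma memb_rawE : memb_raw = memb.
Proof. by rewrite /memb /noniso_mask /noniso_masks -lock. Qed.

Lemma perpb_rawE : perpb_raw = perpb.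
Proof. by rewrite /perpb /perp_table -lock. Qed.

Lemma perpbE k i : (k < 90)%N -> (i < 40)%N -> perpb k i = mask_perp (noniso_mask k) i.
Proof.
move=> k90 i40; have sk : (k < size noniso_masks)%N by rewrite size_noniso.
have tE : perp_table = [seq mkseq (mask_perp m) 40 | m <- noniso_masks].
  by rewrite /perp_table -lock /perp_raw /mask_perp /noniso_masks -lock -orth_rawE.
by rewrite /perpb tE (nth_map [::]) // nth_mkseq.
Qed.

Lemma b_sub_perp (b : nonisoplane) (h : line) :
  (val b \subset perp (val h)) = perpb (idxb b) (idx h).
Proof.
have sb := subspace_val_noniso b; have sh := subspace_val_line h.
rewrite (perpbE (idxb_lt b) (idx_lt h)) idxbE.
apply/(sub_perpP sb sh)/allP => [H k|H j k j40 k40].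
  rewrite mem_mask_elems => /andP[k40 kb].
  by apply: H; rewrite ?idx_lt // rep_line ?idx_lt.
by rewrite rep_line // => /eqP -> kb; apply: H; rewrite mem_mask_elems k40.
Qed.

Lemma l_sub_perp (b : nonisoplane) (l : line) :
  (val l \subset perp (val b)) = perpb (idxb b) (idx l).
Proof.
have sb := subspace_val_noniso b; have sl := subspace_val_line l.
rewrite (perpbE (idxb_lt b) (idx_lt l)) idxbE.
apply/(sub_perpP sl sb)/allP => [H k|H j k j40 k40].
  rewrite mem_mask_elems => /andP[k40 kb].
  by rewrite orthnC ?idx_lt // H ?idx_lt // rep_line ?idx_lt.
move=> jb; rewrite rep_line // => /eqP ->.
by rewrite orthnC ?idx_lt //; apply: H; rewrite mem_mask_elems j40.
Qed.

Lemma l_sub_b (b : nonisoplane) (l : line) :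
  (val l \subset val b) = memb (idxb b) (idx l).
Proof.
by rewrite (line_subset_mask _ (subspace_val_noniso b)) -idxbE.
Qed.

(** * Enumeration of the cones by type *)

Definition pairs_lb : seq (nat * nat) := [seq (i, k) | i <- iota 0 40, k <- iota 0 90].

(** A cone is the increasing list of the numbers of its rays, so that equal cones are equal lists.
    The relations are parameters ([o] for orthogonality of lines, [m] for a line in a plane, [q] for
    a line orthogonal to a plane), to be instantiated with either the locked or the raw ones. *)
Definition mk_a : seq (seq nat) :=
  [seq [:: i] | i <- iota 0 40].
Definition mk_h : seq (seq nat) :=
  [seq [:: 40 + i]%N | i <- iota 0 40].
Definition mk_b : seq (seq nat) :=
  [seq [:: 80 + k]%N | k <- iota 0 90].
Definition mk_aa (o : nat -> nat -> bool) : seq (seq nat) :=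
  [seq [:: p.1; p.2] | p <- pairs40 & (p.1 < p.2)%N && o p.1 p.2].
Definition mk_ab (m : nat -> nat -> bool) : seq (seq nat) :=
  [seq [:: p.1; 80 + p.2]%N | p <- pairs_lb & m p.2 p.1].
Definition mk_ah (o : nat -> nat -> bool) : seq (seq nat) :=
  [seq [:: p.1; 40 + p.2]%N | p <- pairs40 & (p.1 != p.2) && o p.1 p.2].
Definition mk_bh (q : nat -> nat -> bool) : seq (seq nat) :=
  [seq [:: 40 + p.1; 80 + p.2]%N | p <- pairs_lb & q p.2 p.1].
Definition mk_abp (q : nat -> nat -> bool) : seq (seq nat) :=
  [seq [:: p.1; 80 + p.2]%N | p <- pairs_lb & q p.2 p.1].
Definition mk_aah (o : nat -> nat -> bool) : seq (seq nat) :=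
  flatten [seq [seq [:: p.1; p.2; 40 + h]%N | p <- pairs40 &
   [&& (p.1 < p.2)%N, o p.1 p.2, p.1 != h, p.2 != h, o p.1 h & o p.2 h]]
   | h <- iota 0 40].
Definition mk_abh (m q : nat -> nat -> bool) : seq (seq nat) :=
  flatten [seq [seq [:: p.1; 40 + p.2; 80 + k]%N
    | p <- [seq (i, h) | i <- [seq i <- iota 0 40 | m k i], h <- [seq h <- iota 0 40 | q k h]]]
  | k <- iota 0 90].
(** The lines of b and of b^perp come in no fixed order, hence the minimum and the maximum. *)
Definition mk_aab (m q : nat -> nat -> bool) : seq (seq nat) :=
  flatten [seq [seq [:: minn p.1 p.2; maxn p.1 p.2; 80 + k]%N
    | p <- [seq (i, j) | i <- [seq i <- iota 0 40 | m k i], j <- [seq j <- iota 0 40 | q k j]]]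
  | k <- iota 0 90].

Lemma mem_mq (m q : nat -> nat -> bool) k i j :
  ((i, j) \in [seq (i, h) | i <- [seq i <- iota 0 40 | m k i],
                            h <- [seq h <- iota 0 40 | q k h]]) =
  [&& (i < 40)%N, (j < 40)%N, m k i & q k j].
Proof.
apply/allpairsP/and4P => [[[a b] [ai bj [-> ->]]]|[i40 j40 mi qj]].
  by move: ai bj; rewrite !mem_filter !mem_iota0 => /andP[-> ->] /andP[-> ->].
by exists (i, j); rewrite !mem_filter !mem_iota0 i40 j40 mi qj.
Qed.

Definition cones_a := locked (mk_a).
Definition cones_h := locked (mk_h).
Definition cones_b := locked (mk_b).
Definition cones_aa := locked (mk_aa orthn).
Definition cones_ab := locked (mk_ab memb).
Definition cones_ah := locked (mk_ah orthn).
Definition cones_bh := locked (mk_bh perpb).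
Definition cones_abp := locked (mk_abp perpb).
Definition cones_aah := locked (mk_aah orthn).
Definition cones_abh := locked (mk_abh memb perpb).
Definition cones_aab := locked (mk_aab memb perpb).

Definition dsets (l : seq (seq nat)) : cone_type := [set s in [seq dset c | c <- l]].

Lemma dsets_cat l l' : dsets (l ++ l') = dsets l :|: dsets l'.
Proof. by apply/setP => s; rewrite !inE map_cat mem_cat. Qed.

Lemma famP (P : cone_type) (Q : seq (seq nat)) :
  (forall s, s \in P -> exists2 c, c \in Q & s = dset c) ->
  (forall c, c \in Q -> dset c \in P) -> P = dsets Q.
Proof.
move=> H H'; apply/setP => s; rewrite inE; apply/idP/mapP => [/H //|[c cQ ->]].
exact: H'.
Qed.

Lemma mem_pairs_lb i k : ((i, k) \in pairs_lb) = (i < 40)%N && (k < 90)%N.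
Proof.
apply/allpairsP/andP => [[[a b] [aI bI [-> ->]]]|[i40 j40]].
  by move: aI bI; rewrite !mem_iota.
by exists (i, k); rewrite !mem_iota.
Qed.

Lemma dset1 r : dset [:: r] = [set rset r].
Proof. by apply/setP => F; rewrite !inE. Qed.

Lemma dset2 r r' : dset [:: r; r'] = [set rset r; rset r'].
Proof. by apply/setP => F; rewrite !inE. Qed.

Lemma dset3 r r' r'' : dset [:: r; r'; r''] = [set rset r; rset r'; rset r''].
Proof. by apply/setP => F; rewrite !inE orbA. Qed.

Lemma dset0 : dset [::] = finset.set0.
Proof. by apply/setP => F; rewrite !inE. Qed.

Lemma dsets_nil : dsets [:: [::]] = [set finset.set0].
Proof. by apply/setP => s; rewrite !inE dset0. Qed.

Lemma dsetsP l s : reflect (exists2 c, c \in l & s = dset c) (s \in dsets l).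
Proof. by rewrite inE; apply: mapP. Qed.

Lemma dset_perm c c' : c =i c' -> dset c = dset c'.
Proof. by move=> E; apply/setP => F; rewrite !inE; apply: (eq_mem_map _ E). Qed.

Lemma berg_aE : berg_a = dsets cones_a.
Proof.
apply: famP => [s /imsetP[l _ ->]|c]; last (rewrite /cones_a -lock /mk_a => /mapP[i]).
  exists [:: idx l]; first by rewrite /cones_a -lock /mk_a; apply: map_f; rewrite mem_iota idx_lt.
  by rewrite dset1 rset_a.
rewrite mem_iota0 => /idx_onto[l <-] ->; apply/imsetP; exists l => //.
by rewrite dset1 rset_a.
Qed.

Lemma berg_hE : berg_h = dsets cones_h.
Proof.
apply: famP => [s /imsetP[l _ ->]|c]; last (rewrite /cones_h -lock /mk_h => /mapP[i]).
  exists [:: 40 + idx l]%N; first by rewrite /cones_h -lock /mk_h; apply: map_f; rewrite mem_iota idx_lt.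
  by rewrite dset1 rset_h.
rewrite mem_iota0 => /idx_onto[l <-] ->; apply/imsetP; exists l => //.
by rewrite dset1 rset_h.
Qed.

Lemma berg_bE : berg_b = dsets cones_b.
Proof.
apply: famP => [s /imsetP[l _ ->]|c]; last (rewrite /cones_b -lock /mk_b => /mapP[i]).
  exists [:: 80 + idxb l]%N; first by rewrite /cones_b -lock /mk_b; apply: map_f; rewrite mem_iota idxb_lt.
  by rewrite dset1 rset_b.
rewrite mem_iota0 => /idxb_onto[l <-] ->; apply/imsetP; exists l => //.
by rewrite dset1 rset_b.
Qed.

Lemma berg_aaE : berg_aa = dsets cones_aa.
Proof.
apply: famP => [s /imset2P[l l' _]|c]; last (rewrite /cones_aa -lock /mk_aa => /mapP[[i j]]).
  rewrite inE => /andP[_ /andP[ll']]; rewrite orthE orthnC ?idx_lt // => o ->.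
  wlog lt : l l' ll' o / (idx l < idx l')%N => [H|].
    have := ll'; rewrite -(inj_eq idx_inj) neq_ltn => /orP[/H|lt]; first by apply.
    have l'l : l' != l by rewrite eq_sym.
    have o' : orthn (idx l') (idx l) by rewrite (orthnC (idx_lt _) (idx_lt _)).
    rewrite finset.setUC; exact: (H l' l l'l o' lt).
  exists [:: idx l; idx l']; last by rewrite dset2 !rset_a.
  rewrite /cones_aa -lock /mk_aa; apply/mapP; exists (idx l, idx l') => //.
  by rewrite mem_filter mem_pairs40 !idx_lt lt o.
rewrite mem_filter mem_pairs40 => /andP[/andP[ij oij] /andP[]].
move=> /idx_onto[l li] /idx_onto[l' lj] ->; subst i j.
apply/imset2P; exists l l'; rewrite ?inE //; last by rewrite dset2 !rset_a.
by rewrite -(inj_eq idx_inj) (ltn_eqF ij) orthE orthnC ?idx_lt.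
Qed.

Lemma berg_abE : berg_ab = dsets cones_ab.
Proof.
apply: famP => [s /imset2P[l b _]|c]; last (rewrite /cones_ab -lock /mk_ab => /mapP[[i j]]).
  rewrite inE => /andP[_]; rewrite l_sub_b => lb ->.
  exists [:: idx l; 80 + idxb b]%N; last by rewrite dset2 rset_a rset_b.
  rewrite /cones_ab -lock /mk_ab; apply/mapP; exists (idx l, idxb b) => //.
  by rewrite mem_filter mem_pairs_lb idx_lt idxb_lt lb.
rewrite mem_filter mem_pairs_lb => /andP[ij /andP[]].
move=> /idx_onto[l li] /idxb_onto[b bj] ->; subst i j.
by apply/imset2P; exists l b; rewrite ?inE //= ?l_sub_b ?dset2 ?rset_a ?rset_b.
Qed.

Lemma berg_abpE : berg_abp = dsets cones_abp.
Proof.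
apply: famP => [s /imset2P[l b _]|c]; last (rewrite /cones_abp -lock /mk_abp => /mapP[[i j]]).
  rewrite inE => /andP[_]; rewrite l_sub_perp => lb ->.
  exists [:: idx l; 80 + idxb b]%N; last by rewrite dset2 rset_a rset_b.
  rewrite /cones_abp -lock /mk_abp; apply/mapP; exists (idx l, idxb b) => //.
  by rewrite mem_filter mem_pairs_lb idx_lt idxb_lt lb.
rewrite mem_filter mem_pairs_lb => /andP[ij /andP[]].
move=> /idx_onto[l li] /idxb_onto[b bj] ->; subst i j.
by apply/imset2P; exists l b; rewrite ?inE //= ?l_sub_perp ?dset2 ?rset_a ?rset_b.
Qed.

Lemma berg_ahE : berg_ah = dsets cones_ah.
Proof.
apply: famP => [s /imset2P[l h _]|c]; last (rewrite /cones_ah -lock /mk_ah => /mapP[[i j]]).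
  rewrite inE => /andP[_ /andP[lh]]; rewrite orthE orthnC ?idx_lt // => o ->.
  exists [:: idx l; 40 + idx h]%N; last by rewrite dset2 rset_a rset_h.
  rewrite /cones_ah -lock /mk_ah; apply/mapP; exists (idx l, idx h) => //.
  by rewrite mem_filter mem_pairs40 !idx_lt (inj_eq idx_inj) lh o.
rewrite mem_filter mem_pairs40 => /andP[/andP[ij oij] /andP[]].
move=> /idx_onto[l li] /idx_onto[h hj] ->; subst i j.
apply/imset2P; exists l h; rewrite ?inE ?dset2 ?rset_a ?rset_h //.
by rewrite -(inj_eq idx_inj) ij orthE orthnC ?idx_lt.
Qed.

Lemma berg_bhE : berg_bh = dsets cones_bh.
Proof.
apply: famP => [s /imset2P[b h _]|c]; last (rewrite /cones_bh -lock /mk_bh => /mapP[[i j]]).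
  rewrite inE => /andP[_]; rewrite b_sub_perp => lb ->.
  exists [:: 40 + idx h; 80 + idxb b]%N; last by rewrite dset2 rset_h rset_b finset.setUC.
  rewrite /cones_bh -lock /mk_bh; apply/mapP; exists (idx h, idxb b) => //.
  by rewrite mem_filter mem_pairs_lb idx_lt idxb_lt lb.
rewrite mem_filter mem_pairs_lb => /andP[ij /andP[]].
move=> /idx_onto[h hi] /idxb_onto[b bj] ->; subst i j.
by apply/imset2P; exists b h; rewrite ?inE //= ?b_sub_perp // dset2 rset_h rset_b finset.setUC.
Qed.

Lemma berg_aahE : berg_aah = dsets cones_aah.
Proof.
apply: famP => [s /finset.bigcupP[h _ /imset2P[l l' _]]|c]; last (rewrite /cones_aah -lock /mk_aah => /flatten_mapP[k]).
  rewrite inE => /andP[_ /and5P[ll' o lh l'h /andP[lph]]].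
  move: o lph; rewrite !orthE => o lph l'ph ->.
  wlog lt : l l' ll' o lh l'h lph l'ph / (idx l < idx l')%N => [H|].
    have := ll'; rewrite -(inj_eq idx_inj) neq_ltn => /orP[/H|lt]; first by apply.
    have l'l : l' != l by rewrite eq_sym.
    have o' : orthn (idx l) (idx l') by rewrite (orthnC (idx_lt _) (idx_lt _)).
    rewrite (finset.setUC [set ray_a l]); exact: (H l' l l'l o' l'h lh l'ph lph lt).
  exists [:: idx l; idx l'; 40 + idx h]%N; last by rewrite dset3 !rset_a rset_h.
  rewrite /cones_aah -lock /mk_aah; apply/flatten_mapP; exists (idx h); first by rewrite mem_iota idx_lt.
  apply/mapP; exists (idx l, idx l') => //.
  rewrite mem_filter mem_pairs40 !idx_lt lt /= !(inj_eq idx_inj) lh l'h.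
  by rewrite !(orthnC (idx_lt _) (idx_lt h)) (orthnC (idx_lt l)) ?idx_lt // o lph l'ph.
rewrite mem_iota0 => /idx_onto[h hk] /mapP[[i j]].
rewrite mem_filter mem_pairs40 => /andP[/and5P[ij o ih jh /andP[oi oj]] /andP[]].
move=> /idx_onto[l li] /idx_onto[l' lj] ->; subst i j k.
apply/finset.bigcupP; exists h => //; apply/imset2P; exists l l'; rewrite ?inE //.
  rewrite -!(inj_eq idx_inj) (ltn_eqF ij) ih jh !orthE /=.
  by rewrite !(orthnC (idx_lt h)) ?idx_lt // (orthnC (idx_lt l')) ?idx_lt // o oi oj.
by rewrite dset3 !rset_a rset_h.
Qed.

Lemma berg_abhE : berg_abh = dsets cones_abh.
Proof.
apply: famP => [s /finset.bigcupP[h _ /imset2P[l b _]]|c]; last (rewrite /cones_abh -lock /mk_abh => /flatten_mapP[k]).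
  rewrite inE => /andP[_ /andP[]]; rewrite l_sub_b b_sub_perp => lb bh ->.
  exists [:: idx l; 40 + idx h; 80 + idxb b]%N; last first.
    by rewrite dset3 rset_a rset_h rset_b finset.setUAC.
  rewrite /cones_abh -lock /mk_abh; apply/flatten_mapP; exists (idxb b).
    by rewrite mem_iota0 idxb_lt.
  apply/mapP; exists (idx l, idx h) => //.
  by rewrite mem_mq !idx_lt lb bh.
rewrite mem_iota0 => /idxb_onto[b hk] /mapP[[i j]].
rewrite mem_mq => /and4P[/idx_onto[l li] /idx_onto[h lj] ij kj] ->; subst i j k.
apply/finset.bigcupP; exists h => //; apply/imset2P; exists l b; rewrite ?inE //.
  by rewrite l_sub_b b_sub_perp ij kj.
by rewrite dset3 rset_a rset_h rset_b finset.setUAC.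
Qed.

Lemma berg_aabE : berg_aab = dsets cones_aab.
Proof.
have E (b : nonisoplane) (l l' : line) :
    dset [:: minn (idx l) (idx l'); maxn (idx l) (idx l'); 80 + idxb b]%N =
    [set ray_a l; ray_a l'; ray_b b].
  rewrite -!rset_a -rset_b -dset3; apply: dset_perm => x; rewrite !inE.
  by case: leqP; rewrite // orbCA.
apply: famP => [s /finset.bigcupP[b _ /imset2P[l l' _]]|c]; last (rewrite /cones_aab -lock /mk_aab => /flatten_mapP[k]).
  rewrite inE => /andP[_ /andP[]]; rewrite l_sub_b l_sub_perp => lb bh ->.
  exists [:: minn (idx l) (idx l'); maxn (idx l) (idx l'); 80 + idxb b]%N; last by rewrite E.
  rewrite /cones_aab -lock /mk_aab; apply/flatten_mapP; exists (idxb b).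
    by rewrite mem_iota0 idxb_lt.
  apply/mapP; exists (idx l, idx l') => //.
  by rewrite mem_mq !idx_lt lb bh.
rewrite mem_iota0 => /idxb_onto[b hk] /mapP[[i j]].
rewrite mem_mq => /and4P[/idx_onto[l li] /idx_onto[l' lj] ij kj] ->; subst i j k.
apply/finset.bigcupP; exists b => //; apply/imset2P; exists l l'; rewrite ?inE //.
  by rewrite l_sub_b l_sub_perp ij kj.
by rewrite -E.
Qed.

(** * The cones of the Bergman fan *)
Definition cones1 := (cones_a ++ cones_b) ++ cones_h.
Definition cones2 := (((cones_aa ++ cones_ab) ++ cones_ah) ++ cones_bh) ++ cones_abp.
Definition cones3 := (cones_aah ++ cones_abh) ++ cones_aab.
Definition cones := locked ((([:: [::]] ++ cones1) ++ cones2) ++ cones3).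

Definition mk_low (o m q : nat -> nat -> bool) : seq (seq nat) :=
  ([:: [::]] ++ ((mk_a ++ mk_b) ++ mk_h))
  ++ ((((mk_aa o ++ mk_ab m) ++ mk_ah o) ++ mk_bh q) ++ mk_abp q).

Definition mk_cones3 (o m q : nat -> nat -> bool) : seq (seq nat) :=
  (mk_aah o ++ mk_abh m q) ++ mk_aab m q.

Definition mk_cones (o m q : nat -> nat -> bool) : seq (seq nat) :=
  mk_low o m q ++ mk_cones3 o m q.

Lemma conesE : cones = mk_cones orthn memb perpb.
Proof.
have [Ea Eb Eh] : [/\ cones_a = mk_a, cones_b = mk_b & cones_h = mk_h].
  by split; apply/esym/lock.
have [Eaa Eab Eah] : [/\ cones_aa = mk_aa orthn, cones_ab = mk_ab memb
    & cones_ah = mk_ah orthn] by split; apply/esym/lock.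
have [Ebh Eabp Eaah] : [/\ cones_bh = mk_bh perpb, cones_abp = mk_abp perpb
    & cones_aah = mk_aah orthn] by split; apply/esym/lock.
have [Eabh Eaab] : cones_abh = mk_abh memb perpb /\ cones_aab = mk_aab memb perpb.
  by split; apply/esym/lock.
rewrite /cones -lock /cones1 /cones2 /cones3 Ea Eb Eh Eaa Eab Eah Ebh Eabp Eaah Eabh Eaab.
rewrite /mk_cones /mk_low /mk_cones3; reflexivity.
Qed.

(* Connectives are strict in the virtual machine; these versions are not. *)
Fixpoint lall (T : Type) (a : pred T) (s : seq T) : bool :=
  if s is x :: s' then (if a x then lall a s' else false) else true.

Fixpoint lhas (T : Type) (a : pred T) (s : seq T) : bool :=
  if s is x :: s' then (if a x then true else lhas a s') else false.

Lemma lallE (T : Type) (a : pred T) s : lall a s = all a s.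
Proof. by elim: s => //= x s ->. Qed.

Lemma lhasE (T : Type) (a : pred T) s : lhas a s = has a s.
Proof. by elim: s => //= x s ->. Qed.

Lemma berg_conesE : berg_cones = dsets cones.
Proof.
rewrite /berg_cones berg_aE berg_bE berg_hE berg_aaE berg_abE berg_ahE berg_bhE.
rewrite berg_abpE berg_aahE berg_abhE berg_aabE.
rewrite /cones -lock (dsets_cat _ cones3) (dsets_cat _ cones2) (dsets_cat _ cones1).
rewrite /cones1 (dsets_cat _ cones_h) (dsets_cat _ cones_b).
rewrite /cones2 (dsets_cat _ cones_abp) (dsets_cat _ cones_bh) (dsets_cat _ cones_ah)
  (dsets_cat _ cones_ab).
rewrite /cones3 (dsets_cat _ cones_aab) (dsets_cat _ cones_abh) dsets_nil.
reflexivity.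
Qed.

Lemma berg_conesP s : reflect (exists2 c, c \in cones & s = dset c) (s \in berg_cones).
Proof. by rewrite berg_conesE; apply: dsetsP. Qed.

(** Deciding by the ranges of the ray numbers (below 40, 80, 170) replaces a search among several
    thousand cones; [incone_cones] proves that the test implies membership. *)
Definition incone_of (o m q : nat -> nat -> bool) (c : seq nat) : bool :=
  (match c with
  | [::] => true
  | [:: x] => (x < 170)%N
  | [:: x; y] =>
    if (y < 40)%N then (x < y)%N && o x y
    else if (y < 80)%N then [&& x < 40, x != y - 40 & o x (y - 40)]%N
    else (y < 170)%N && (if (x < 40)%N then m (y - 80) x || q (y - 80) x
      else (x < 80)%N && q (y - 80) (x - 40))
  | [:: x; y; z] =>
    if (y < 40)%N then (x < y)%N &&
      (if (z < 80)%N then [&& 40 <= z, o x y, x != z - 40, y != z - 40,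
          o x (z - 40) & o y (z - 40)]%N
       else (z < 170)%N && (m (z - 80) x && q (z - 80) y
         || m (z - 80) y && q (z - 80) x))
    else [&& y < 80, x < 40, 80 <= z, z < 170, m (z - 80) x
      & q (z - 80) (y - 40)]%N
  | _ => false
  end)%N.

Definition incone := incone_of orthn memb perpb.

Lemma mem_conesE c : reflect [\/ c == [::],
    [|| c \in cones_a, c \in cones_b | c \in cones_h],
    [|| c \in cones_aa, c \in cones_ab | [|| c \in cones_ah, c \in cones_bh | c \in cones_abp]]
  | [|| c \in cones_aah, c \in cones_abh | c \in cones_aab]] (c \in cones).
Proof.
suff -> : (c \in cones) = [|| c == [::],
    [|| c \in cones_a, c \in cones_b | c \in cones_h],
    [|| c \in cones_aa, c \in cones_ab | [|| c \in cones_ah, c \in cones_bh | c \in cones_abp]]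
  | [|| c \in cones_aah, c \in cones_abh | c \in cones_aab]] by apply: or4P.
rewrite /cones -lock (mem_cat _ _ cones3) (mem_cat _ _ cones2)
  (mem_cat _ _ cones1) /cones1 (mem_cat _ _ cones_h) (mem_cat _ _ cones_b)
  /cones2 (mem_cat _ _ cones_abp) (mem_cat _ _ cones_bh) (mem_cat _ _ cones_ah)
  (mem_cat _ _ cones_ab) /cones3 (mem_cat _ _ cones_aab) (mem_cat _ _ cones_abh).
by rewrite mem_seq1 -!orbA.
Qed.

Lemma incone_cones c : incone c -> c \in cones.
Proof.
have sub170 z : (z < 170)%N -> (80 <= z)%N -> (z - 80 < 90)%N.
  by move=> z170 z80; rewrite ltn_subLR.
have sub80 z : (z < 80)%N -> (40 <= z)%N -> (z - 40 < 40)%N.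
  by move=> z170 z80; rewrite ltn_subLR.
have memE := mem_conesE.
case: c => [|x [|y [|z []]]] //; first by move=> _; apply/memE; constructor.
- rewrite /incone /incone_of => x170.
  have [x40|x40] := ltnP x 40.
    by apply/memE/Or42/or3P/Or31; rewrite /cones_a -lock /mk_a map_f ?mem_iota0.
  have [x80|x80] := ltnP x 80.
    apply/memE/Or42/or3P/Or33; rewrite /cones_h -lock /mk_h.
    by rewrite -(subnKC x40) map_f ?mem_iota0 ?sub80.
  apply/memE/Or42/or3P/Or32; rewrite /cones_b -lock /mk_b.
  by rewrite -(subnKC x80) map_f ?mem_iota0 ?sub170.
- rewrite /incone /incone_of => H; apply/memE/Or43; move: H.
  have [y40|y40] := ltnP y 40.
    move=> /andP[xy o]; apply/or3P/Or31; rewrite /cones_aa -lock /mk_aa.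
    apply/mapP; exists (x, y) => [|//].
    by rewrite mem_filter mem_pairs40 y40 (ltn_trans xy y40) xy o.
  have [y80|y80] := ltnP y 80.
    move=> /and3P[x40 xy o]; apply/or3P/Or33/or3P/Or31; rewrite /cones_ah -lock /mk_ah.
    apply/mapP; exists (x, y - 40)%N; last by rewrite /= subnKC.
    by rewrite mem_filter mem_pairs40 x40 sub80 // xy o.
  move=> /andP[y170]; have [x40|x40] := ltnP x 40.
    move=> /orP[m|p].
      apply/or3P/Or32; rewrite /cones_ab -lock /mk_ab.
      apply/mapP; exists (x, y - 80)%N; last by rewrite /= subnKC.
      by rewrite mem_filter mem_pairs_lb x40 sub170 // m.
    apply/or3P/Or33/or3P/Or33; rewrite /cones_abp -lock /mk_abp.
    apply/mapP; exists (x, y - 80)%N; last by rewrite /= subnKC.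
    by rewrite mem_filter mem_pairs_lb x40 sub170 // p.
  move=> /andP[x80 p]; apply/or3P/Or33/or3P/Or32; rewrite /cones_bh -lock /mk_bh.
  apply/mapP; exists (x - 40, y - 80)%N; last by rewrite /= !subnKC.
  by rewrite mem_filter mem_pairs_lb sub80 // sub170 // p.
rewrite /incone /incone_of => H; apply/memE/Or44; move: H.
have [y40|y40] := ltnP y 40.
  move=> /andP[xy]; have x40 := ltn_trans xy y40; have [z80|z80] := ltnP z 80.
    move=> /and5P[z40 o xz yz /andP[oxz oyz]].
    apply/or3P/Or31; rewrite /cones_aah -lock /mk_aah.
    apply/flatten_mapP; exists (z - 40)%N; first by rewrite mem_iota0 sub80.
    apply/mapP; exists (x, y); last by rewrite /= subnKC.
    by rewrite mem_filter mem_pairs40 x40 y40 xy o xz yz oxz oyz.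
  move=> /andP[z170 mp]; apply/or3P/Or33; rewrite /cones_aab -lock /mk_aab.
  apply/flatten_mapP; exists (z - 80)%N; first by rewrite mem_iota0 sub170.
  case/orP: mp => /andP[m p]; apply/mapP.
    exists (x, y); first by rewrite mem_mq x40 y40 m p.
    by rewrite /= (minn_idPl (ltnW xy)) (maxn_idPr (ltnW xy)) subnKC.
  exists (y, x); first by rewrite mem_mq x40 y40 m p.
  by rewrite /= (minn_idPr (ltnW xy)) (maxn_idPl (ltnW xy)) subnKC.
move=> /and5P[y80 x40 z80 z170 /andP[m p]]; apply/or3P/Or32; rewrite /cones_abh -lock /mk_abh.
apply/flatten_mapP; exists (z - 80)%N; first by rewrite mem_iota0 sub170.
apply/mapP; exists (x, y - 40)%N; last by rewrite /= !subnKC.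
by rewrite mem_mq x40 sub80 // m p.
Qed.

Definition subseqs (T : Type) (s : seq T) : seq (seq T) :=
  foldr (fun x ss => ss ++ [seq x :: t | t <- ss]) [:: [::]] s.

Lemma filter_subseqs (T : eqType) (p : pred T) s : filter p s \in subseqs s.
Proof.
elim: s => //= x s IH; rewrite mem_cat; case: (p x); last by rewrite IH.
by rewrite (map_f (cons x) IH) orbT.
Qed.

Fixpoint insert (x : nat) (s : seq nat) : seq nat :=
  if s is y :: s' then (if (x <= y)%N then x :: s else y :: insert x s') else [:: x].

Lemma mem_insert x s : insert x s =i x :: s.
Proof.
elim: s => //= y s IH z; case: ifP => _ //.
by rewrite !inE IH inE orbCA.
Qed.

Lemma size_insert x s : size (insert x s) = (size s).+1.
Proof. by elim: s => //= y s IH; case: ifP => //= _; rewrite IH. Qed.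

Definition has3 (a : pred nat) (l : seq nat) : bool :=
  lhas (fun x => if a x then lhas (fun y => if a y then (if y == x then false else
    lhas (fun z => if a z then (z != x) && (z != y) else false) l) else false) l
    else false) l.

(** Three new rays at a wall leave two after discarding the ray [r] of the facet from which the wall
    was obtained. *)
Lemma has3P (a : pred nat) l r : has3 a l ->
  exists x y, [/\ x != y, a x, a y, x != r & y != r].
Proof.
rewrite /has3 lhasE => /hasP[x _]; case: ifP => // ax.
rewrite lhasE => /hasP[y _]; case: ifP => // ay; case: eqP => // /eqP yx.
rewrite lhasE => /hasP[z _]; case: ifP => // az /andP[zx zy].
have [E|xr] := eqVneq x r.
  by exists y, z; rewrite -E eq_sym zy ay az yx zx.
have [E|yr] := eqVneq y r; last by exists x, y; rewrite eq_sym yx ax ay xr.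
by exists x, z; rewrite eq_sym zx ax az xr -E zy.
Qed.

(* The neighbour lists are only a source of candidates for the branching. *)
Definition neighbours_raw : seq (seq nat) :=
  [seq [seq r <- iota 0 170 | incone_of orth_raw memb_raw perpb_raw (insert r [:: r'])]
  | r' <- iota 0 80].

Definition neighbours := locked neighbours_raw.

Definition new_ray (o m q : nat -> nat -> bool) (d : seq nat) (G : nat) : bool :=
  if (G < 170)%N then
    (if G \in d then false else incone_of o m q (insert G d)) else false.

(** The clauses give closure under faces, three facets along each wall, and an extension of every
    smaller cone, hence purity. A cone of dimension 2 never has two rays (b), so its smallest ray
    has a row in the neighbour lists. *)
Definition cone_check_of (o m q : nat -> nat -> bool) (nb : seq (seq nat))
    (c : seq nat) : bool :=
  [&& sorted ltn c, lall (fun r => r < 170)%N c, lall (incone_of o m q) (subseqs c)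
    & if size c == 3 then true
      else if size c == 2 then has3 (new_ray o m q c) (nth [::] nb (head 0%N c))
      else lhas (new_ray o m q c) (iota 0 170)].

Definition cone_check := cone_check_of orthn memb perpb neighbours.

Lemma cones_check : all cone_check cones.
Proof.
rewrite conesE /cone_check /neighbours -lock -orth_rawE -memb_rawE -perpb_rawE.
vm_cast_no_check (erefl true).
Qed.

Lemma rays_check : [&& uniq rays, size rays == 170%N & all (fun m => size m == 40%N) rays].
Proof. by rewrite /rays -lock; vm_cast_no_check (erefl true). Qed.

Lemma size_rays : size rays = 170%N. Proof. by case/and3P: rays_check => _ /eqP. Qed.

Lemma size_ray r : (r < 170)%N -> size (nth [::] rays r) = 40%N.
Proof.
move=> r170; case/and3P: rays_check => _ _ /allP /(_ (nth [::] rays r)) H.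
by apply/eqP/H; rewrite mem_nth ?size_rays.
Qed.

Lemma decode_inj (X : finType) (ix : X -> nat) (n : nat) m m' :
  (forall k, (k < n)%N -> exists x, ix x = k) -> size m = n -> size m' = n ->
  decode ix m = decode ix m' -> m = m'.
Proof.
move=> onto sm sm' E; apply: (@eq_from_nth _ false); first by rewrite sm.
move=> k; rewrite sm => /onto[x <-].
by move/setP/(_ x): E; rewrite !inE.
Qed.

Lemma rset_inj r r' : (r < 170)%N -> (r' < 170)%N -> rset r = rset r' -> r = r'.
Proof.
move=> r170 r'170; rewrite !rsetE => /(decode_inj idx_onto (size_ray r170) (size_ray r'170)) /eqP.
rewrite nth_uniq ?size_rays //; first by move/eqP.
by case/and3P: rays_check.
Qed.

Lemma cone_checkP c : c \in cones -> cone_check c.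
Proof. exact: (allP cones_check). Qed.

Lemma cones_all_lt c : c \in cones -> all (fun r => r < 170)%N c.
Proof. by move=> /cone_checkP /and4P[_ H _ _]; rewrite -lallE. Qed.

Lemma cones_sorted c : c \in cones -> sorted ltn c.
Proof. by move=> /cone_checkP /and4P[]. Qed.

Lemma cones_filter c p : c \in cones -> filter p c \in cones.
Proof.
move=> /cone_checkP /and4P[_ _ + _]; rewrite lallE => /allP H.
exact/incone_cones/H/filter_subseqs.
Qed.

Lemma cones_lt c r : c \in cones -> r \in c -> (r < 170)%N.
Proof. by move=> /cones_all_lt /allP H; apply: H. Qed.

Lemma cones_uniq c : c \in cones -> uniq c.
Proof.
by move=> /cones_sorted; apply: sorted_uniq; [apply: ltn_trans|apply: ltnn].
Qed.

Lemma rset_mem c r : all (fun r => r < 170)%N c -> (r < 170)%N ->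
  (rset r \in dset c) = (r \in c).
Proof.
move=> /allP c170 r170; apply/dsetP/idP => [[r' r'c E]|rc]; last by exists r.
by rewrite (rset_inj r170 (c170 _ r'c) E).
Qed.

Lemma dset_inj c c' : sorted ltn c -> sorted ltn c' ->
  all (fun r => r < 170)%N c -> all (fun r => r < 170)%N c' ->
  dset c = dset c' -> c = c'.
Proof.
move=> sc sc' c170 c'170 E; apply: (irr_sorted_eq ltn_trans ltnn sc sc') => r.
apply/idP/idP => rc.
  by have r170 := allP c170 _ rc; rewrite -rset_mem // -E rset_mem.
by have r170 := allP c'170 _ rc; rewrite -rset_mem // E rset_mem.
Qed.

Lemma cones_dset_inj : {in cones &, injective dset}.
Proof.
by move=> c c' cC c'C; apply: dset_inj; rewrite ?cones_sorted ?cones_all_lt.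
Qed.

Lemma card_dset c : c \in cones -> #|dset c| = size c.
Proof.
move=> cC; rewrite cardsE -(size_map rset); apply/card_uniqP.
rewrite map_inj_in_uniq ?(cones_uniq cC) // => r r' rc r'c.
by apply: rset_inj; apply: (cones_lt cC).
Qed.

Lemma card_cone_list l : {subset l <= cones} -> uniq l ->
  #|[set s in [seq dset c | c <- l]]| = size l.
Proof.
move=> sub ul; rewrite cardsE -(size_map dset); apply/card_uniqP.
by rewrite map_inj_in_uniq // => c c' /sub cC /sub; apply: cones_dset_inj.
Qed.

Lemma berg_down : down_closed berg_cones.
Proof.
move=> s s' /berg_conesP[c cC ->] s'c.
have E : s' = dset [seq r <- c | rset r \in s'].
  apply/setP => F; apply/idP/dsetP => [Fs'|[r]]; last first.
    by rewrite mem_filter => /andP[rs' _] ->.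
  have /dsetP[r rc FE] := fintype.subsetP s'c _ Fs'.
  by exists r => //; rewrite mem_filter -FE Fs'.
by apply/berg_conesP; exists [seq r <- c | rset r \in s'] => //; apply: cones_filter.
Qed.

Lemma dset_insert r c : dset (insert r c) = rset r |: dset c.
Proof.
rewrite (dset_perm (c' := r :: c)); first by apply/setP => F; rewrite !inE.
exact: mem_insert.
Qed.

Lemma dset_rem r c : c \in cones -> r \in c -> dset (rem r c) = dset c :\ rset r.
Proof.
move=> cC rc; have uc := cones_uniq cC; have r170 := cones_lt cC rc.
apply/setP => F; rewrite in_setD1; apply/dsetP/andP => [[r']|[Fr /dsetP[r' r'c FE]]].
  rewrite mem_rem_uniq // inE => /andP[rr' r'c] ->; split; last by apply/dsetP; exists r'.
  apply: contra rr' => /eqP E; apply/eqP; apply: rset_inj => //; exact: cones_lt r'c.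
exists r' => //; rewrite mem_rem_uniq // inE r'c andbT.
by apply: contra Fr => /eqP <-; rewrite FE.
Qed.

Lemma rem_cones r c : c \in cones -> rem r c \in cones.
Proof. by move=> cC; rewrite rem_filter ?cones_uniq //; apply: cones_filter. Qed.

Lemma cones_size c : c \in cones -> (size c <= 3)%N.
Proof.
move=> /cone_checkP /and4P[_ _ + _]; rewrite lallE => /allP H.
have := H _ (filter_subseqs predT c); rewrite filter_predT /incone.
by case: c {H} => [|? [|? [|? []]]].
Qed.

Lemma new_rayP d G : new_ray orthn memb perpb d G ->
  [/\ (G < 170)%N, G \notin d & insert G d \in cones].
Proof.
rewrite /new_ray; case: ifP => // G170; case: ifP => // /negbT Gd Gc.
by split=> //; apply: incone_cones.
Qed.

Lemma facet_of_list c : c \in cones -> size c = 3%N ->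
  (forall t', t' \in berg_cones -> dset c \subset t' -> t' = dset c) /\
  branching berg_cones (dset c).
Proof.
move=> cC sc; split=> [_ /berg_conesP[c' c'C ->] sub|F /dsetP[r rc ->]].
  by apply/esym/eqP; rewrite eqEcard sub !card_dset // sc cones_size.
have /cone_checkP /and4P[_ _ _] := rem_cones r cC.
have sd : size (rem r c) = 2%N by rewrite size_rem // sc.
rewrite sd /= => /has3P - /(_ r) [x [y [xy /new_rayP[x170 xd xC] /new_rayP[y170 yd yC] xr yr]]].
have c170 := cones_all_lt cC.
have nc z : z \notin rem r c -> z != r -> z \notin c.
  by rewrite mem_rem_uniq ?cones_uniq // inE negb_and negbK => /orP[->|].
exists (rset x), (rset y); split.
- by apply: contra xy => /eqP /(rset_inj x170 y170) ->.
- by rewrite !rset_mem // !nc.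
- by rewrite -dset_rem // -dset_insert; apply/berg_conesP; exists (insert x (rem r c)).
by rewrite -dset_rem // -dset_insert; apply/berg_conesP; exists (insert y (rem r c)).
Qed.

Lemma cones_extend c : c \in cones ->
  exists c', [/\ c' \in cones, size c' = 3%N & dset c \subset dset c'].
Proof.
have [n] := ubnP (3 - size c)%N; elim: n c => // n IH c; rewrite ltnS => le_n cC.
have /and4P[_ _ _ chk] := cone_checkP cC.
have [sc|sc] := eqVneq (size c) 3%N; first by exists c.
have [G GC] : exists G, insert G c \in cones.
  move: chk; rewrite (negPf sc); case: ifP => _.
    by move=> /has3P - /(_ 0%N) [x [y [_ /new_rayP[_ _ xC] _ _ _]]]; exists x.
  by rewrite lhasE => /hasP[x _ /new_rayP[_ _ xC]]; exists x.
have lt3 : (size c < 3)%N by rewrite ltn_neqAle sc cones_size.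
have [||c' [c'C sc' sub]] := IH (insert G c); rewrite ?GC //.
  by rewrite size_insert (leq_trans _ le_n) // ltn_sub2l.
exists c'; split=> //; apply: fintype.subset_trans sub.
by rewrite dset_insert finset.subsetUr.
Qed.

Lemma berg_facets s : s \in berg_cones -> exists t : {set {set line}},
  [/\ t \in berg_cones, s \subset t,
      forall t', t' \in berg_cones -> t \subset t' -> t' = t & branching berg_cones t].
Proof.
move=> /berg_conesP[c cC ->]; have [c' [c'C sc' sub]] := cones_extend cC.
have [max br] := facet_of_list c'C sc'; exists (dset c'); split=> //.
by apply/berg_conesP; exists c'.
Qed.

(** * Separatedness by counting *)

Definition decode_set (X : finType) (ix : X -> nat) (S : seq bitseq) (c : seq nat) :
    {set {set X}} := [set F in [seq decode ix (nth [::] S r) | r <- c]].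

Lemma decode_setP (X : finType) (ix : X -> nat) S c F :
  reflect (exists2 r, r \in c & F = decode ix (nth [::] S r)) (F \in decode_set ix S c).
Proof. by rewrite inE; apply: mapP. Qed.

Definition inter_count (m m' : bitseq) : nat :=
  count (fun p : bool * bool => p.1 && p.2) (zip m m').

Definition sub_mask (m m' : bitseq) : bool :=
  all (fun p : bool * bool => p.1 ==> p.2) (zip m m').

Lemma zip_iota (m m' : bitseq) n : size m = n -> size m' = n ->
  zip m m' = [seq (nth false m k, nth false m' k) | k <- iota 0 n].
Proof.
move=> sm sm'; apply: (@eq_from_nth _ (false, false)).
  by rewrite size_zip sm sm' minnn size_map size_iota.
move=> k; rewrite size_zip sm sm' minnn => kn.
by rewrite nth_zip ?sm // (nth_map 0%N) ?size_iota // nth_iota.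
Qed.

Lemma count_cover (T R : Type) (p : pred T) (q : R -> pred T) (l : seq T) (c : seq R) :
  all (fun k => p k ==> has (fun r => q r k) c) l ->
  (count p l <= \sum_(r <- c) count (fun k => p k && q r k) l)%N.
Proof.
elim: c p => [|r c IH] p cov.
  rewrite big_nil leqn0 -leqn0 -(count_pred0 l).
  by elim: l cov => //= x l IHl /andP[px /IHl]; rewrite implybF in px; rewrite (negPf px).
rewrite big_cons -[X in (X <= _)%N]size_filter -(count_predC (q r)) !count_filter.
  apply: leq_add.
    by apply: sub_count => k /=; rewrite andbC.
  apply: leq_trans (_ : (count (fun k => p k && ~~ q r k) l <= _)%N).
    by apply: sub_count => k /=; rewrite andbC.
  apply: (leq_trans (IH (fun k => p k && ~~ q r k) _)).
    apply: sub_all cov => k /=; case: (p k) => //=; by case: (q r k).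
  apply: leq_sum => r' _; apply: sub_count => k /=.
  by case: (p k) => //=; case: (q r k).
Qed.

(** The size of a set depends only on its type, and [w] bounds its intersection with a set of
    another type that does not contain it. Separatedness of thousands of cones thus reduces to sums
    over types in [type_check]. *)
Definition mask_check (n : nat) (S : seq bitseq) (ty sz : nat -> nat)
    (w : nat -> nat -> nat) : bool :=
  all (fun r => let m := nth [::] S r in
    [&& size m == n, count id m == sz (ty r)
      & all (fun r' => let m' := nth [::] S r' in
          if sub_mask m m' then true else inter_count m m' <= w (ty r) (ty r'))%N
        (iota 0 (size S))]) (iota 0 (size S)).

Definition type_check (n : nat) (N : nat) (ty sz : nat -> nat)
    (w : nat -> nat -> nat) (types : seq nat) (c : seq nat) : bool :=
  [&& all (fun r => r < N)%N c,
      all (fun r => ty r \in types) c,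
      all (fun t => sumn [seq w t (ty r) | r <- c] < sz t)%N types
    & sumn [seq sz (ty r) | r <- c] < n]%N.

Lemma size_filter_mask m n : size m = n ->
  count id m = count (nth false m) (iota 0 n).
Proof.
move=> sm; rewrite -{1}(mkseq_nth false m) sm /mkseq count_map.
by apply: eq_count.
Qed.

(** If the members of a cone not containing [G] covered [G], its size would be at most the sum of
    the intersection bounds, against the strict inequality in [type_check]. The last clause of that
    test excludes in the same way that the cone covers the ground set. *)
Lemma separated_types (X : finType) (ix : X -> nat) n (S : seq bitseq)
    (ty sz : nat -> nat) (w : nat -> nat -> nat) (types : seq nat)
    (Q : seq (seq nat)) (Delta : {set {set {set X}}}) :
  (forall x, (ix x < n)%N) -> (forall k, (k < n)%N -> exists x, ix x = k) ->
  (forall s, s \in Delta -> exists2 c, c \in Q & s = decode_set ix S c) ->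
  mask_check n S ty sz w -> all (type_check n (size S) ty sz w types) Q ->
  separated Delta.
Proof.
move=> ixn onto DQ /allP chkS /allP chkQ.
have {}chkS r : (r < size S)%N -> [/\ size (nth [::] S r) = n,
    count (nth false (nth [::] S r)) (iota 0 n) = sz (ty r) &
    forall r', (r' < size S)%N -> ~~ sub_mask (nth [::] S r) (nth [::] S r') ->
      (inter_count (nth [::] S r) (nth [::] S r') <= w (ty r) (ty r'))%N].
  rewrite -mem_iota0 => /chkS /and3P[/eqP sm /eqP cm /allP chk]; split=> //.
    by rewrite -size_filter_mask.
  by move=> r'; rewrite -mem_iota0 => /chk /=; case: (sub_mask _ _).
have countT : count predT (iota 0 n) = n by rewrite count_predT size_iota.
split=> [s G sD GD|s /DQ[c /chkQ /and4P[/allP cS _ _ lt] ->]].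
  have [c cQ sE] := DQ _ sD; have /finset.bigcupP[s' s'D Gs'] := GD.
  have [c' c'Q s'E] := DQ _ s'D.
  have /and4P[/allP cS _ /allP lt _] := chkQ _ cQ.
  have /and4P[/allP c'S /allP c'ty _ _] := chkQ _ c'Q.
  move: Gs'; rewrite s'E => /decode_setP[g gc' GE].
  have [sg cg chkg] := chkS _ (c'S _ gc').
  set mg := nth [::] S g in sg cg chkg.
  pose q r k := if sub_mask mg (nth [::] S r) then false else nth false (nth [::] S r) k.
  have [cov|] := boolP (all (fun k => nth false mg k ==> has (fun r => q r k) c) (iota 0 n)).
    have := count_cover cov; rewrite cg leqNgt.
    rewrite (leq_ltn_trans _ (lt _ (c'ty _ gc'))) // sumnE big_map.
    rewrite big_seq [leqRHS]big_seq; apply: leq_sum => r rc.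
    rewrite /q; case: (boolP (sub_mask mg _)) => sub.
      by rewrite (eq_count (a2 := pred0)) ?count_pred0 // => k; rewrite andbF.
    apply: leq_trans (chkg _ (cS _ rc) sub); have [sr _ _] := chkS _ (cS _ rc).
    by rewrite /inter_count (zip_iota sg sr) count_map leq_eqVlt; apply/orP; left.
  move=> /allPn[k]; rewrite mem_iota0 => kn; rewrite negb_imply => /andP[kg /hasPn nq].
  have [x xk] := onto _ kn; exists x; first by rewrite GE inE xk.
  move=> F; rewrite sE => /decode_setP[r rc ->]; rewrite inE xk => kr.
  have := nq _ rc; rewrite /q; case: ifP => [+ _|_]; last by rewrite kr.
  have [sr _ _] := chkS _ (cS _ rc).
  rewrite /sub_mask (zip_iota sg sr) all_map => /allP sub.
  rewrite GE; apply/fintype.subsetP => y; rewrite !inE => yg.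
  by have := sub (ix y); rewrite mem_iota0 ixn /= yg => /(_ isT).
have [cov|] := boolP (all (fun k => predT k ==> has (fun r => nth false (nth [::] S r) k) c) (iota 0 n)).
  have := count_cover cov; rewrite countT leqNgt (leq_ltn_trans _ lt) //.
  rewrite sumnE big_map big_seq [leqRHS]big_seq; apply: leq_sum => r rc.
  by have [_ <- _] := chkS _ (cS _ rc); apply: sub_count.
move=> /allPn[k]; rewrite mem_iota0 => kn /= /hasPn nk.
have [x xk] := onto _ kn; exists x => F /decode_setP[r rc ->].
by rewrite inE xk nk.
Qed.

Definition ray_type r : nat := if (r < 40)%N then 0 else if (r < 80)%N then 1 else 2.
Definition ray_size t : nat := nth 0%N [:: 1; 12; 4]%N t.
(** Types 0, 1, 2 are (a), (ä), (b). For instance two hyperplanes share a plane, which has four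
    lines, and two distinct planes share at most one line. *)
Definition ray_inter t t' : nat :=
  nth 0%N (nth [::] [:: [:: 0; 0; 0]; [:: 1; 4; 4]; [:: 1; 1; 1]]%N t) t'.

Lemma rays_mask_check : mask_check 40 rays ray_type ray_size ray_inter.
Proof. by rewrite /rays -lock; vm_cast_no_check (erefl true). Qed.

Lemma cones_type_check :
  all (type_check 40 170 ray_type ray_size ray_inter [:: 0; 1; 2]%N) cones.
Proof.
rewrite conesE -orth_rawE -memb_rawE -perpb_rawE.
vm_cast_no_check (erefl true).
Qed.

Lemma dset_decode c : dset c = decode_set idx rays c.
Proof. by rewrite /decode_set; under eq_map do rewrite -rsetE. Qed.

Lemma berg_separated : separated berg_cones.
Proof.
apply: (separated_types idx_lt idx_onto _ rays_mask_check (types := [:: 0; 1; 2]%N) (Q := cones)).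
  by move=> s /berg_conesP[c cC ->]; exists c => //; apply: dset_decode.
by rewrite size_rays; apply: cones_type_check.
Qed.

(** * The tropical Burkhardt complex *)
Definition iso_elems_raw : seq (seq nat) := [seq mask_elems m | m <- iso_raw].

(** If an isotropic plane meets b in l, its vectors are orthogonal to l, so their components in b
    lie in l; hence it also meets b^perp. The isotropic planes meeting b are therefore the sixteen
    sums of a line of b and a line of b^perp, the same for b and b^perp, and [undup] leaves 45
    sets. *)
Definition quadric_raw : seq bitseq :=
  [seq mkseq (fun k => has (nth false m) (nth [::] iso_elems_raw k)) 40 | m <- noniso_raw].

(* The vertices of the tropical Burkhardt complex: 0..39 are the lines, each
   encoded by the isotropic planes containing it, and 40..84 are the pairs
   {b, b^perp}, each encoded by the isotropic planes meeting b. *)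
Definition verts_raw : seq bitseq :=
  [seq mkseq (fun k => nth false (nth [::] iso_raw k) i) 40 | i <- iota 0 40]
  ++ undup quadric_raw.

Definition vert_raw : seq nat :=
  iota 0 40 ++ iota 0 40 ++ [seq 40 + index q (undup quadric_raw) | q <- quadric_raw]%N.

Definition iso_elems := locked iso_elems_raw.
Definition verts := locked verts_raw.
Definition vert_table := locked vert_raw.

Definition vert_of (t : seq nat) (r : nat) : nat := nth 0%N t r.
Definition vert : nat -> nat := vert_of vert_table.

(* [mapA] sends the ray r to [mult r] times the vertex plus [shift r] times
   the all-one vector. *)
Definition mult r : nat := if (40 <= r < 80)%N then 2 else 1.
Definition shift r : nat := if (40 <= r < 80)%N then 1 else 0.

(** The values of [mult] and [shift] at (ä): an isotropic plane through h lies in h^perp and has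
    three lines other than h, and any other meets h^perp in exactly one line, so the count is 1 + 2
    [h in W]. An isotropic plane meets a non-isotropic one in at most one line. *)
Definition image_check (R V : seq bitseq) (E : seq (seq nat)) (t : seq nat) : bool :=
  all (fun r => (vert_of t r < 85)%N && all (fun k =>
    count (nth false (nth [::] R r)) (nth [::] E k) ==
    shift r + mult r * nth false (nth [::] V (vert_of t r)) k)%N (iota 0 40)) (iota 0 170).

Lemma image_checkP : image_check rays verts iso_elems vert_table.
Proof.
rewrite /rays -lock /verts -lock /iso_elems -lock /vert_table -lock.
vm_cast_no_check (erefl true).
Qed.

Lemma verts_check :
  [&& size verts == 85%N, uniq verts & all (fun m => size m == 40%N) verts].
Proof. by rewrite /verts -lock; vm_cast_no_check (erefl true). Qed.

Lemma size_verts : size verts = 85%N. Proof. by case/and3P: verts_check => /eqP. Qed.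

Lemma size_vert v : (v < 85)%N -> size (nth [::] verts v) = 40%N.
Proof.
move=> v85; case/and3P: verts_check => _ _ /allP /(_ (nth [::] verts v)) H.
by apply/eqP/H; rewrite mem_nth ?size_verts.
Qed.

Lemma vert_lt r : (r < 170)%N -> (vert r < 85)%N.
Proof.
by rewrite -mem_iota0 => r170; have := allP image_checkP _ r170; case/andP.
Qed.

Definition vset v : {set isoplane} := decode idxW (nth [::] verts v).

Lemma vset_inj v v' : (v < 85)%N -> (v' < 85)%N -> vset v = vset v' -> v = v'.
Proof.
move=> v85 v'85 /(decode_inj idxW_onto (size_vert v85) (size_vert v'85)) /eqP.
rewrite nth_uniq ?size_verts //; first by move/eqP.
by case/and3P: verts_check.
Qed.

Definition tset (c : seq nat) : {set {set isoplane}} :=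
  decode_set idxW verts [seq vert r | r <- c].

Lemma tsetP c G : reflect (exists2 r, r \in c & G = vset (vert r)) (G \in tset c).
Proof.
apply: (iffP (decode_setP _ _ _ _)) => [[v /mapP[r rc ->] ->]|[r rc ->]].
  by exists r.
by exists (vert r) => //; apply: map_f.
Qed.

Definition trop_complex : {set {set {set isoplane}}} :=
  [set s in [seq tset c | c <- cones]].

Lemma trop_complexP s : reflect (exists2 c, c \in cones & s = tset c) (s \in trop_complex).
Proof. by rewrite inE; apply: mapP. Qed.

Definition vert_type v : nat := if (v < 40)%N then 0 else 1.
Definition vert_size t : nat := nth 0%N [:: 4; 16]%N t.
(** The bounds are just sharp enough: a cone (aab) gives 4 + 4 + 7 = 15 against a set of 16 planes,
    and 1 + 1 + 1 = 3 against a set of 4. *)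
Definition vert_inter t t' : nat :=
  nth 0%N (nth [::] [:: [:: 1; 1]; [:: 4; 7]]%N t) t'.

Lemma verts_mask_check : mask_check 40 verts vert_type vert_size vert_inter.
Proof. by rewrite /verts -lock; vm_cast_no_check (erefl true). Qed.

Definition image_type_check (t : seq nat) (c : seq nat) : bool :=
  type_check 40 85 vert_type vert_size vert_inter [:: 0; 1]%N [seq vert_of t r | r <- c].

Lemma cones_image_type_check : all (image_type_check vert_table) cones.
Proof.
rewrite conesE /vert_table -lock -orth_rawE -memb_rawE -perpb_rawE.
vm_cast_no_check (erefl true).
Qed.

Lemma trop_separated : separated trop_complex.
Proof.
apply: (separated_types idxW_lt idxW_onto _ verts_mask_check (types := [:: 0; 1]%N)
  (Q := [seq [seq vert r | r <- c] | c <- cones])).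
  move=> s /trop_complexP[c cC ->]; exists [seq vert r | r <- c] => //.
  exact: map_f.
rewrite size_verts all_map; apply: cones_image_type_check.
Qed.

Lemma trop_down : down_closed trop_complex.
Proof.
move=> s s' /trop_complexP[c cC ->] s'c.
have E : s' = tset [seq r <- c | vset (vert r) \in s'].
  apply/setP => F; apply/idP/tsetP => [Fs'|[r]]; last first.
    by rewrite mem_filter => /andP[rs' _] ->.
  have /tsetP[r rc FE] := fintype.subsetP s'c _ Fs'.
  by exists r => //; rewrite mem_filter -FE Fs'.
by apply/trop_complexP; exists [seq r <- c | vset (vert r) \in s'] => //; apply: cones_filter.
Qed.

Lemma line_in_plane (l : line) (W : isoplane) :
  (val l \subset val W) = nth false (nth [::] iso_masks (idxW W)) (idx l).
Proof. by rewrite (line_subset_mask _ (subspace_val_iso W)) -idxWE. Qed.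

Lemma iso_elemsE k : (k < 40)%N ->
  nth [::] iso_elems k = mask_elems (nth [::] iso_masks k).
Proof.
move=> k40; have sk : (k < size iso_masks)%N by rewrite size_iso.
have -> : iso_elems = [seq mask_elems m | m <- iso_masks].
  by rewrite /iso_elems -lock /iso_masks -lock.
by rewrite (nth_map [::]).
Qed.

Section MapA.
Variable R : realType.

Lemma mapAE (v : trop_vec R line) W :
  mapA v W = \sum_(l : line | val l \subset val W) v l.
Proof.
rewrite sum_ffunE [RHS]big_mkcond; apply: eq_bigr => l _.
have -> : \sum_(W' : isoplane | val l \subset val W') unitv R W' =
    indic R [set W' : isoplane | val l \subset val W'].
  by apply: eq_bigl => W'; rewrite inE.
rewrite ffunE indicE inE.
by case: (val l \subset val W); [apply: mulr1|apply: mulr0].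
Qed.

Lemma mapAD (v w : trop_vec R line) : mapA (v + w) = mapA v + mapA w.
Proof.
apply/ffunP => W; rewrite ffunE !mapAE -big_split.
by apply: eq_bigr => l _; rewrite ffunE.
Qed.

Lemma mapAZ k (v : trop_vec R line) : mapA (k *: v) = k *: mapA v.
Proof.
apply/ffunP => W; rewrite ffunE !mapAE scaler_sumr.
by apply: eq_bigr => l _; rewrite ffunE.
Qed.

Lemma big_index (X : finType) (ix : X -> nat) n (f : nat -> R) : injective ix ->
  (forall x, (ix x < n)%N) -> (forall k, (k < n)%N -> exists x, ix x = k) ->
  \sum_x f (ix x) = \sum_(k <- iota 0 n) f k.
Proof.
move=> inj lt onto; rewrite -(big_map ix xpredT f) /index_enum -enumT.
apply: perm_big; apply: uniq_perm; rewrite ?iota_uniq //.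
  by rewrite map_inj_uniq // enum_uniq.
move=> k; rewrite mem_iota0; apply/mapP/idP => [[x _ ->]|/onto[x xk]]; first exact: lt.
by exists x; rewrite ?mem_enum // xk.
Qed.

Lemma mapA_indic r W : (r < 170)%N ->
  mapA (indic R (rset r)) W =
  (count (nth false (nth [::] rays r)) (nth [::] iso_elems (idxW W)))%:R.
Proof.
move=> r170; rewrite mapAE iso_elemsE ?idxW_lt //.
set m := nth [::] iso_masks _.
transitivity (\sum_(l : line) (nth false m (idx l) && nth false (nth [::] rays r) (idx l))%:R : R).
  rewrite big_mkcond; apply: eq_bigr => l _.
  by rewrite line_in_plane -/m indicE rsetE inE; case: (nth false m _).
rewrite (big_index (fun k => (nth false m k && nth false (nth [::] rays r) k)%:R) idx_inj idx_lt idx_onto).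
rewrite /mask_elems count_filter -sum1_count natr_sum [RHS]big_mkcond.
apply: eq_bigr => k _ /=.
by case: (nth false m k); case: (nth _ _ _).
Qed.

Lemma mapA_ray r : (r < 170)%N ->
  mapA (indic R (rset r)) =
  (mult r)%:R *: indic R (vset (vert r)) + (shift r)%:R *: ones R isoplane.
Proof.
move=> r170; apply/ffunP => W; rewrite (mapA_indic _ r170) !ffunE indicE inE.
have := allP image_checkP r; rewrite mem_iota0 => /(_ r170) /andP[_ /allP].
move=> /(_ (idxW W)); rewrite mem_iota0 => /(_ (idxW_lt W)) /eqP ->.
by rewrite natrD natrM addrC [X in _ = _ + X]mulr1.
Qed.

Lemma mapA_ones : mapA (ones R line) = 4%:R *: ones R isoplane.
Proof.
apply/ffunP => W; rewrite mapAE !ffunE [RHS]mulr1.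
rewrite (eq_bigr (fun=> 1)); last by move=> l _; rewrite onesE.
have chk : all (fun l => size l == 4%N) iso_elems.
  by rewrite /iso_elems -lock; vm_cast_no_check (erefl true).
have sz : size iso_elems = 40%N.
  by rewrite /iso_elems -lock size_map -size_iso /iso_masks -lock.
have := allP chk (nth [::] iso_elems (idxW W)); rewrite mem_nth ?sz ?idxW_lt // => /(_ isT).
rewrite iso_elemsE ?idxW_lt // => /eqP E.
rewrite -[4%:R](congr1 (fun n => n%:R) E).
transitivity (\sum_(l : line) (nth false (nth [::] iso_masks (idxW W)) (idx l))%:R : R).
  rewrite big_mkcond; apply: eq_bigr => l _; rewrite line_in_plane.
  by case: (nth _ _ _).
rewrite (big_index (fun k => (nth false (nth [::] iso_masks (idxW W)) k)%:R) idx_inj idx_lt idx_onto).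
rewrite /mask_elems size_filter -sum1_count natr_sum [RHS]big_mkcond.
by apply: eq_bigr => k _; case: (nth _ _ _).
Qed.

Lemma mapA0 : mapA 0 = 0 :> trop_vec R isoplane.
Proof. by rewrite -(scale0r (0 : trop_vec R line)) mapAZ scale0r. Qed.

(** By [mapA_ray] each generator goes to a positive multiple of a vertex modulo [ones]. The reverse
    inclusion divides by that multiple and absorbs the shift. *)
Lemma image_cone_dset c : c \in cones ->
  image_cone R (dset c) = cone_over (@indic R isoplane) (tset c).
Proof.
move=> cC; apply/seteqP; split=> v.
  move=> [_ [a [t [a0 ->]]] <-].
  rewrite mapAD mapAZ mapA_ones; apply: cone_overD; last first.
    by rewrite scalerA; apply: cone_over_ones.
  elim/big_rec: _ => [|F v' Fc H].
    by rewrite mapA0 -(scale0r (ones R isoplane)); apply: cone_over_ones.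
  rewrite mapAD; apply: cone_overD => //; rewrite mapAZ.
  apply: cone_overZ; first exact: a0.
  have /dsetP[r rc ->] := Fc; rewrite (mapA_ray (cones_lt cC rc)).
  apply: cone_overD; last exact: cone_over_ones.
  by apply: cone_overZ (ler0n _ _) (cone_over_gen _ _); apply/tsetP; exists r.
have imD v1 v2 : image_cone R (dset c) v1 -> image_cone R (dset c) v2 ->
    image_cone R (dset c) (v1 + v2).
  move=> [w1 c1 <-] [w2 c2 <-]; exists (w1 + w2); last by rewrite mapAD.
  exact: cone_overD.
have imZ k v1 : 0 <= k -> image_cone R (dset c) v1 -> image_cone R (dset c) (k *: v1).
  move=> k0 [w1 c1 <-]; exists (k *: w1); last by rewrite mapAZ.
  exact: cone_overZ.
have im1 k : image_cone R (dset c) (k *: ones R isoplane).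
  (* An isotropic plane has four lines, so A multiplies the all-one vector by 4. *)
  exists ((k / 4%:R) *: ones R line); first exact: cone_over_ones.
  by rewrite mapAZ mapA_ones scalerA divfK // pnatr_eq0.
move=> [a [t [a0 ->]]]; apply: (imD _ _) => //.
apply: (big_rec (image_cone R (dset c))) => [|G v' Gc H].
  by rewrite -(scale0r (ones R isoplane)).
apply: (imD _ _) => //; apply: (imZ _ _); first exact: a0.
have /tsetP[r rc ->] := Gc; have r170 := cones_lt cC rc.
have m0 : (mult r)%:R != 0 :> R by rewrite pnatr_eq0 /mult; case: ifP.
have -> : indic R (vset (vert r)) = (mult r)%:R^-1 *:
    (mapA (indic R (rset r)) + (- (shift r)%:R) *: ones R isoplane).
  by rewrite mapA_ray // -addrA -scalerDl subrr scale0r addr0 scalerK.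
apply: (imZ _ _); first by rewrite invr_ge0 ler0n.
apply: (imD _ _) => //; exists (indic R (rset r)) => //.
by apply: cone_over_gen; apply/dsetP; exists r.
Qed.

End MapA.

(** * Census of the cones *)
Fixpoint lex_le (s t : seq nat) : bool :=
  match s, t with
  | x :: s', y :: t' => if x == y then lex_le s' t' else (x <= y)%N
  | [::], _ => true
  | _, _ => false
  end.

(** The sorted vertices of the image form a complete invariant of the image cone, which makes fibres
    of A on cones computable by sorting. *)
Definition key_of (t : seq nat) (c : seq nat) : seq nat :=
  foldr insert [::] [seq vert_of t r | r <- c].
Definition key : seq nat -> seq nat := key_of vert_table.

(** The number of vertices and, among them, the number of plane pairs: this pair distinguishes the
    six types. *)
Definition signature (x : seq nat) : nat * nat := (size x, count (leq 40) x).

(* The keys of [l], sorted, form [n] blocks of [k] equal elements. *)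
Definition blocks (t : seq nat) (l : seq (seq nat)) (n k : nat) : seq (seq nat) :=
  let s := sort lex_le [seq key_of t c | c <- l] in
  [seq nth [::] s (k * i)%N | i <- iota 0 n].

Definition fiber_check (t : seq nat) (n k : nat) (sg : nat * nat)
    (l : seq (seq nat)) : bool :=
  let d := blocks t l n k in
  [&& sort lex_le [seq key_of t c | c <- l] == flatten [seq nseq k x | x <- d],
      uniq d & all (fun x => (signature x == sg) && sorted ltn x) d].

Definition types_a := locked (mk_a ++ mk_h).
Definition types_b := locked mk_b.
Definition types_aa := locked (mk_aa orthn ++ mk_ah orthn).
Definition types_ab := locked ((mk_ab memb ++ mk_bh perpb) ++ mk_abp perpb).
Definition types_aab := locked (mk_aab memb perpb ++ mk_abh memb perpb).
Definition types_aaa := locked (mk_aah orthn).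

Lemma fiber_a : fiber_check vert_table 40 2 (1, 0)%N types_a.
Proof. by rewrite /types_a -lock /vert_table -lock; vm_cast_no_check (erefl true). Qed.

Lemma fiber_b : fiber_check vert_table 45 2 (1, 1)%N types_b.
Proof. by rewrite /types_b -lock /vert_table -lock; vm_cast_no_check (erefl true). Qed.

Lemma fiber_aa : fiber_check vert_table 240 3 (2, 0)%N types_aa.
Proof.
rewrite /types_aa -lock /vert_table -lock -orth_rawE.
vm_cast_no_check (erefl true).
Qed.

Lemma fiber_ab : fiber_check vert_table 360 3 (2, 1)%N types_ab.
Proof.
rewrite /types_ab -lock /vert_table -lock -memb_rawE -perpb_rawE.
vm_cast_no_check (erefl true).
Qed.

Lemma fiber_aab : fiber_check vert_table 720 4 (3, 1)%N types_aab.
Proof.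
rewrite /types_aab -lock /vert_table -lock -memb_rawE -perpb_rawE.
vm_cast_no_check (erefl true).
Qed.

Lemma fiber_aaa : fiber_check vert_table 160 3 (3, 0)%N types_aaa.
Proof.
rewrite /types_aaa -lock /vert_table -lock -orth_rawE.
vm_cast_no_check (erefl true).
Qed.

Lemma over_aE : over_a = dsets types_a.
Proof.
rewrite /over_a berg_aE berg_hE /types_a -lock (dsets_cat mk_a).
by rewrite /cones_a -lock /cones_h -lock.
Qed.

Lemma over_bE : over_b = dsets types_b.
Proof. by rewrite /over_b berg_bE /types_b -lock /cones_b -lock. Qed.

Lemma over_aaE : over_aa = dsets types_aa.
Proof.
rewrite /over_aa berg_aaE berg_ahE /types_aa -lock (dsets_cat (mk_aa orthn)).
by rewrite /cones_aa -lock /cones_ah -lock.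
Qed.

Lemma over_abE : over_ab = dsets types_ab.
Proof.
rewrite /over_ab berg_abE berg_bhE berg_abpE /types_ab -lock.
rewrite (dsets_cat (mk_ab memb ++ _)) (dsets_cat (mk_ab memb)).
by rewrite /cones_ab -lock /cones_bh -lock /cones_abp -lock.
Qed.

Lemma over_aabE : over_aab = dsets types_aab.
Proof.
rewrite /over_aab berg_aabE berg_abhE /types_aab -lock (dsets_cat (mk_aab _ _)).
by rewrite /cones_aab -lock /cones_abh -lock.
Qed.

Lemma over_aaaE : over_aaa = dsets types_aaa.
Proof. by rewrite /over_aaa berg_aahE /types_aaa -lock /cones_aah -lock. Qed.

Inductive cone_cases (c : seq nat) : Prop :=
| Case0 of c = [::] | CaseA of c \in types_a | CaseB of c \in types_b
| CaseAA of c \in types_aa | CaseAB of c \in types_ab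
| CaseAAB of c \in types_aab | CaseAAA of c \in types_aaa.

Lemma cones_cases c : c \in cones <-> cone_cases c.
Proof.
have mc (s t : seq (seq nat)) : (c \in s ++ t) = (c \in s) || (c \in t) := mem_cat c s t.
have Ea : (c \in types_a) = (c \in cones_a) || (c \in cones_h).
  by rewrite /types_a -lock (mc mk_a) /cones_a -lock /cones_h -lock.
have Eb : (c \in types_b) = (c \in cones_b) by rewrite /types_b -lock /cones_b -lock.
have Eaa : (c \in types_aa) = (c \in cones_aa) || (c \in cones_ah).
  by rewrite /types_aa -lock (mc (mk_aa _)) /cones_aa -lock /cones_ah -lock.
have Eab : (c \in types_ab) = [|| c \in cones_ab, c \in cones_bh | c \in cones_abp].
  rewrite /types_ab -lock (mc (mk_ab memb ++ _)) (mc (mk_ab memb)) -orbA.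
  by rewrite /cones_ab -lock /cones_bh -lock /cones_abp -lock.
have Eaab : (c \in types_aab) = (c \in cones_aab) || (c \in cones_abh).
  by rewrite /types_aab -lock (mc (mk_aab _ _)) /cones_aab -lock /cones_abh -lock.
have Eaaa : (c \in types_aaa) = (c \in cones_aah).
  by rewrite /types_aaa -lock /cones_aah -lock.
split=> [/mem_conesE[/eqP|/or3P[]|/or3P[||/or3P[]]|/or3P[]] H|].
- exact: Case0.
- by apply: CaseA; rewrite Ea H.
- by apply: CaseB; rewrite Eb H.
- by apply: CaseA; rewrite Ea H orbT.
- by apply: CaseAA; rewrite Eaa H.
- by apply: CaseAB; rewrite Eab; apply/or3P/Or31.
- by apply: CaseAA; rewrite Eaa H orbT.
- by apply: CaseAB; rewrite Eab; apply/or3P/Or32.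
- by apply: CaseAB; rewrite Eab; apply/or3P/Or33.
- by apply: CaseAAA; rewrite Eaaa H.
- by apply: CaseAAB; rewrite Eaab H orbT.
- by apply: CaseAAB; rewrite Eaab H.
case=> H; apply/mem_conesE.
- by apply: Or41; rewrite H.
- by apply: Or42; move: H; rewrite Ea => /orP[->|->]; rewrite ?orbT.
- by apply: Or42; rewrite -Eb H orbT.
- by apply: Or43; move: H; rewrite Eaa => /orP[->|->]; rewrite ?orbT.
- apply: Or43; move: H; rewrite Eab => /or3P[H|H|H]; apply/or3P; first exact: Or32.
    by apply/Or33/or3P/Or32.
  by apply/Or33/or3P/Or33.
- by apply: Or44; move: H; rewrite Eaab => /orP[->|->]; rewrite ?orbT.
- by apply: Or44; rewrite -Eaaa H.
Qed.

Section Fibers.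
Variables (n k : nat) (sg : nat * nat) (l : seq (seq nat)).
Hypothesis chk : fiber_check vert_table n k sg l.
Hypothesis k0 : (0 < k)%N.
Local Notation d := (blocks vert_table l n k).

Lemma fiber_perm : perm_eq [seq key c | c <- l] (flatten [seq nseq k x | x <- d]).
Proof.
have /and3P[/eqP E _ _] := chk.
by apply/permPl => p; rewrite -(perm_sort lex_le) E.
Qed.

Lemma fiber_uniq : uniq d. Proof. by case/and3P: chk. Qed.

Lemma fiber_mem x : (x \in [seq key c | c <- l]) = (x \in d).
Proof.
rewrite (perm_mem fiber_perm); apply/flatten_mapP/idP => [[y yd]|xd].
  by rewrite mem_nseq => /andP[_ /eqP ->].
by exists x => //; rewrite mem_nseq k0 eqxx.
Qed.

Lemma fiber_sig x : x \in d -> signature x = sg /\ sorted ltn x.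
Proof. by have /and3P[_ _ /allP H] := chk => /H /andP[/eqP]. Qed.

Lemma fiber_key c : c \in l -> [/\ key c \in d, signature (key c) = sg & sorted ltn (key c)].
Proof.
move=> cl; have kd : key c \in d by rewrite -fiber_mem map_f.
by have [] := fiber_sig kd.
Qed.

Lemma fiber_count x : x \in d -> count (fun c => key c == x) l = k.
Proof.
move=> xd; rewrite -(count_map key (pred1 x)) (permP fiber_perm).
rewrite count_flatten -map_comp sumnE big_map (bigD1_seq x) ?fiber_uniq //=.
rewrite count_nseq /= eqxx mul1n big1 ?addn0 // => y yx.
by rewrite count_nseq /= (negPf yx).
Qed.

Lemma size_blocks : size d = n. Proof. by rewrite size_map size_iota. Qed.

End Fibers.

Lemma key_mem c : key c =i [seq vert r | r <- c].
Proof.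
rewrite /key /key_of; elim: [seq _ | _ <- c] => // v s IH w.
by rewrite /= mem_insert !inE IH.
Qed.

Lemma size_key c : size (key c) = size c.
Proof.
rewrite /key /key_of -(size_map (vert_of vert_table) c).
by elim: [seq _ | _ <- c] => //= v s IH; rewrite size_insert IH.
Qed.

Lemma cone_case_fiber c : c \in cones -> c = [::] \/ exists n k sg l,
  [/\ fiber_check vert_table n k sg l, (0 < k)%N & c \in l].
Proof.
case/cones_cases => H; first (by left); right.
- by exists 40%N, 2%N, (1, 0)%N, types_a; split; rewrite ?fiber_a.
- by exists 45%N, 2%N, (1, 1)%N, types_b; split; rewrite ?fiber_b.
- by exists 240%N, 3%N, (2, 0)%N, types_aa; split; rewrite ?fiber_aa.
- by exists 360%N, 3%N, (2, 1)%N, types_ab; split; rewrite ?fiber_ab.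
- by exists 720%N, 4%N, (3, 1)%N, types_aab; split; rewrite ?fiber_aab.
- by exists 160%N, 3%N, (3, 0)%N, types_aaa; split; rewrite ?fiber_aaa.
Qed.

(** Strictness means that distinct rays of a cone have distinct vertices, so the image of a cone has
    as many vertices as the cone has rays. *)
Lemma key_sorted c : c \in cones -> sorted ltn (key c).
Proof.
move=> /cone_case_fiber[->|[n [k [sg [l [chk k0 cl]]]]]]; first by rewrite /key /key_of.
by have [] := fiber_key chk k0 cl.
Qed.

Lemma key_lt c v : c \in cones -> v \in key c -> (v < 85)%N.
Proof.
move=> cC; rewrite key_mem => /mapP[r rc ->].
exact: vert_lt (cones_lt cC rc).
Qed.

Lemma tset_key c c' : c \in cones -> c' \in cones ->
  tset c = tset c' <-> key c = key c'.
Proof.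
move=> cC c'C; split=> E.
  apply: (irr_sorted_eq ltn_trans ltnn (key_sorted cC) (key_sorted c'C)) => v.
  have half b b' : b \in cones -> b' \in cones -> tset b = tset b' ->
      v \in key b -> v \in key b'.
    move=> bC b'C Eb; rewrite !key_mem => /mapP[r rb ->].
    have : vset (vert r) \in tset b' by rewrite -Eb; apply/tsetP; exists r.
    case/tsetP => r' r'b' /(vset_inj (vert_lt (cones_lt bC rb)) (vert_lt (cones_lt b'C r'b'))) ->.
    exact: map_f.
  by apply/idP/idP; apply: half.
apply/setP => G; apply/tsetP/tsetP => -[r rc ->].
  have : vert r \in key c' by rewrite -E key_mem map_f.
  by rewrite key_mem => /mapP[r' r'c' ->]; exists r'.
have : vert r \in key c by rewrite E key_mem map_f.
by rewrite key_mem => /mapP[r' r'c' ->]; exists r'.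
Qed.

Lemma card_tset c : c \in cones -> #|tset c| = size c.
Proof.
move=> cC; have uk : uniq (key c) by apply: sorted_uniq (key_sorted cC); [apply: ltn_trans|apply: ltnn].
have -> : tset c = [set G in [seq vset v | v <- key c]].
  apply/setP => G; rewrite [in RHS]inE; apply/tsetP/mapP => [[r rc ->]|[v]].
    by exists (vert r) => //; rewrite key_mem map_f.
  by rewrite key_mem => /mapP[r rc ->] ->; exists r.
rewrite cardsE -(size_key c) -(size_map vset (key c)); apply/card_uniqP.
rewrite map_inj_in_uniq // => v v' vk v'k.
by apply: vset_inj; apply: key_lt cC _.
Qed.

Section Census.
Variables (R : realType) (n k : nat) (sg : nat * nat) (l : seq (seq nat)).
Hypothesis chk : fiber_check vert_table n k sg l.
Hypothesis k0 : (0 < k)%N.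
Hypothesis lu : uniq l.
Hypothesis lC : {subset l <= cones}.
Hypothesis sgl : forall c, c \in cones -> signature (key c) = sg -> c \in l.
Local Notation d := (blocks vert_table l n k).

Definition tsets (m : seq (seq nat)) : {set {set {set isoplane}}} :=
  [set s in [seq tset c | c <- m]].

Lemma tsetsP m s : reflect (exists2 c, c \in m & s = tset c) (s \in tsets m).
Proof. by rewrite inE; apply: mapP. Qed.

Lemma card_tsets : #|tsets l| = n.
Proof.
pose D x := [set G in [seq vset v | v <- x]].
have ED c : tset c = D (key c).
  apply/setP => G; rewrite [in RHS]inE; apply/tsetP/mapP => [[r rc ->]|[v]].
    by exists (vert r) => //; rewrite key_mem map_f.
  by rewrite key_mem => /mapP[r rc ->] ->; exists r.
have -> : tsets l = [set s in [seq D x | x <- d]].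
  apply/setP => s; rewrite [in RHS]inE; apply/tsetsP/mapP => [[c cl ->]|[x]].
    by exists (key c); rewrite ?ED // -(fiber_mem chk k0) map_f.
  by rewrite -(fiber_mem chk k0) => /mapP[c cl ->] ->; exists c; rewrite ?ED.
rewrite cardsE -[RHS](size_blocks n k l) -(size_map D); apply/card_uniqP.
rewrite map_inj_in_uniq ?(fiber_uniq chk) // => x y.
rewrite -!(fiber_mem chk k0) => /mapP[c cl ->] /mapP[c' c'l ->].
by rewrite -!ED => /(tset_key (lC cl) (lC c'l)).
Qed.

Lemma tsets_cone m : {subset m <= cones} ->
  trop_cones R (dsets m) = (cone_over (@indic R isoplane) @` [set` tsets m])%classic.
Proof.
move=> mC; apply/seteqP; split=> D.
  move=> [s [/dsetsP[c cm ->] ->]]; exists (tset c); first by apply/tsetsP; exists c.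
  by rewrite image_cone_dset // mC.
move=> [s /tsetsP[c cm ->] <-]; exists (dset c); split; first by apply/dsetsP; exists c.
by rewrite image_cone_dset // mC.
Qed.

Lemma tset_complex c : c \in cones -> tset c \in trop_complex.
Proof. by move=> cC; apply/trop_complexP; exists c. Qed.

(** Equal images mean equal keys by [tset_key]. An arbitrary Bergman cone with the same image then
    has the signature [sg], so [sgl] places it in [l], and the fibre is counted inside [l]. *)
Lemma census_of_fibers : census R (dsets l) n k.
Proof.
split.
  rewrite tsets_cone //; set f := cone_over _.
  have inj : {in [set` tsets l]%classic &, injective f}.
    move=> s s'; rewrite !inE => /tsetsP[c cl ->] /tsetsP[c' c'l ->].
    have cT := tset_complex (lC cl); have c'T := tset_complex (lC c'l).
    exact: (cone_eq trop_separated cT c'T).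
  apply: card_eq_trans (inj_card_eq inj) _.
  have /card_eq_fsetP : size (finmap.enum_fset (finmap.seq_fset tt (enum (tsets l)))) = n.
    by rewrite finmap.size_seq_fset undup_id ?enum_uniq // -cardE card_tsets.
  congr (is_true (_ #= _)%card); apply/seteqP.
  have E s : (s \in finmap.enum_fset (finmap.seq_fset tt (enum (tsets l)))) = (s \in tsets l).
    exact: etrans (finmap.seq_fsetE tt (enum (tsets l)) s) (mem_enum _ s).
  by split=> s H; [exact: etrans (esym (E s)) H|exact: etrans (E s) H].
move=> D [s [/dsetsP[c cl ->] ->]].
have cC := lC cl.
have kd : key c \in d by have [] := fiber_key chk k0 cl.
have E : mapping_onto (image_cone R (dset c)) = dsets [seq c' <- l | key c' == key c].
  apply/setP => s'; rewrite [in LHS]inE; apply/andP/(dsetsP _ _).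
    move=> [/berg_conesP[c' c'C ->] /asboolP Ei].
    have Ek : key c' = key c.
      apply/tset_key => //.
      apply: (@cone_eq R _ _ trop_separated _ _ (tset_complex c'C) (tset_complex cC)).
      by rewrite -!image_cone_dset.
    exists c' => //; rewrite mem_filter Ek eqxx sgl // Ek.
    by have [] := fiber_sig chk kd.
  move=> [c']; rewrite mem_filter => /andP[/eqP Ek c'l] ->.
  split; first by apply/berg_conesP; exists c' => //; apply: lC.
  apply/asboolP; rewrite !image_cone_dset ?lC //; congr cone_over.
  by apply/tset_key; rewrite ?lC.
rewrite E; split.
  apply/fintype.subsetP => s' /dsetsP[c']; rewrite mem_filter => /andP[_ c'l] ->.
  by apply/dsetsP; exists c'.
rewrite card_cone_list ?filter_uniq //.
  by rewrite size_filter; have H := fiber_count chk kd; exact H.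
by move=> c'; rewrite mem_filter => /andP[_ /lC].
Qed.

End Census.

Lemma signature_types c sg : c \in cones -> signature (key c) = sg ->
  [/\ sg = (1, 0)%N -> c \in types_a, sg = (1, 1)%N -> c \in types_b,
      sg = (2, 0)%N -> c \in types_aa, sg = (2, 1)%N -> c \in types_ab
    & (sg = (3, 1)%N -> c \in types_aab) /\ (sg = (3, 0)%N -> c \in types_aaa)].
Proof.
move=> cC <-; case/cones_cases: cC => [->|cl|cl|cl|cl|cl|cl] //.
- by have [_ -> _] := fiber_key fiber_a isT cl.
- by have [_ -> _] := fiber_key fiber_b isT cl.
- by have [_ -> _] := fiber_key fiber_aa isT cl.
- by have [_ -> _] := fiber_key fiber_ab isT cl.
- by have [_ -> _] := fiber_key fiber_aab isT cl.
- by have [_ -> _] := fiber_key fiber_aaa isT cl.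
Qed.

(** * Numbers of cones and of faces *)

Fixpoint lex_lt (s t : seq nat) : bool :=
  match s, t with
  | x :: s', y :: t' => if x == y then lex_lt s' t' else (x < y)%N
  | [::], _ :: _ => true
  | _, _ => false
  end.

Lemma lex_lt_irr : irreflexive lex_lt.
Proof. by elim=> //= x s ->; rewrite eqxx. Qed.

Lemma lex_lt_trans : transitive lex_lt.
Proof.
elim=> [|y t IH] [|x s] [|z u] //=.
have [-> //|xy] := eqVneq x y; first by case: ifP => // _; apply: IH.
case: eqP => [<- xy' _|_ xy' yz']; first by rewrite (negPf xy).
by have xz := ltn_trans xy' yz'; rewrite (ltn_eqF xz).
Qed.

(** Sorting and comparing neighbours avoids a quadratic test for repetitions. *)
Definition distinct_check (n : nat) (l : seq (seq nat)) : bool :=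
  (size l == n) && sorted lex_lt (sort lex_le l).

Lemma distinct_checkP n l : distinct_check n l -> size l = n /\ uniq l.
Proof.
move=> /andP[/eqP sl ss]; split=> //; rewrite -(sort_uniq lex_le).
exact: sorted_uniq lex_lt_trans lex_lt_irr _ ss.
Qed.

Lemma types_aa_check : distinct_check 720 types_aa.
Proof.
rewrite /types_aa -lock -orth_rawE.
vm_cast_no_check (erefl true).
Qed.

Lemma types_ab_check : distinct_check 1080 types_ab.
Proof.
rewrite /types_ab -lock -memb_rawE -perpb_rawE.
vm_cast_no_check (erefl true).
Qed.

Lemma types_aab_check : distinct_check 2880 types_aab.
Proof.
rewrite /types_aab -lock -memb_rawE -perpb_rawE.
vm_cast_no_check (erefl true).
Qed.

Lemma types_aaa_check : distinct_check 480 types_aaa.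
Proof.
rewrite /types_aaa -lock -orth_rawE.
vm_cast_no_check (erefl true).
Qed.

Lemma types_a_check : distinct_check 80 types_a.
Proof. by rewrite /types_a -lock; vm_cast_no_check (erefl true). Qed.

Lemma types_b_check : distinct_check 90 types_b.
Proof. by rewrite /types_b -lock; vm_cast_no_check (erefl true). Qed.

Lemma over_a_census R : census R over_a 40 2.
Proof.
have [_ ul] := distinct_checkP types_a_check.
rewrite over_aE; apply: (census_of_fibers R fiber_a isT ul).
  by move=> c H; apply/cones_cases; apply: CaseA.
by move=> c cC /(signature_types cC)[/(_ erefl)].
Qed.

Lemma over_b_census R : census R over_b 45 2.
Proof.
have [_ ul] := distinct_checkP types_b_check.
rewrite over_bE; apply: (census_of_fibers R fiber_b isT ul).
  by move=> c H; apply/cones_cases; apply: CaseB.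
by move=> c cC /(signature_types cC)[_ /(_ erefl)].
Qed.

Lemma over_aa_census R : census R over_aa 240 3.
Proof.
have [_ ul] := distinct_checkP types_aa_check.
rewrite over_aaE; apply: (census_of_fibers R fiber_aa isT ul).
  by move=> c H; apply/cones_cases; apply: CaseAA.
by move=> c cC /(signature_types cC)[_ _ /(_ erefl)].
Qed.

Lemma over_ab_census R : census R over_ab 360 3.
Proof.
have [_ ul] := distinct_checkP types_ab_check.
rewrite over_abE; apply: (census_of_fibers R fiber_ab isT ul).
  by move=> c H; apply/cones_cases; apply: CaseAB.
by move=> c cC /(signature_types cC)[_ _ _ /(_ erefl)].
Qed.

Lemma over_aab_census R : census R over_aab 720 4.
Proof.
have [_ ul] := distinct_checkP types_aab_check.
rewrite over_aabE; apply: (census_of_fibers R fiber_aab isT ul).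
  by move=> c H; apply/cones_cases; apply: CaseAAB.
by move=> c cC /(signature_types cC)[_ _ _ _ [/(_ erefl)]].
Qed.

Lemma over_aaa_census R : census R over_aaa 160 3.
Proof.
have [_ ul] := distinct_checkP types_aaa_check.
rewrite over_aaaE; apply: (census_of_fibers R fiber_aaa isT ul).
  by move=> c H; apply/cones_cases; apply: CaseAAA.
by move=> c cC /(signature_types cC)[_ _ _ _ [_ /(_ erefl)]].
Qed.

Lemma sub_types_uniq n l l1 l2 : distinct_check n l -> l = l1 ++ l2 -> uniq l1 /\ uniq l2.
Proof. by move=> /distinct_checkP[_ ul] E; move: ul; rewrite E cat_uniq => /and3P[]. Qed.

Lemma card_dsets_part l n : {subset l <= cones} -> uniq l -> size l = n -> #|dsets l| = n.
Proof. by move=> lC ul <-; apply: card_cone_list. Qed.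

Lemma size_mk_aa : size (mk_aa orth_raw) = 240%N.
Proof. by vm_cast_no_check (erefl 240%N). Qed.
Lemma size_mk_ah : size (mk_ah orth_raw) = 480%N.
Proof. by vm_cast_no_check (erefl 480%N). Qed.
Lemma size_mk_ab : size (mk_ab memb_raw) = 360%N.
Proof. by vm_cast_no_check (erefl 360%N). Qed.
Lemma size_mk_bh : size (mk_bh perpb_raw) = 360%N.
Proof. by vm_cast_no_check (erefl 360%N). Qed.
Lemma size_mk_abp : size (mk_abp perpb_raw) = 360%N.
Proof. by vm_cast_no_check (erefl 360%N). Qed.
Lemma size_mk_aab : size (mk_aab memb_raw perpb_raw) = 1440%N.
Proof. by vm_cast_no_check (erefl 1440%N). Qed.
Lemma size_mk_abh : size (mk_abh memb_raw perpb_raw) = 1440%N.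
Proof. by vm_cast_no_check (erefl 1440%N). Qed.

Lemma card_types_cat n l l1 l2 n1 n2 : distinct_check n l -> l = l1 ++ l2 ->
  {subset l <= cones} -> size l1 = n1 -> size l2 = n2 ->
  #|dsets l1| = n1 /\ #|dsets l2| = n2.
Proof.
move=> chk E lC s1 s2; have [u1 u2] := sub_types_uniq chk E.
have sub1 : {subset l1 <= cones} by move=> c c1; apply: lC; rewrite E mem_cat c1.
have sub2 : {subset l2 <= cones} by move=> c c2; apply: lC; rewrite E mem_cat c2 orbT.
by split; apply: card_dsets_part.
Qed.

Lemma cat_sub (l l1 l2 : seq (seq nat)) : l = l1 ++ l2 -> {subset l <= cones} ->
  {subset l1 <= cones} /\ {subset l2 <= cones}.
Proof.
by move=> E lC; split=> c H; apply: lC; rewrite E mem_cat H ?orbT.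
Qed.

Lemma types_a_sub : {subset types_a <= cones}.
Proof. by move=> c H; apply/cones_cases; apply: CaseA. Qed.
Lemma types_b_sub : {subset types_b <= cones}.
Proof. by move=> c H; apply/cones_cases; apply: CaseB. Qed.
Lemma types_aa_sub : {subset types_aa <= cones}.
Proof. by move=> c H; apply/cones_cases; apply: CaseAA. Qed.
Lemma types_ab_sub : {subset types_ab <= cones}.
Proof. by move=> c H; apply/cones_cases; apply: CaseAB. Qed.
Lemma types_aab_sub : {subset types_aab <= cones}.
Proof. by move=> c H; apply/cones_cases; apply: CaseAAB. Qed.
Lemma types_aaa_sub : {subset types_aaa <= cones}.
Proof. by move=> c H; apply/cones_cases; apply: CaseAAA. Qed.

Lemma types_aE : types_a = cones_a ++ cones_h.
Proof. by rewrite /types_a -lock /cones_a -lock /cones_h -lock. Qed.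
Lemma types_bE : types_b = cones_b.
Proof. by rewrite /types_b -lock /cones_b -lock. Qed.
Lemma types_aaE : types_aa = cones_aa ++ cones_ah.
Proof. by rewrite /types_aa -lock /cones_aa -lock /cones_ah -lock. Qed.
Lemma types_abE : types_ab = (cones_ab ++ cones_bh) ++ cones_abp.
Proof. by rewrite /types_ab -lock /cones_ab -lock /cones_bh -lock /cones_abp -lock. Qed.
Lemma types_aabE : types_aab = cones_aab ++ cones_abh.
Proof. by rewrite /types_aab -lock /cones_aab -lock /cones_abh -lock. Qed.
Lemma types_aaaE : types_aaa = cones_aah.
Proof. by rewrite /types_aaa -lock /cones_aah -lock. Qed.

Lemma card_berg_ah_a : #|berg_a| = 40%N /\ #|berg_h| = 40%N.
Proof.
rewrite berg_aE berg_hE; apply: (card_types_cat types_a_check types_aE types_a_sub).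
  by rewrite /cones_a -lock size_map size_iota.
by rewrite /cones_h -lock size_map size_iota.
Qed.

Lemma card_berg_b : #|berg_b| = 90%N.
Proof.
rewrite berg_bE -types_bE; have [s u] := distinct_checkP types_b_check.
exact: card_dsets_part types_b_sub u s.
Qed.

Lemma card_berg_aa_ah : #|berg_aa| = 240%N /\ #|berg_ah| = 480%N.
Proof.
rewrite berg_aaE berg_ahE; apply: (card_types_cat types_aa_check types_aaE types_aa_sub).
  by rewrite /cones_aa -lock -orth_rawE; apply: size_mk_aa.
by rewrite /cones_ah -lock -orth_rawE; apply: size_mk_ah.
Qed.

Lemma card_berg_ab_bh_abp :
  [/\ #|berg_ab| = 360%N, #|berg_bh| = 360%N & #|berg_abp| = 360%N].
Proof.
have [sub1 sub3] := cat_sub types_abE types_ab_sub.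
have [sub11 sub12] := cat_sub erefl sub1.
have [u1 u3] := sub_types_uniq types_ab_check types_abE.
have [u11 u12] : uniq cones_ab /\ uniq cones_bh by move: u1; rewrite cat_uniq => /and3P[].
rewrite berg_abE berg_bhE berg_abpE; split; apply: card_dsets_part => //.
- by rewrite /cones_ab -lock -memb_rawE; apply: size_mk_ab.
- by rewrite /cones_bh -lock -perpb_rawE; apply: size_mk_bh.
by rewrite /cones_abp -lock -perpb_rawE; apply: size_mk_abp.
Qed.

Lemma card_berg_aab_abh : #|berg_aab| = 1440%N /\ #|berg_abh| = 1440%N.
Proof.
rewrite berg_aabE berg_abhE; apply: (card_types_cat types_aab_check types_aabE types_aab_sub).
  by rewrite /cones_aab -lock -memb_rawE -perpb_rawE; apply: size_mk_aab.
by rewrite /cones_abh -lock -memb_rawE -perpb_rawE; apply: size_mk_abh.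
Qed.

Lemma card_berg_aah : #|berg_aah| = 480%N.
Proof.
rewrite berg_aahE -types_aaaE; have [s u] := distinct_checkP types_aaa_check.
exact: card_dsets_part types_aaa_sub u s.
Qed.

Lemma faces_trop_complex k m m' : {subset m <= cones} -> {subset m' <= cones} ->
  (forall c, c \in cones -> size c = k <-> c \in m \/ c \in m') ->
  faces trop_complex k = tsets m :|: tsets m'.
Proof.
move=> mC m'C H; apply/setP => s; rewrite !inE -/(tsets m) -/(tsets m').
apply/andP/orP => [[/mapP[c cC ->]]|[/mapP[c cm ->]|/mapP[c cm ->]]].
- rewrite card_tset // => /eqP /(H c cC) [cm|cm]; [left|right]; exact: map_f.
- by rewrite map_f ?mC // card_tset ?mC //; split=> //; apply/eqP/H; rewrite ?mC //; left.
by rewrite map_f ?m'C // card_tset ?m'C //; split=> //; apply/eqP/H; rewrite ?m'C //; right.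
Qed.

Lemma size_types c : c \in cones ->
  [/\ size c = 1%N <-> c \in types_a \/ c \in types_b,
      size c = 2%N <-> c \in types_aa \/ c \in types_ab
    & size c = 3%N <-> c \in types_aab \/ c \in types_aaa].
Proof.
move=> cC; have sz n k sg l : fiber_check vert_table n k sg l -> (0 < k)%N ->
    c \in l -> size c = sg.1.
  by move=> chk k0 cl; have [_ <- _] := fiber_key chk k0 cl; rewrite -size_key.
split; split.
- case/cones_cases: cC => [->|cl|cl|cl|cl|cl|cl] //; try (by left); try (by right).
  + by rewrite (sz _ _ _ _ fiber_aa isT cl).
  + by rewrite (sz _ _ _ _ fiber_ab isT cl).
  + by rewrite (sz _ _ _ _ fiber_aab isT cl).
  + by rewrite (sz _ _ _ _ fiber_aaa isT cl).
- by case=> cl; rewrite ?(sz _ _ _ _ fiber_a isT cl) ?(sz _ _ _ _ fiber_b isT cl).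
- case/cones_cases: cC => [->|cl|cl|cl|cl|cl|cl] //; try (by left); try (by right).
  + by rewrite (sz _ _ _ _ fiber_a isT cl).
  + by rewrite (sz _ _ _ _ fiber_b isT cl).
  + by rewrite (sz _ _ _ _ fiber_aab isT cl).
  + by rewrite (sz _ _ _ _ fiber_aaa isT cl).
- by case=> cl; rewrite ?(sz _ _ _ _ fiber_aa isT cl) ?(sz _ _ _ _ fiber_ab isT cl).
- case/cones_cases: cC => [->|cl|cl|cl|cl|cl|cl] //; try (by left); try (by right).
  + by rewrite (sz _ _ _ _ fiber_a isT cl).
  + by rewrite (sz _ _ _ _ fiber_b isT cl).
  + by rewrite (sz _ _ _ _ fiber_aa isT cl).
  + by rewrite (sz _ _ _ _ fiber_ab isT cl).
- by case=> cl; rewrite ?(sz _ _ _ _ fiber_aab isT cl) ?(sz _ _ _ _ fiber_aaa isT cl).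
Qed.

Lemma card_tsetsU n k sg m n' k' sg' m' :
  fiber_check vert_table n k sg m -> (0 < k)%N -> {subset m <= cones} ->
  fiber_check vert_table n' k' sg' m' -> (0 < k')%N -> {subset m' <= cones} ->
  sg != sg' -> #|tsets m :|: tsets m'| = (n + n')%N.
Proof.
move=> chk k0 mC chk' k'0 m'C sgN; rewrite cardsU.
rewrite (card_tsets chk k0 mC) (card_tsets chk' k'0 m'C).
suff -> : tsets m :&: tsets m' = finset.set0 by rewrite cards0 subn0.
apply/setP => s; rewrite !inE -/(tsets m); apply/negP => /andP[/mapP[c cm ->] /mapP[c' c'm]].
move=> /(tset_key (mC _ cm) (m'C _ c'm)) E; move: sgN.
have [_ <- _] := fiber_key chk k0 cm; have [_ <- _] := fiber_key chk' k'0 c'm.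
by rewrite E eqxx.
Qed.

Lemma trop_faces1 : faces trop_complex 1 = tsets types_a :|: tsets types_b.
Proof.
apply: faces_trop_complex => [||c cC]; [exact: types_a_sub|exact: types_b_sub|].
by have [] := size_types cC.
Qed.

Lemma trop_faces2 : faces trop_complex 2 = tsets types_aa :|: tsets types_ab.
Proof.
apply: faces_trop_complex => [||c cC]; [exact: types_aa_sub|exact: types_ab_sub|].
by have [] := size_types cC.
Qed.

Lemma trop_faces3 : faces trop_complex 3 = tsets types_aab :|: tsets types_aaa.
Proof.
apply: faces_trop_complex => [||c cC]; [exact: types_aab_sub|exact: types_aaa_sub|].
by have [] := size_types cC.
Qed.

Lemma card_trop_faces :
  [/\ #|faces trop_complex 1| = 85%N, #|faces trop_complex 2| = 600%N
    & #|faces trop_complex 3| = 880%N].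
Proof.
rewrite trop_faces1 trop_faces2 trop_faces3; split.
- exact: (card_tsetsU fiber_a isT types_a_sub fiber_b isT types_b_sub isT).
- exact: (card_tsetsU fiber_aa isT types_aa_sub fiber_ab isT types_ab_sub isT).
exact: (card_tsetsU fiber_aab isT types_aab_sub fiber_aaa isT types_aaa_sub isT).
Qed.

Lemma trop_complex_dim : (\max_(s in trop_complex) #|s| = 3)%N.
Proof.
apply/eqP; rewrite eqn_leq; apply/andP; split.
  apply/bigmax_leqP => s /trop_complexP[c cC ->].
  by rewrite card_tset //; apply: cones_size.
have [_ _ c3] := card_trop_faces.
have : (0 < #|faces trop_complex 3|)%N by rewrite c3.
case/card_gt0P => s; rewrite inE => /andP[sT /eqP <-].
exact: (@leq_bigmax_cond _ _ (fun s : {set {set isoplane}} => #|s|)).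
Qed.

Lemma trop_cones_faces (R : realType) k m m' P Q :
  P = dsets m -> Q = dsets m' -> {subset m <= cones} -> {subset m' <= cones} ->
  faces trop_complex k = tsets m :|: tsets m' ->
  (fun D => exists s, s \in faces trop_complex k /\
     D = cone_over (@indic R isoplane) s) = trop_cones R (P :|: Q).
Proof.
move=> -> -> mC m'C ->; rewrite -dsets_cat tsets_cone => [|c]; last first.
  by rewrite mem_cat => /orP[/mC|/m'C].
have memU s : (s \in tsets m :|: tsets m') = (s \in tsets (m ++ m')).
  by rewrite !inE map_cat mem_cat.
apply/seteqP; split=> D.
  by move=> [s [sT ->]]; exists s => //; exact: etrans (esym (memU s)) sT.
by move=> [s sT <-]; exists s; split=> //; exact: etrans (memU s) sT.
Qed.

(** * The forms of G32 and their flats *)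
(* [(a, b)] stands for [a + b w], where [w ^ 2 = - 1 - w]. *)
Definition eis : Type := (int * int)%type.

(** The integer operations are called directly rather than through the ring structure, as these
    programs are run in the virtual machine. *)
Definition eadd (x y : eis) : eis := (intZmod.addz x.1 y.1, intZmod.addz x.2 y.2).
Definition eopp (x : eis) : eis := (intZmod.oppz x.1, intZmod.oppz x.2).
Definition emul (x y : eis) : eis :=
  let bd := intRing.mulz x.2 y.2 in
  (intZmod.addz (intRing.mulz x.1 y.1) (intZmod.oppz bd),
   intZmod.addz (intZmod.addz (intRing.mulz x.1 y.2) (intRing.mulz x.2 y.1)) (intZmod.oppz bd)).
Definition econj (x : eis) : eis :=
  (intZmod.addz x.1 (intZmod.oppz x.2), intZmod.oppz x.2).

Definition e0 : eis := (Posz 0, Posz 0).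
Definition e1 : eis := (Posz 1, Posz 0).
Definition es : eis := (Posz 1, Posz 2).
Definition ez (k : nat) : eis :=
  nth e0 [:: e1; (Posz 0, Posz 1); (Negz 0, Negz 0)] (k %% 3)%N.

Definition forms_raw : seq (seq eis) :=
  [:: [:: es; e0; e0; e0]; [:: e0; es; e0; e0]; [:: e0; e0; es; e0]; [:: e0; e0; e0; es]]
  ++ [seq [:: e0; e1; ez (i + 2 * j); ez (2 * i + 2 * j)]%N | i <- digits3, j <- digits3]
  ++ [seq [:: ez (i + 2 * j)%N; e0; e1; eopp (ez j)] | i <- digits3, j <- digits3]
  ++ [seq [:: ez i; eopp (ez j); e0; e1] | i <- digits3, j <- digits3]
  ++ [seq [:: e1; ez (2 * i + 2 * j)%N; eopp (ez (2 * i)%N); e0] | i <- digits3, j <- digits3].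

Definition forms := locked forms_raw.

Definition edot (f p : seq eis) : eis :=
  foldr (fun fp s => eadd (emul fp.1 fp.2) s) e0 (zip f p).

(** For l distinct from h, the forms of l and h are Hermitian orthogonal exactly when l and h are
    orthogonal, so the conjugate of the form of h is a zero of precisely the forms in the ray (ä) of
    h. Every form has Hermitian norm 3, whence the factor -3 in [bpoint]. *)
Definition hpoint (fs : seq (seq eis)) h : seq eis := [seq econj x | x <- nth [::] fs h].

(* A point orthogonal to [u_l] in the span of the conjugates of [u_l] and [u_m]. *)
Definition bpoint (fs : seq (seq eis)) l m : seq eis :=
  let c := edot (nth [::] fs l) (hpoint fs m) in
  [seq eadd (emul c xy.1) (emul (Negz 2, Posz 0) xy.2)
    | xy <- zip (hpoint fs l) (hpoint fs m)].

(* The rank 3 flats, each given by the disjoint rays it is the union of and by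
   a common zero of its forms. *)
Definition flats_of (q : nat -> nat -> bool) (fs : seq (seq eis)) :
    seq (seq nat * seq eis) :=
  [seq ([:: 40 + h]%N, hpoint fs h) | h <- iota 0 40]
  ++ [seq ([:: p.1; 80 + p.2]%N,
           bpoint fs p.1 (find (fun m => q p.2 m && (m != p.1)) (iota 0 40)))
       | p <- pairs_lb & q p.2 p.1].

Definition flats := locked (flats_of perpb_raw forms_raw).

Definition lmask (R : seq bitseq) (d : seq nat) (k : nat) : bool :=
  has (fun r => nth false (nth [::] R r) k) d.

Definition eis0 (x : eis) : bool :=
  match x with (Posz 0, Posz 0) => true | _ => false end.

Definition zero_check (R : seq bitseq) (fs : seq (seq eis)) (fl : seq (seq nat * seq eis)) :=
  lall (fun F => if size F.2 == 4%N then
     lall (fun k => eis0 (edot (nth [::] fs k) F.2) == lmask R F.1 k) (iota 0 40)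
     else false) fl.

Lemma zero_checkP : zero_check rays forms flats.
Proof.
rewrite /flats -lock /forms -lock /rays -lock.
vm_cast_no_check (erefl true).
Qed.

Section Eval.
Variables (K : fieldType) (w : K).
Hypothesis char0 : [pchar K] =i pred0.
Hypothesis w_prim : 3.-primitive_root w.

Definition eis_val (x : eis) : K := x.1%:~R + x.2%:~R * w.

Lemma w3 : w ^+ 3 = 1. Proof. exact: prim_expr_order. Qed.

Lemma w_neq1 : w != 1.
Proof. by apply/eqP => E; have := prim_order_dvd w_prim 1; rewrite expr1 E eqxx. Qed.

Lemma w2 : w ^+ 2 = -1 - w.
Proof.
have /eqP : (w - 1) * (w ^+ 2 + w + 1) = 0.
  have -> : (w - 1) * (w ^+ 2 + w + 1) = w ^+ 3 - 1 by ring.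
  by rewrite w3 subrr.
rewrite mulf_eq0 subr_eq0 (negPf w_neq1) /= => /eqP E.
by apply/eqP; rewrite -subr_eq0 -E; apply/eqP; ring.
Qed.

Lemma eis_valD x y : eis_val (eadd x y) = eis_val x + eis_val y.
Proof. by rewrite /eis_val /= !(intrD, rmorphD) /=; ring. Qed.

Lemma eis_valN x : eis_val (eopp x) = - eis_val x.
Proof. by rewrite /eis_val /= !rmorphN /=; ring. Qed.

Lemma eis_valM x y : eis_val (emul x y) = eis_val x * eis_val y.
Proof.
rewrite /eis_val /emul /= !(rmorphD, rmorphN, rmorphM) /=.
have -> : (x.1%:~R + x.2%:~R * w) * (y.1%:~R + y.2%:~R * w) =
  x.1%:~R * y.1%:~R + (x.1%:~R * y.2%:~R + x.2%:~R * y.1%:~R) * w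
   + x.2%:~R * y.2%:~R * w ^+ 2 :> K by ring.
rewrite w2; ring.
Qed.

Lemma intr_eq0_char0 (a : int) : (a%:~R == 0 :> K) = (a == 0).
Proof.
have natr n : (n%:R == 0 :> K) = (n == 0)%N by exact: (pcharf0P K).1.
by case: a => n; [exact: natr|rewrite NegzE rmorphN oppr_eq0; exact: natr].
Qed.

(** Multiplying by the conjugate gives the norm a^2 - a b + b^2, an integer that vanishes in
    characteristic 0 only if it is 0, and a definite form. *)
Lemma eis_val_eq0 x : (eis_val x == 0) = eis0 x.
Proof.
case: x => a b; apply/eqP/idP => [E|]; last first.
  by rewrite /eis0; case: a => [[|?]|?] //; case: b => [[|?]|?] // _; rewrite /eis_val /= mul0r addr0.
have N : a * a - a * b + b * b = 0.
  apply/eqP; rewrite -intr_eq0_char0 !(rmorphD, rmorphN, rmorphM) /=; apply/eqP.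
  have -> : a%:~R * a%:~R - a%:~R * b%:~R + b%:~R * b%:~R =
     (a%:~R + b%:~R * w) * (a%:~R + b%:~R * (-1 - w)) + b%:~R * b%:~R * (w ^+ 2 + w + 1) :> K.
    by ring.
  by rewrite w2; move: E; rewrite /eis_val /= => ->; ring.
have b0 : b = 0 by nia.
have a0 : a = 0 by nia.
by rewrite a0 b0.
Qed.

Definition form_val (f : seq eis) : 'rV[K]_4 := \row_(k < 4) eis_val (nth e0 f k).

Lemma eis_val0 : eis_val e0 = 0.
Proof. by rewrite /eis_val /= mul0r addr0. Qed.

Lemma edot_val f p : size p = 4%N ->
  \sum_(k < 4) form_val f 0 k * form_val p 0 k = eis_val (edot f p).
Proof.
move=> sp; under eq_bigr do rewrite !mxE.
rewrite -(big_mkord xpredT (fun k => eis_val (nth e0 f k) * eis_val (nth e0 p k))) -sp.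
elim: p f {sp} => [|y p IH] [|x f] /=.
- by rewrite big_geq ?eis_val0.
- by rewrite big_geq ?eis_val0.
- by rewrite eis_val0 big1 // => k _; rewrite nth_nil eis_val0 mul0r.
by rewrite big_nat_recl //= IH eis_valD eis_valM.
Qed.

End Eval.

Section Forms.
Variables (K : fieldType) (w : K).
Hypothesis w_prim : 3.-primitive_root w.
Local Notation val4 := (form_val w).

Lemma ez_val (k : nat) : eis_val w (ez k) = w ^+ k.
Proof.
rewrite -(prim_expr_mod w_prim) /ez /eis_val.
case: (k %% 3)%N (ltn_pmod k (isT : 0 < 3)%N) => [|[|[|]]] //= _.
- by rewrite mul0r addr0.
- by rewrite add0r mul1r.
by rewrite (w2 w_prim) mulN1r.
Qed.

Lemma ezE (k : nat) (x : 'F_3) : (x : nat) = (k %% 3)%N -> w ^+ (x : nat) = eis_val w (ez k).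
Proof. by move=> ->; rewrite (prim_expr_mod w_prim) ez_val. Qed.

Lemma form_valE a b c d :
  val4 [:: a; b; c; d] = row4 (eis_val w a) (eis_val w b) (eis_val w c) (eis_val w d).
Proof. by apply/row4P; apply: ord4P; rewrite !mxE !inordK. Qed.

Lemma es_val : eis_val w es = w - w ^+ 2.
Proof. by rewrite (w2 w_prim) /eis_val /=; ring. Qed.

Lemma e1_val : eis_val w e1 = 1.
Proof. by rewrite /eis_val /= mul0r addr0. Qed.

Lemma enum_F3 : enum 'F_3 = [seq i%:R | i <- digits3].
Proof.
have szE : size (enum 'F_3) = 3%N by rewrite -cardE card_Fp.
apply: (@eq_from_nth _ 0) => [|i]; first by rewrite szE.
rewrite szE => i3; rewrite (nth_map 0%N) //; apply: val_inj.
transitivity i; first exact: (@nth_enum_ord 3 0 i i3).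
by case: i i3 => [|[|[|]]].
Qed.

Lemma table_block (f : nat -> nat -> seq nat) (g : nat -> nat -> seq eis)
    (F : 'F_3 -> 'F_3 -> 'rV['F_3]_4) (G : 'F_3 -> 'F_3 -> 'rV[K]_4) :
  (forall i j, i \in digits3 -> j \in digits3 -> F i%:R j%:R = dvec (f i j)) ->
  (forall i j, i \in digits3 -> j \in digits3 -> G i%:R j%:R = val4 (g i j)) ->
  [seq (F i j, G i j) | i <- enum 'F_3, j <- enum 'F_3] =
  [seq (dvec p.1, val4 p.2) | p <- zip [seq f i j | i <- digits3, j <- digits3]
                                        [seq g i j | i <- digits3, j <- digits3]].
Proof. by move=> HF HG; rewrite enum_F3 /= !HF // !HG. Qed.

Lemma g32_tableE :
  g32_table w = [seq (dvec p.1, val4 p.2) | p <- zip reps forms].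
Proof.
have d3 (P : nat -> nat -> bool) : all (fun i => all (P i) digits3) digits3 ->
    forall i j, i \in digits3 -> j \in digits3 -> P i j.
  by move=> /allP H i j /H /allP H' /H'.
have sub i j : i \in digits3 -> j \in digits3 ->
    (i%:R - j%:R : 'F_3) = ((i + 2 * j) %% 3)%N :> nat.
  move=> id jd; apply/eqP; move: i j id jd; apply: d3; by vm_compute.
have opp i j : i \in digits3 -> j \in digits3 ->
    (- i%:R - j%:R : 'F_3) = ((2 * i + 2 * j) %% 3)%N :> nat.
  move=> id jd; apply/eqP; move: i j id jd; apply: d3; by vm_compute.
have opp1 i : i \in digits3 -> (- i%:R : 'F_3) = ((2 * i) %% 3)%N :> nat.
  by move=> id; have := opp i 0 id isT; rewrite subr0 muln0 addn0.
have nat3 i : i \in digits3 -> (i%:R : 'F_3) = (i %% 3)%N :> nat by move=> _; apply: nat_F3.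
rewrite /forms -lock /forms_raw /reps /g32_table.
rewrite !zip_cat ?map_cat ?size_allpairs //; congr (_ ++ (_ ++ (_ ++ (_ ++ _)))).
- by rewrite /= !form_valE !eis_val0 es_val.
- apply: (table_block (f := fun i j => [:: i; j; 0; 1]%N)
    (g := fun i j => [:: e0; e1; ez (i + 2 * j); ez (2 * i + 2 * j)]%N)) => i j id jd; first by [].
  by rewrite form_valE eis_val0 e1_val (ezE (sub i j id jd)) (ezE (opp i j id jd)).
- apply: (table_block (f := fun i j => [:: i; j; 1; 0]%N)
    (g := fun i j => [:: ez (i + 2 * j)%N; e0; e1; eopp (ez j)])) => i j id jd; first by [].
  by rewrite form_valE eis_val0 e1_val eis_valN (ezE (sub i j id jd)) (ezE (nat3 j jd)).
- apply: (table_block (f := fun i j => [:: i; j; 1; 1]%N)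
    (g := fun i j => [:: ez i; eopp (ez j); e0; e1])) => i j id jd; first by [].
  by rewrite form_valE eis_val0 e1_val eis_valN (ezE (nat3 i id)) (ezE (nat3 j jd)).
- apply: (table_block (f := fun i j => [:: i; j; 1; 2]%N)
    (g := fun i j => [:: e1; ez (2 * i + 2 * j)%N; eopp (ez (2 * i)%N); e0])) => i j id jd; first by [].
  by rewrite form_valE eis_val0 e1_val eis_valN (ezE (opp i j id jd)) (ezE (opp1 i id)).
Qed.

Lemma size_forms : size forms = 40%N.
Proof. by rewrite /forms -lock. Qed.

Lemma g32_formE (l : line) : g32_form w l = val4 (nth [::] forms (idx l)).
Proof.
have sz : size reps = 40%N by [].
have szz : size (zip reps forms) = 40%N by rewrite size1_zip ?size_forms.
have E : find (fun p : 'rV['F_3]_4 * 'rV[K]_4 => p.1 \in val l) (g32_table w) = idx l.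
  rewrite g32_tableE find_map idx_find.
  transitivity (find (fun s => dvec s \in val l) (unzip1 (zip reps forms))).
    by rewrite find_map.
  by rewrite unzip1_zip // size_forms.
rewrite /g32_form E g32_tableE (nth_map ([::], [::])) ?szz ?idx_lt //.
by rewrite nth_zip ?size_forms.
Qed.

End Forms.

(** * Flats and flags of the 40 forms *)

Definition flat_rays_of (q : nat -> nat -> bool) : seq (seq nat) :=
  [seq [:: 40 + h]%N | h <- iota 0 40]
  ++ [seq [:: p.1; 80 + p.2]%N | p <- pairs_lb & q p.2 p.1].

Definition flat_rays := locked (flat_rays_of perpb_raw).

Lemma flat_rays_ofE q fs : flat_rays_of q = [seq F.1 | F <- flats_of q fs].
Proof. by rewrite /flat_rays_of /flats_of map_cat -!map_comp. Qed.

Lemma flat_raysE : flat_rays = [seq F.1 | F <- flats].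
Proof.
rewrite /flat_rays -lock /flats -lock; exact: (flat_rays_ofE perpb_raw forms_raw).
Qed.

Fixpoint sub_bits (a b : bitseq) : bool :=
  match a, b with
  | x :: a', y :: b' => if x then (if y then sub_bits a' b' else false) else sub_bits a' b'
  | x :: a', [::] => if x then false else sub_bits a' [::]
  | [::], _ => true
  end.

Fixpoint disjoint_bits (a b : bitseq) : bool :=
  match a, b with
  | x :: a', y :: b' =>
      if x then (if y then false else disjoint_bits a' b') else disjoint_bits a' b'
  | _, _ => true
  end.

Fixpoint or_bits (a b : bitseq) : bitseq :=
  match a, b with
  | x :: a', y :: b' => (if x then true else y) :: or_bits a' b'
  | [::], _ => b
  | _, [::] => a
  end.

Fixpoint and_bits (a b : bitseq) : bitseq :=
  match a, b with
  | x :: a', y :: b' => (if x then y else false) :: and_bits a' b'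
  | _, _ => [::]
  end.

Lemma sub_bitsP a b k : sub_bits a b -> nth false a k -> nth false b k.
Proof.
elim: a b k => [|x a IH] [|y b] [|k] //=; first by case: x.
- by case: x => // /IH H /H; rewrite nth_nil.
- by case: x => //; case: y.
by case: x; [case: y => // /IH H /H|move=> /IH H /H].
Qed.

Lemma sub_bitsPn a b : ~~ sub_bits a b -> exists2 k, nth false a k & ~~ nth false b k.
Proof.
elim: a b => [|x a IH] [|y b] //=.
  case: x => [_|/IH[k ak bk]]; first by exists 0%N.
  by exists k.+1 => //; rewrite nth_nil in bk *.
case: x => [|/IH[k ak bk]]; last by exists k.+1.
by case: y => [/IH[k ak bk]|_]; [exists k.+1|exists 0%N].
Qed.

Lemma disjoint_bitsP a b k : disjoint_bits a b -> nth false a k -> ~~ nth false b k.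
Proof.
elim: a b k => [|x a IH] [|y b] [|k] //=.
  by case: x => //; case: y.
by case: x; [case: y => // /IH H /H|move=> /IH H /H].
Qed.

Lemma nth_or_bits a b k : nth false (or_bits a b) k = nth false a k || nth false b k.
Proof.
by elim: a b k => [|x a IH] [|y b] [|k] //=; rewrite ?orbF ?nth_nil //.
Qed.

Lemma nth_and_bits a b k : nth false (and_bits a b) k = nth false a k && nth false b k.
Proof.
by elim: a b k => [|x a IH] [|y b] [|k] //=; rewrite ?andbF ?nth_nil //.
Qed.

Definition bits (R : seq bitseq) (d : seq nat) : bitseq :=
  foldr (fun r b => or_bits (nth [::] R r) b) (nseq 40 false) d.

Lemma nth_bits R d k : nth false (bits R d) k = lmask R d k.
Proof.
elim: d => [|r d IH]; first exact: etrans (nth_nseq false 40 false k) (if_same _ _).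
by rewrite [bits _ _]/(or_bits _ (bits R d)) nth_or_bits IH.
Qed.

Definition meet_bits (B : seq bitseq) : bitseq := foldr and_bits (nseq 40 true) B.
Definition join_bits (B : seq bitseq) : bitseq := foldr or_bits (nseq 40 false) B.

Lemma nth_meet_bits B k : (k < 40)%N ->
  nth false (meet_bits B) k = all (fun b => nth false b k) B.
Proof.
move=> k40; elim: B => [|b B IH].
  by have E := nth_nseq false 40 true k; rewrite k40 in E; exact: E.
by rewrite [meet_bits _]/(and_bits _ (meet_bits B)) nth_and_bits IH.
Qed.

Lemma nth_join_bits B k : nth false (join_bits B) k = has (fun b => nth false b k) B.
Proof.
elim: B => [|b B IH]; first exact: etrans (nth_nseq false 40 false k) (if_same _ _).
by rewrite [join_bits _]/(or_bits _ (join_bits B)) nth_or_bits IH.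
Qed.

(** Disjointness makes the indicator of a flat the sum of the indicators of its rays, as needed to
    write a point as a combination of rays. *)
Definition disjoint_rays (R : seq bitseq) (d : seq nat) : bool :=
  lall (fun k => count (fun r => nth false (nth [::] R r) k) d <= 1)%N (iota 0 40).

(** The flat of rank 2 through two lines consists of these two if they are orthogonal, and otherwise
    of the four lines of their plane. *)
Definition span2_rays (o : nat -> nat -> bool) (N : seq bitseq) (i j : nat) : seq nat :=
  if o i j then [:: i; j] else [:: 80 + index (pmask i j) N]%N.

Definition flag_cone (i : nat) (d2 d3 : seq nat) : seq nat :=
  sort leq (undup (i :: d2 ++ d3)).

(** The rank 2 flat is recognized as the intersection of the rank 3 flats through [i] and [j], and
    these must cover all lines. Each flag through them must give a cone; since pairs are listed with
    [i] below [j], both choices of the first line are tested. *)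
Definition pair_check (o m q : nat -> nat -> bool) (N R : seq bitseq)
    (FR : seq (seq nat * bitseq)) (i j : nat) : bool :=
  let d2 := span2_rays o N i j in
  let fl := [seq F <- FR | if nth false F.2 i then nth false F.2 j else false] in
  let B := [seq F.2 | F <- fl] in
  [&& disjoint_rays R d2, bits R d2 == meet_bits B, join_bits B == nseq 40 true
    & lall (fun F => if incone_of o m q (flag_cone i d2 F.1)
                     then incone_of o m q (flag_cone j d2 F.1) else false) fl].

Definition pairs_check (o m q : nat -> nat -> bool) (N R : seq bitseq)
    (D : seq (seq nat)) : bool :=
  let FR := [seq (d, bits R d) | d <- D] in
  lall (fun i => lall (fun j => pair_check o m q N R FR i j) (iota i.+1 (39 - i)))
    (iota 0 40).

Lemma pairs_checkP : pairs_check orthn memb perpb noniso_masks rays flat_rays.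
Proof.
rewrite /noniso_masks -lock /rays -lock /flat_rays -lock.
rewrite -orth_rawE -memb_rawE -perpb_rawE.
vm_cast_no_check (erefl true).
Qed.

Definition flat_check (R : seq bitseq) (d : seq nat) : bool :=
  if disjoint_rays R d then ~~ sub_bits (nseq 40 true) (bits R d) else false.

Lemma flats_check : lall (flat_check rays) flat_rays.
Proof.
rewrite /rays -lock /flat_rays -lock.
vm_cast_no_check (erefl true).
Qed.

Lemma flat_disjoint d : d \in flat_rays -> disjoint_rays rays d.
Proof.
by have := flats_check; rewrite lallE => /allP H /H; rewrite /flat_check; case: ifP.
Qed.

Lemma flat_proper d : d \in flat_rays -> exists2 k, (k < 40)%N & ~~ lmask rays d k.
Proof.
have := flats_check; rewrite lallE => /allP H /H; rewrite /flat_check; case: ifP => // _.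
move=> /sub_bitsPn[k]; rewrite nth_nseq nth_bits => k40 dk; exists k => //.
by move: k40; case: ifP.
Qed.

Definition maximal_rays (R : seq bitseq) (c : seq nat) : seq nat :=
  let ms := [seq (x, nth [::] R x) | x <- c] in
  [seq p.1 | p <- [seq p <- ms |
     lall (fun p' => if p.1 == p'.1 then true else ~~ sub_bits p.2 p'.2) ms]].

Definition nested_check (R : seq bitseq) (c : seq nat) : bool :=
  match c with
  | [:: x; y] => let a := nth [::] R x in let b := nth [::] R y in
     if sub_bits a b then true else if sub_bits b a then true else disjoint_bits a b
  | _ => true
  end.

(* The union of the rays of a cone is the union of a smaller set of rays,
   either a pair of orthogonal lines, a flat of rank 3, or at most one ray. *)
Definition union_check (q : nat -> nat -> bool) (R : seq bitseq) (c : seq nat) : bool :=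
  if nested_check R c then
    let d := maximal_rays R c in
    if match d with
       | [::] | [:: _] => true
       | [:: x; y] => if (y < 40)%N then true 
         else if (80 <= y)%N then (if (x < 40)%N then q (y - 80)%N x else false) else false
       | _ => false end
    then bits R d == bits R c else false
  else false.

Lemma cones_union_check : lall (union_check perpb rays) cones.
Proof.
rewrite conesE /rays -lock -orth_rawE -memb_rawE -perpb_rawE.
vm_cast_no_check (erefl true).
Qed.

(** An intersection of rank 3 flats is a flat, so this certifies that the union of the rays is
    one. *)
Definition closed_check (R : seq bitseq) (D : seq (seq nat)) (C : seq (seq nat)) : bool :=
  let FR := [seq bits R d | d <- D] in
  lall (fun c => let b := bits R c in b == meet_bits [seq F <- FR | sub_bits b F]) C.

Definition closed_cones_of (o : nat -> nat -> bool) : seq (seq nat) :=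
  [::] :: [seq [:: r] | r <- iota 0 170] ++ mk_aa o.

Lemma closed_checkP : closed_check rays flat_rays (closed_cones_of orthn).
Proof.
rewrite /rays -lock /flat_rays -lock -orth_rawE.
vm_cast_no_check (erefl true).
Qed.

Lemma union_checkP c : c \in cones -> union_check perpb rays c.
Proof. by have := cones_union_check; rewrite lallE => /allP H /H. Qed.

Lemma cones_nested c r r' : c \in cones -> r \in c -> r' \in c ->
  [\/ rset r \subset rset r', rset r' \subset rset r | [disjoint rset r & rset r']].
Proof.
move=> cC rc r'c; have [<-|rr'] := eqVneq r r'; first by apply: Or31; apply: subxx.
(* [nested_check] inspects cones with two rays, so the face spanned by these two is used. *)
pose d := [seq z <- c | z \in [:: r; r']].
have dC : d \in cones by apply: cones_filter.
have pd : perm_eq d [:: r; r'].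
  apply: uniq_perm => [||z]; rewrite ?(cones_uniq dC) //= ?inE ?rr' //.
  rewrite mem_filter !inE; case: eqP => [->|_]; first by rewrite rc.
  by case: eqP => [->|]; rewrite ?r'c.
have nest a b : d = [:: a; b] ->
    [\/ rset a \subset rset b, rset b \subset rset a | [disjoint rset a & rset b]].
  move=> E; have := union_checkP dC; rewrite /union_check E; case: ifP => // + _.
  rewrite /nested_check; case: ifP => [sub _|_].
    apply: Or31; apply/fintype.subsetP => l; rewrite !rsetE !inE; exact: sub_bitsP sub.
  case: ifP => [sub _|_ dis].
    apply: Or32; apply/fintype.subsetP => l; rewrite !rsetE !inE; exact: sub_bitsP sub.
  apply: Or33; rewrite disjoint_subset; apply/fintype.subsetP => l.
  by rewrite !rsetE !inE; apply: disjoint_bitsP dis.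
have : size d = 2%N by rewrite (perm_size pd).
case dE : d => [|a [|b []]] // _; have [ra rb] : (r \in [:: a; b]) /\ (r' \in [:: a; b]).
  by rewrite -dE !(perm_mem pd) !inE !eqxx orbT.
move: ra rb; rewrite !inE => /orP[]/eqP ra /orP[]/eqP rb; move: rr'.
- by rewrite ra rb eqxx.
- by move=> _; rewrite ra rb; apply: nest.
- move=> _; rewrite ra rb; case: (nest a b dE) => H; first exact: Or32.
    exact: Or31.
  by apply: Or33; rewrite disjoint_sym.
by rewrite ra rb eqxx.
Qed.

Lemma closed_flat c k : c \in closed_cones_of orthn -> (k < 40)%N -> ~~ lmask rays c k ->
  exists2 d, d \in flat_rays & ~~ lmask rays d k /\
    forall k', lmask rays c k' -> lmask rays d k'.
Proof.
move=> cC k40 ck; have := closed_checkP; rewrite /closed_check lallE => /allP /(_ c cC).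
move=> /eqP /(congr1 (fun b => nth false b k)).
rewrite nth_bits nth_meet_bits // (negPf ck) => /esym /negbT /allPn[b].
rewrite mem_filter => /andP[sub /mapP[d df bE]]; rewrite bE nth_bits => dk.
rewrite bE in sub.
exists d => //; split=> // k' ck'; rewrite -nth_bits; apply: (sub_bitsP sub).
by rewrite nth_bits.
Qed.

(** The union of the rays is that of the maximal ones, which span a face. By [union_check] this face
    is a rank 3 flat itself or one of the cones in [closed_cones_of]; in both cases a line outside
    is avoided by a rank 3 flat. *)
Lemma cones_closed c k : c \in cones -> (k < 40)%N -> ~~ lmask rays c k ->
  exists2 d, d \in flat_rays & ~~ lmask rays d k /\
    forall k', lmask rays c k' -> lmask rays d k'.
Proof.
move=> cC k40; have := union_checkP cC; rewrite /union_check; case: ifP => // _.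
set e := maximal_rays rays c; case: ifP => // shape /eqP E.
have Em k' : lmask rays c k' = lmask rays e k' by rewrite -!nth_bits E.
have ec : {subset e <= c}.
  move=> r /mapP[p]; rewrite mem_filter => /andP[_ /mapP[r' r'c ->]] ->.
  exact: r'c.
have eC : e \in cones.
  have -> : e = [seq x <- c | lall (fun p => if x == p.1 then true else
      ~~ sub_bits (nth [::] rays x) p.2) [seq (y, nth [::] rays y) | y <- c]].
    by rewrite /e /maximal_rays filter_map -map_comp map_id_in.
  exact: cones_filter.
rewrite Em => ek.
suff [d df [dk sub]] : exists2 d, d \in flat_rays & ~~ lmask rays d k /\
    forall k', lmask rays e k' -> lmask rays d k'.
  by exists d => //; split=> // k'; rewrite Em; apply: sub.
case: e shape ec eC ek {E Em} => [|x [|y []]] // shape ec eC ek.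
- exact: closed_flat.
- apply: closed_flat => //; rewrite inE mem_cat; apply/orP; right; apply/orP; left.
  by apply: map_f; rewrite mem_iota0; apply: (cones_lt eC); rewrite inE.
have := cone_checkP eC; case/and4P=> _ _ + _; rewrite lallE => /allP.
move=> /(_ _ (filter_subseqs predT [:: x; y])); rewrite filter_predT /incone_of.
move: shape; case: ifP => y40.
  move=> _ /andP[xy o]; apply: closed_flat => //; rewrite inE mem_cat; apply/orP; right.
  apply/orP; right; apply/mapP; exists (x, y) => //.
  by rewrite mem_filter mem_pairs40 xy o y40 (ltn_trans xy y40).
case: ifP => // y80; case: ifP => // x40 qx _.
have y170 : (y < 170)%N by apply: (cones_lt eC); rewrite !inE eqxx orbT.
exists [:: x; y] => //; rewrite /flat_rays -lock perpb_rawE mem_cat; apply/orP; right.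
apply/mapP; exists (x, y - 80)%N; last by rewrite /= subnKC.
by rewrite mem_filter mem_pairs_lb x40 qx ltn_subLR.
Qed.

Lemma lmaskE d (l : line) : lmask rays d (idx l) = has (fun r => l \in rset r) d.
Proof. by apply: eq_has => r; rewrite rsetE inE. Qed.

Lemma disjoint_raysP d l : disjoint_rays rays d ->
  count (fun r => l \in rset r) d = lmask rays d (idx l).
Proof.
rewrite /disjoint_rays lallE => /allP /(_ (idx l)); rewrite mem_iota0 idx_lt => /(_ isT).
have E : count (fun r => nth false (nth [::] rays r) (idx l)) d = count (fun r => l \in rset r) d.
  by apply: eq_count => r; rewrite rsetE inE.
rewrite E lmaskE has_count.
by case: (count _ d) => [|[|]].
Qed.

Lemma rank_adds_gt (K : fieldType) (m n k : nat) (A : 'M[K]_(m, k)) (B : 'M[K]_(n, k)) :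
  ~~ (B <= A)%MS -> (\rank A < \rank (A + B)%MS)%N.
Proof. by move=> BA; apply: rank_ltmx; rewrite ltmxE addsmxSl addsmx_sub submx_refl. Qed.

Section Flats.
Variables (K : fieldType) (w : K).
Hypothesis char0 : [pchar K] =i pred0.
Hypothesis w_prim : 3.-primitive_root w.
Local Notation u := (g32_form w).
Local Notation ev := (g32_eval w).

Lemma flat_point d : d \in flat_rays -> exists p : 'rV[K]_4, forall l,
  (ev l p == 0) = lmask rays d (idx l).
Proof.
rewrite flat_raysE => /mapP[F Fl ->]; exists (form_val w F.2) => l.
have := zero_checkP; rewrite /zero_check lallE => /allP /(_ F Fl).
case: eqP => // sF; rewrite lallE => /allP /(_ (idx l)); rewrite mem_iota0 idx_lt.
move=> /(_ isT) /eqP <-; rewrite -(eis_val_eq0 char0 w_prim) -(edot_val w_prim) //.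
by rewrite /g32_eval g32_formE.
Qed.

Lemma ev_ker l (p : 'rV[K]_4) : (u l <= kermx p^T)%MS = (ev l p == 0).
Proof.
rewrite (sameP sub_kermxP eqP).
have E : (u l *m p^T) 0 0 = ev l p by rewrite !mxE; apply: eq_bigr => k _; rewrite !mxE.
apply/eqP/eqP => [E0|E0]; first by rewrite -E E0 mxE.
by apply/matrixP => i j; rewrite !ord1 E E0 mxE.
Qed.

Lemma form_neq0 l : u l != 0.
Proof.
have hf : [:: 40 + idx l]%N \in flat_rays.
  rewrite /flat_rays -lock mem_cat map_f // mem_iota0; exact: idx_lt.
have [p /(_ l)] := flat_point hf; rewrite lmaskE /= orbF rset_h inE eqxx andbF => /negbT.
by apply: contra => /eqP E; rewrite -ev_ker E sub0mx.
Qed.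

(** Three independent forms vanishing at [p] span the three-dimensional space of all linear forms
    vanishing at [p]. *)
Lemma rank3_flat i1 i2 i3 (p : 'rV[K]_4) : ~~ (u i2 <= u i1)%MS ->
  ~~ (u i3 <= u i1 + u i2)%MS -> p != 0 -> ev i1 p = 0 -> ev i2 p = 0 -> ev i3 p = 0 ->
  forall l, (u l <= u i1 + u i2 + u i3)%MS = (ev l p == 0).
Proof.
move=> i12 i123 p0 E1 E2 E3 l; rewrite -ev_ker.
have sub : (u i1 + u i2 + u i3 <= kermx p^T)%MS.
  by rewrite !addsmx_sub !ev_ker E1 E2 E3 eqxx.
have r1 : (0 < \rank (u i1))%N by rewrite lt0n mxrank_eq0 form_neq0.
have rker : (\rank (kermx p^T) = 3)%N by rewrite mxrank_ker mxrank_tr rank_rV p0.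
have eqr : (\rank (u i1 + u i2 + u i3)%MS == \rank (kermx p^T))%N.
  rewrite eqn_leq (mxrankS sub) rker.
  have r2 := leq_ltn_trans r1 (rank_adds_gt i12).
  have r3 := leq_ltn_trans r2 (rank_adds_gt i123).
  exact: r3.
have /eqmxP E : (u i1 + u i2 + u i3 == kermx p^T)%MS.
  by have [_ <-] := mxrank_leqif_sup sub; rewrite sub.
by rewrite E.
Qed.

(** The first four forms are nonzero multiples of the coordinates. *)
Lemma forms_span (m : nat) (A : 'M[K]_(m, 4)) : (\rank A < 4)%N -> exists l, ~~ (u l <= A)%MS.
Proof.
move=> rA; apply/existsP; apply: contraLR rA => /existsPn H; rewrite -leqNgt.
have {}H l : (u l <= A)%MS by have := H l; rewrite negbK.
rewrite -[X in (X <= _)%N](@mxrank1 K 4); apply: mxrankS; apply/row_subP => k.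
have s0 : w - w ^+ 2 != 0.
  by rewrite -(es_val w_prim) (eis_val_eq0 char0 w_prim).
have [l lk] : exists l, idx l = k by apply: idx_onto; apply: ltn_trans (ltn_ord k) _.
have -> : row k 1%:M = (w - w ^+ 2)^-1 *: u l.
  rewrite g32_formE // lk /forms -lock; apply/rowP => j; rewrite !mxE /forms_raw nth_cat ltn_ord.
  rewrite -(es_val w_prim); set s := eis_val w es in s0 *.
  have sV : s^-1 * s = 1 by apply: mulVf; rewrite /s es_val.
  have s00 : s^-1 * eis_val w e0 = 0 by rewrite eis_val0 mulr0.
  by case: k lk => [[|[|[|[|k]]]] k4] // _; case: j => [[|[|[|[|j]]]] j4];
    rewrite //= ?sV ?s00.
exact: scalemx_sub.
Qed.

Lemma pair_flags i j : (i < 40)%N -> (j < 40)%N -> i != j -> exists d2,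
  [/\ disjoint_rays rays d2,
    (forall k, (k < 40)%N -> lmask rays d2 k =
       all (fun d => lmask rays d k) [seq d <- flat_rays | lmask rays d i && lmask rays d j]),
    (forall k, (k < 40)%N -> exists2 d, d \in flat_rays &
       [&& lmask rays d i, lmask rays d j & lmask rays d k])
  & forall d, d \in flat_rays -> lmask rays d i -> lmask rays d j ->
      flag_cone i d2 d \in cones].
Proof.
have pc a b : (a < b)%N -> (b < 40)%N ->
    pair_check orthn memb perpb noniso_masks rays [seq (d, bits rays d) | d <- flat_rays] a b.
  move=> ab b40; have := pairs_checkP; rewrite /pairs_check lallE => /allP /(_ a).
  rewrite mem_iota0 (ltn_trans ab b40) => /(_ isT); rewrite lallE => /allP /(_ b) H; apply: (H _).
  have a39 : (a <= 39)%N by exact: ltn_trans ab b40.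
  by rewrite mem_iota ab addSn subnKC.
have main a b : (a < b)%N -> (b < 40)%N -> exists d2,
  [/\ disjoint_rays rays d2,
    (forall k, (k < 40)%N -> lmask rays d2 k =
       all (fun d => lmask rays d k) [seq d <- flat_rays | lmask rays d a && lmask rays d b]),
    (forall k, (k < 40)%N -> exists2 d, d \in flat_rays &
       [&& lmask rays d a, lmask rays d b & lmask rays d k])
  & forall d, d \in flat_rays -> lmask rays d a -> lmask rays d b ->
      flag_cone a d2 d \in cones /\ flag_cone b d2 d \in cones].
  move=> ab b40; have /and4P[dis /eqP meet /eqP join cns] := pc a b ab b40.
  move: meet join cns; set fl := filter _ _ => meet join cns.
  have flE d : ((d, bits rays d) \in fl) = [&& d \in flat_rays, lmask rays d a & lmask rays d b].
    rewrite mem_filter /= !nth_bits; apply/andP/and3P => [[+ /mapP[d' d'f [dd' _]]]|[df -> ->]].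
      by case: ifP => // da db; split=> //; rewrite dd'.
    by split=> //; apply/mapP; exists d.
  have BE : [seq F.2 | F <- fl] =
      [seq bits rays d | d <- [seq d <- flat_rays | lmask rays d a && lmask rays d b]].
    rewrite /fl filter_map -!map_comp; congr map; apply: eq_filter => d /=.
    by rewrite !nth_bits; case: (lmask rays d a).
  exists (span2_rays orthn noniso_masks a b); split=> // [k k40|k k40|d df da db].
  - rewrite -nth_bits meet BE nth_meet_bits // all_map; apply: eq_all => d /=.
    exact: nth_bits.
  - have := congr1 (fun b => nth false b k) join; rewrite BE nth_join_bits nth_nseq k40.
    move=> /hasP[b' /mapP[d]]; rewrite mem_filter => /andP[/andP[da db] df] ->.
    by rewrite nth_bits => dk; exists d; rewrite ?da ?db.
  move: cns; rewrite lallE => /allP /(_ (d, bits rays d)); rewrite flE df da db => /(_ isT).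
  rewrite [_.1]/= -/(incone _) -/(incone _); case: ifP => // ca cb.
  by split; apply: incone_cones.
move=> i40 j40; rewrite neq_ltn => /orP[ij|ji].
  have [d2 [dis meet join cns]] := main i j ij j40; exists d2; split=> //.
  by move=> d df di dj; have [] := cns d df di dj.
have [d2 [dis meet join cns]] := main j i ji i40; exists d2; split=> //.
- by move=> k k40; rewrite meet //; congr all; apply: eq_filter => d; apply: andbC.
- by move=> k k40; have [d df /and3P[dj di dk]] := join k k40; exists d; rewrite ?dj ?di.
by move=> d df di dj; have [] := cns d df dj di.
Qed.

(** The rank 3 flat is any flat of the table containing [i1], [i2], [i3]: its common zero shows by
    [rank3_flat] that it is exactly their span. *)
Lemma flag_coneP i1 i2 i3 : ~~ (u i2 <= u i1)%MS -> ~~ (u i3 <= u i1 + u i2)%MS ->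
  exists c d2 d3, [/\ c \in cones, {subset d2 <= c}, {subset d3 <= c}, idx i1 \in c &
    (forall l, count (fun r => l \in rset r) d2 = (u l <= u i1 + u i2)%MS) /\
    (forall l, count (fun r => l \in rset r) d3 = (u l <= u i1 + u i2 + u i3)%MS)].
Proof.
move=> i12 i123; have ne : idx i1 != idx i2.
  by apply: contra i12 => /eqP /idx_inj ->; apply: submx_refl.
have [d2 [dis2 meet join cns]] := pair_flags (idx_lt i1) (idx_lt i2) ne.
have span3 d j : d \in flat_rays -> lmask rays d (idx i1) -> lmask rays d (idx i2) ->
    lmask rays d (idx j) -> ~~ (u j <= u i1 + u i2)%MS ->
    forall l, (u l <= u i1 + u i2 + u j)%MS = lmask rays d (idx l).
  move=> df d1 d2' d3 i12j l; have [p pE] := flat_point df.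
  have ev0 i : lmask rays d (idx i) -> ev i p = 0 by rewrite -pE => /eqP.
  have [k k40 dk] := flat_proper df; have [i ik] := idx_onto k40; rewrite -ik in dk.
  have p0 : p != 0.
    apply: contra dk => /eqP p0; rewrite -pE p0 /g32_eval big1 // => j' _.
    by rewrite mxE mulr0.
  by rewrite -pE; apply: rank3_flat i12 i12j p0 (ev0 _ d1) (ev0 _ d2') (ev0 _ d3) l.
have [d3 d3f /and3P[d31 d32 d33]] := join (idx i3) (idx_lt i3).
have cE := span3 d3 i3 d3f d31 d32 d33 i123.
exists (flag_cone (idx i1) d2 d3), d2, d3; split.
- exact: (cns d3 d3f d31 d32).
- by move=> r rd; rewrite mem_sort mem_undup inE mem_cat rd orbT.
- by move=> r rd; rewrite mem_sort mem_undup inE mem_cat rd !orbT.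
- by rewrite mem_sort mem_undup inE eqxx.
split=> l; last first.
  by rewrite cE (disjoint_raysP l (flat_disjoint d3f)).
rewrite (disjoint_raysP _ dis2) meet ?idx_lt //; congr nat_of_bool.
apply/allP/idP => [H|ul d]; last first.
  rewrite mem_filter => /andP[/andP[d1 d2'] df]; have [p pE] := flat_point df.
  rewrite -pE -ev_ker; apply: submx_trans ul _.
  by rewrite addsmx_sub !ev_ker !pE d1 d2'.
apply: contraT => ul.
have {}H d : d \in flat_rays -> lmask rays d (idx i1) -> lmask rays d (idx i2) ->
    lmask rays d (idx l) by move=> df d1 d2'; apply: H; rewrite mem_filter df d1 d2'.
(* If [l] were outside the span of [i1] and [i2] but in every rank 3 flat through them, each such
   flat would be the span of [i1], [i2], [l], and none would contain this [k]. *)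
have [k] : exists k, ~~ (u k <= u i1 + u i2 + u l)%MS.
  have r1 i : (\rank (u i) <= 1)%N := rank_leq_row _.
  have r2 := leq_trans (mxrank_adds_leqif (u i1) (u i2)) (leq_add (r1 i1) (r1 i2)).
  have r3 := leq_trans (mxrank_adds_leqif (u i1 + u i2)%MS (u l)) (leq_add r2 (r1 l)).
  exact: forms_span r3.
have [d df /and3P[d1 d2' dk]] := join (idx k) (idx_lt k).
by rewrite (span3 d l df d1 d2' (H d df d1 d2') ul) dk.
Qed.

(* The superlevel sets of a point of a cone are flats. *)
Lemma superlevel_point (R : realType) c (v : trop_vec R line) j : c \in cones ->
  cone_over (@indic R line) (dset c) v ->
  exists p : 'rV[K]_4, ev j p != 0 /\ forall l, v j < v l -> ev l p = 0.
Proof.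
move=> cC [a [t [a0 /combP vE]]].
(* The union of the rays inside the superlevel set is a flat avoiding [j]; it remains to see that it
   is the whole superlevel set. *)
pose d := [seq r <- c | rset r \subset [set l | v j < v l]].
have dC : d \in cones by apply: cones_filter.
have sum0 l : 0 <= \sum_(F in dset c) a F * (l \in F)%:R.
  by apply: sumr_ge0 => F Fc; rewrite mulr_ge0 ?ler0n ?a0.
have dj : ~~ lmask rays d (idx j).
  rewrite lmaskE; apply/hasPn => r; rewrite mem_filter => /andP[/fintype.subsetP sub _].
  by apply: contraT; rewrite negbK => /sub; rewrite inE ltxx.
have [e ef [ej esub]] := cones_closed dC (idx_lt j) dj.
have [p pE] := flat_point ef; exists p; split; first by rewrite pE.
move=> l jl; apply/eqP; rewrite pE; apply: esub; rewrite lmaskE.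
have [r0 r0c] : exists2 r, r \in c & l \in rset r.
  apply/hasP; apply: contraLR jl => /hasPn nl; rewrite -leNgt !vE big1 ?add0r.
    by rewrite lerDr.
  move=> F /dsetP[r rc ->]; by rewrite (negPf (nl r rc)) mulr0.
move=> lr0.
(* A smallest ray through [l] is contained in every other ray of the cone through [l], so the value
   of v on it is at least v l, and it lies in the superlevel set. *)
pose P (F : {set line}) := (F \in dset c) && (l \in F).
have P0 : P (rset r0) by rewrite /P lr0 andbT; apply/dsetP; exists r0.
case: (arg_minnP (fun F : {set line} => #|F|) P0) => F /andP[/dsetP[r rc ->{F}] lr] rmin.
have small r' : r' \in c -> l \in rset r' -> rset r \subset rset r'.
  move=> r'c lr'; have [//|sub|dis] := cones_nested cC rc r'c; last first.
    by have := disjointFr dis lr; rewrite lr'.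
  suff /eqP -> : rset r' == rset r by [].
  rewrite eqEcard sub; apply: rmin; rewrite /P lr' andbT.
  by apply/dsetP; exists r'.
apply/hasP; exists r => //; rewrite mem_filter rc andbT.
apply/fintype.subsetP => l' l'r; rewrite inE; apply: lt_le_trans jl _.
rewrite !vE lerD2r; apply: ler_sum => F Fc; apply: ler_wpM2l; first exact: a0.
case/dsetP: Fc => r' r'c ->; have [lr'|_] := boolP (l \in rset r'); last exact: ler0n.
by rewrite (fintype.subsetP (small r' r'c lr')).
Qed.

End Flats.

(** * The Bergman fan *)
Lemma total_max (T : eqType) (le : rel T) (s : seq T) : total le -> transitive le ->
  s != [::] -> exists2 x, x \in s & all (le^~ x) s.
Proof.
move=> tot tr; elim: s => // y s IH _; have refl x : le x x by have := tot x x; rewrite orbb.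
case: (s =P [::]) => [->|/eqP /IH [x xs xP]]; first by exists y; rewrite ?inE //= refl.
have /orP[xy|yx] := tot x y.
  exists y; rewrite ?mem_head //= refl; apply/allP => z /(allP xP) zx.
  exact: tr zx xy.
by exists x; rewrite /= ?inE ?xs ?orbT // yx.
Qed.

Section Flags.
Variables (K : fieldType) (w : K).
Hypothesis char0 : [pchar K] =i pred0.
Hypothesis w_prim : 3.-primitive_root w.
Local Notation u := (g32_form w).
Local Notation ev := (g32_eval w).

Lemma form_sub l i : (u l <= u i)%MS = (l == i).
Proof.
apply/idP/eqP => [li|->]; last exact: submx_refl.
apply/eqP; apply: contraT => ne.
have cC : [:: idx i] \in cones by apply: incone_cones; apply: ltn_trans (idx_lt i) _.
have [|d df [dl sub]] := cones_closed cC (idx_lt l).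
  by rewrite lmaskE /= orbF rset_a inE.
have [p pE] := flat_point char0 w_prim df.
move: dl; rewrite -pE -ev_ker => /negP; case; apply: submx_trans li _.
by rewrite ev_ker pE sub // lmaskE /= rset_a inE eqxx.
Qed.

Definition span_forms (I : {set line}) : 'M[K]_4 := (\sum_(i in I) <<u i>>)%MS.

(* Both the order of the coordinates of a point of the tropical linear space and
   the order of the forms under a valuation have this property. *)
Definition flat_order (le : rel line) : Prop :=
  forall (I : {set line}) l, (u l <= span_forms I)%MS -> exists2 i, i \in I & le i l.

Lemma span_forms_gen (I : {set line}) i : i \in I -> (u i <= span_forms I)%MS.
Proof. by move=> iI; rewrite (sumsmx_sup i) // genmxE. Qed.

(** Each chosen form is maximal for [le] outside the span of the earlier ones, so forms outside that
    span lie below it. A form inside the next span lies above one of the chosen forms by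
    [flat_order], hence above the last of them. So all forms of a layer of the flag are equivalent;
    [M] and [F] are the indicators of the flats of rank 2 and 3. *)
Lemma flat_order_flag le : total le -> transitive le -> flat_order le ->
  exists c d2 d3 i1 i2 i3 i4, let M l := count (fun r => l \in rset r) d2 in
    let F l := count (fun r => l \in rset r) d3 in
  [/\ c \in cones, [/\ {subset d2 <= c}, {subset d3 <= c} & idx i1 \in c],
    [/\ le i4 i3, le i3 i2 & le i2 i1],
    forall l, [/\ (l == i1 <= M l)%N, (M l <= F l)%N & (F l <= 1)%N]
  & forall l, [/\ F l = 0%N -> le l i4 && le i4 l,
                  F l = 1%N -> M l = 0%N -> le l i3 && le i3 l
                & M l = 1%N -> l != i1 -> le l i2 && le i2 l]].
Proof.
move=> tot tr P; have refl x : le x x by have := tot x x; rewrite orbb.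
have mx (m : nat) (A : 'M[K]_(m, 4)) : (\rank A < 4)%N ->
    exists2 i, ~~ (u i <= A)%MS & forall l, ~~ (u l <= A)%MS -> le l i.
  move=> /(forms_span char0 w_prim)[l0 l0A].
  have [|i] := total_max tot tr (s := enum [pred l | ~~ (u l <= A)%MS]).
    have : l0 \in enum [pred l | ~~ (u l <= A)%MS] by rewrite mem_enum inE.
    by case: (enum _).
  rewrite mem_enum inE => iA /allP imax; exists i => // l lA.
  by apply: imax; rewrite mem_enum inE.
have [|i1 _ m1] := mx 4%N 0; first by rewrite mxrank0.
have le1 l : le l i1.
  by apply: m1; rewrite submx0 (form_neq0 char0 w_prim).
have r1 i : (\rank (u i) <= 1)%N := rank_leq_row _.
have r2 i j := leq_trans (mxrank_adds_leqif (u i) (u j)) (leq_add (r1 i) (r1 j)).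
have r3 i j k := leq_trans (mxrank_adds_leqif (u i + u j)%MS (u k)) (leq_add (r2 i j) (r1 k)).
have [i2 n2 m2] := mx _ (u i1) (leq_ltn_trans (r1 i1) (isT : 1 < 4)%N).
have [i3 n3 m3] := mx _ (u i1 + u i2)%MS (leq_ltn_trans (r2 i1 i2) (isT : 2 < 4)%N).
have [i4 n4 m4] := mx _ (u i1 + u i2 + u i3)%MS (r3 i1 i2 i3).
have l21 : le i2 i1 by [].
have s12 l : (u l <= u i1)%MS -> (u l <= u i1 + u i2)%MS.
  by move=> H; apply: submx_trans H (addsmxSl _ _).
have s23 l : (u l <= u i1 + u i2)%MS -> (u l <= u i1 + u i2 + u i3)%MS.
  by move=> H; apply: submx_trans H (addsmxSl _ _).
have l32 : le i3 i2 by apply: m2; apply: contra n3; apply: s12.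
have l43 : le i4 i3 by apply: m3; apply: contra n4; apply: s23.
have [c [d2 [d3 [cC d2c d3c i1c [ME FE]]]]] := flag_coneP char0 w_prim n2 n3.
exists c, d2, d3, i1, i2, i3, i4; split=> // l.
  rewrite ME FE; split; last by case: (_ <= _)%MS.
    by case: eqP => [->|//]; rewrite (s12 _ (submx_refl _)).
  by case: (boolP (u l <= u i1 + u i2)%MS) => // /s23 ->.
rewrite ME FE; split.
- case: (boolP (u l <= _)%MS) => // lF _; rewrite m4 //=.
  have full : (u l <= span_forms [set i1; i2; i3; i4])%MS.
    have rk : (3 < \rank (u i1 + u i2 + u i3 + u i4)%MS)%N.
      have r1' : (0 < \rank (u i1))%N by rewrite lt0n mxrank_eq0 (form_neq0 char0 w_prim).
      have r2' := leq_ltn_trans r1' (rank_adds_gt n2).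
      have r3' := leq_ltn_trans r2' (rank_adds_gt n3).
      exact: leq_ltn_trans r3' (rank_adds_gt n4).
    have fullM : row_full (u i1 + u i2 + u i3 + u i4)%MS.
      by rewrite /row_full eqn_leq rank_leq_col.
    apply: submx_trans (submx_full _ fullM) _.
    by rewrite !addsmx_sub !span_forms_gen // !inE eqxx ?orbT.
  have [i] := P _ _ full; rewrite !inE => iI il; apply: (tr i _ l _ il).
  case/orP: iI => [/orP[/orP[]|]|] /eqP ->; rewrite ?refl ?l43 //.
  exact: (tr _ _ _ l43 l32).
- case: (boolP (u l <= u i1 + u i2 + u i3)%MS) => // lF _.
  case: (boolP (u l <= u i1 + u i2)%MS) => // lM _; rewrite m3 //=.
  have sub : (u l <= span_forms [set i1; i2; i3])%MS.
    by apply: submx_trans lF _; rewrite !addsmx_sub !span_forms_gen // !inE eqxx ?orbT.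
  have [i] := P _ _ sub; rewrite !inE => iI il; apply: (tr i _ l _ il).
  by case/orP: iI => [/orP[]|] /eqP ->; rewrite ?refl ?l32.
case: (boolP (u l <= u i1 + u i2)%MS) => // lM _ l1; rewrite m2 ?form_sub //=.
have sub : (u l <= span_forms [set i1; i2])%MS.
  by apply: submx_trans lM _; rewrite !addsmx_sub !span_forms_gen // !inE eqxx ?orbT.
have [i] := P _ _ sub; rewrite !inE => iI il; apply: (tr i _ l _ il).
by case/orP: iI => /eqP ->; rewrite ?refl.
Qed.

Lemma span_forms_rank (C : {set line}) : (\rank (span_forms C) <= #|C|)%N.
Proof.
rewrite -sum1_card; apply: (big_ind2 (fun (A : 'M_4) n => \rank A <= n)%N).
- by rewrite mxrank0.
- by move=> A n B m An Bm; apply: leq_trans (mxrank_adds_leqif _ _) (leq_add An Bm).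
by move=> i _; rewrite genmxE rank_leq_row.
Qed.

Lemma span_formsS (B C : {set line}) : B \subset C -> (span_forms B <= span_forms C)%MS.
Proof.
move=> /fintype.subsetP BC; apply/sumsmx_subP => i iB.
by rewrite genmxE span_forms_gen ?BC.
Qed.

Lemma independentS (B C : {set line}) : C \subset B ->
  g32_independent w B -> g32_independent w C.
Proof.
move=> CB /eqP rB; rewrite /g32_independent eqn_leq span_forms_rank /=.
have := mxrank_adds_leqif (span_forms C) (span_forms (B :\: C)).
rewrite -/(span_forms C).
have -> : (span_forms C + span_forms (B :\: C))%MS = span_forms B.
  by rewrite [RHS](big_setID C) /= (finset.setIidPr CB).
move=> [le _]; have := leq_trans le (leq_add (leqnn _) (span_forms_rank _)).
rewrite [X in (X <= _)%N]rB -(cardsID C B) (finset.setIidPr CB) leq_add2r.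
by [].
Qed.

Lemma circuit_span C l : g32_circuit w C -> l \in C ->
  (u l <= span_forms (C :\ l))%MS.
Proof.
move=> /minsetP[depC minC] lC.
have ind : g32_independent w (C :\ l).
  apply: contraT => dep; have := minC _ dep (finset.subsetDl _ _) => E.
  by move: lC; rewrite -E !inE eqxx.
have sub := span_formsS (finset.subsetDl C [set l]).
have rk : (\rank (span_forms C) <= \rank (span_forms (C :\ l)))%N.
  have cC : #|C| = #|C :\ l|.+1 by rewrite (cardsD1 l C) lC.
  by rewrite (eqP ind) -ltnS -cC ltn_neqAle depC span_forms_rank.
have [_ E] := mxrank_leqif_sup sub.
apply: submx_trans (span_forms_gen lC) _.
by rewrite -E eqn_leq rk mxrankS.
Qed.

(** Adding [l] to a basis of the span of [I] creates a circuit through [l] inside [I] and [l]. The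
    minimum on it is attained twice, so some element of [I] is at most v l. *)
Lemma berg_flat_order (R : realType) (v : trop_vec R line) : berg R w v ->
  flat_order (fun i j => v i <= v j).
Proof.
move=> bv I l lI; apply/exists_inP; apply: contraT => /exists_inPn no.
pose Q B := g32_independent w B && (B \subset I).
have [|B /maxsetP[/andP[indB BI] maxB]] := @ex_maxset _ Q.
  by exists finset.set0; rewrite /Q finset.sub0set /g32_independent big_set0 mxrank0 cards0.
have IB i : i \in I -> (u i <= span_forms B)%MS.
  move=> iI; have [iB|iB] := boolP (i \in B); first exact: span_forms_gen.
  have sub := span_formsS (finset.subsetUr [set i] B).
  have [_ E] := mxrank_leqif_sup sub.
  apply: submx_trans (span_forms_gen (setU11 i B)) _.
  rewrite -E eqn_leq mxrankS //= (eqP indB) -ltnS.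
  have -> : #|B|.+1 = #|i |: B| by rewrite cardsU1 iB.
  rewrite ltn_neqAle span_forms_rank andbT; apply: contra iB => ind.
  rewrite -(maxB (i |: B)) ?setU11 ?finset.subsetUr //.
  have ind' : g32_independent w (i |: B) := ind.
  by rewrite /Q ind' finset.subUset finset.sub1set iI.
have lB : (u l <= span_forms B)%MS.
  by apply: submx_trans lI _; apply/sumsmx_subP => i iI; rewrite genmxE IB.
have lnB : l \notin B.
  by apply/negP => /(fintype.subsetP BI) /no; rewrite lexx.
have dep : ~~ g32_independent w (l |: B).
  rewrite /g32_independent neq_ltn cardsU1 lnB add1n ltnS -(eqP indB).
  by rewrite mxrankS ?orbT // big_setU1 //= addsmx_sub genmxE lB submx_refl.
have [C cC CB] := @minset_exists _ (fun D => ~~ g32_independent w D) _ dep.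
have CI i : i \in C -> i != l -> i \in I.
  by move=> /(fintype.subsetP CB); rewrite !inE => /orP[->//|/(fintype.subsetP BI)].
have lC : l \in C.
  apply: contraT => lnC; have /minsetP[+ _] := cC; case/negP; apply: independentS indB.
  apply/fintype.subsetP => i iC; have := fintype.subsetP CB i iC; rewrite !inE.
  by case: eqP => // E; rewrite -E iC in lnC.
have [l1 [l2 [l1C l2C ne vmin]]] := bv C cC; have [v1 v2] := vmin l lC.
have [E|n1] := eqVneq l1 l; last by rewrite (negPf (no _ (CI _ l1C n1))) in v1.
have n2 : l2 != l by rewrite -E eq_sym.
by rewrite (negPf (no _ (CI _ l2C n2))) in v2.
Qed.

(** If the minimum on a circuit were attained at one form only, [superlevel_point] would give a zero
    of all the others that is not a zero of this one, although it lies in their span. *)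
Lemma cone_berg (R : realType) (v : trop_vec R line) c : c \in cones ->
  cone_over (@indic R line) (dset c) v -> berg R w v.
Proof.
move=> cC cv C cirC.
have [l0 l0C] : exists l, l \in C.
  apply/set0Pn; apply/eqP => E; have /minsetP[+ _] := cirC.
  by rewrite E /g32_independent big_set0 mxrank0 cards0.
have [l1 l1C min1] := Order.TotalTheory.arg_minP (fun l => v l) l0C.
have [/existsP[l2 /and3P[l2C ne le21]]|no] := boolP [exists l, [&& l \in C, l != l1 & v l <= v l1]].
  exists l1, l2; split=> //; first by rewrite eq_sym.
  by move=> l lC; split; [apply: min1|apply: le_trans le21 (min1 _ lC)].
have [p [pl1 p0]] := superlevel_point char0 w_prim l1 cC cv.
case/negP: pl1; rewrite -ev_ker; apply: submx_trans (circuit_span cirC l1C) _.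
apply/sumsmx_subP => i; rewrite !inE genmxE ev_ker => /andP[ne iC].
apply/eqP; apply: p0; rewrite ltNge; apply: contra no => le.
by apply/existsP; exists i; rewrite iC ne.
Qed.

End Flags.

Section BergFan.
Variables (K : fieldType) (w : K) (R : realType).
Hypothesis char0 : [pchar K] =i pred0.
Hypothesis w_prim : 3.-primitive_root w.

Lemma count_rays (d : seq nat) (l : line) :
  (\sum_(r <- d) indic R (rset r)) l = (count (fun r => l \in rset r) d)%:R.
Proof.
rewrite sum_ffunE -sum1_count natr_sum [RHS]big_mkcond.
by apply: eq_bigr => r _; rewrite indicE; case: (l \in _).
Qed.

Lemma berg_cone_over (v : trop_vec R line) : berg R w v ->
  exists2 c, c \in cones & cone_over (@indic R line) (dset c) v.
Proof.
move=> /berg_flat_order P.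
have tot : total (fun i j => v i <= v j) by move=> i j; apply: le_total.
have tr : transitive (fun i j => v i <= v j) by move=> j i k; apply: le_trans.
have [c [d2 [d3 [i1 [i2 [i3 [i4 /=]]]]]]] := flat_order_flag char0 w_prim tot tr P.
case=> cC [d2c d3c i1c] [l43 l32 l21] nest lev; exists c => //.
have dcone d : {subset d <= c} ->
    cone_over (@indic R line) (dset c) (\sum_(r <- d) indic R (rset r)).
  elim: d => [_|r d IH sub].
    by rewrite big_nil -(scale0r (ones R line)); apply: cone_over_ones.
  rewrite big_cons; apply: cone_overD.
    by apply: cone_over_gen; apply/dsetP; exists r => //; apply: sub; rewrite mem_head.
  by apply: IH => x xd; apply: sub; rewrite inE xd orbT.
(* Summation by parts along the four levels of the flag. *)
have -> : v = (v i1 - v i2) *: indic R (rset (idx i1)) +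
   ((v i2 - v i3) *: (\sum_(r <- d2) indic R (rset r)) +
   ((v i3 - v i4) *: (\sum_(r <- d3) indic R (rset r)) + v i4 *: ones R line)).
  apply/ffunP => l; rewrite !ffunE !count_rays indicE rset_a inE.
  have [] := nest l; have [] := lev l.
  set M := count _ d2; set F := count _ d3 => F0 M0 M1 le1 le2 le3.
  have eqv i j : (v i <= v j) && (v j <= v i) -> v i = v j by move=> /le_anti.
  have [E|ne] := eqVneq l i1.
    move: le1; rewrite E eqxx => M1'; have F1 := leq_trans M1' le2.
    have -> : M = 1%N by apply/eqP; rewrite eqn_leq M1' (leq_trans le2 le3).
    have -> : F = 1%N by apply/eqP; rewrite eqn_leq F1 le3.
    rewrite /GRing.scale /=; ring.
  case: M M0 M1 le2 {le1} => [|[|M]] M0 M1 le2; last by have := leq_trans le2 le3.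
    case: F F0 M0 le3 {le2} => [|[|F]] // F0 M0 _.
      rewrite (eqv _ _ (F0 erefl)) /GRing.scale /=; ring.
    rewrite (eqv _ _ (M0 erefl erefl)) /GRing.scale /=; ring.
  have -> : F = 1%N by apply/eqP; rewrite eqn_leq le3 le2.
  rewrite (eqv _ _ (M1 erefl ne)) /GRing.scale /=; ring.
apply: cone_overD.
  apply: cone_overZ; first by rewrite subr_ge0.
  by apply: cone_over_gen; apply/dsetP; exists (idx i1).
apply: cone_overD; first by apply: cone_overZ; [rewrite subr_ge0|apply: dcone].
apply: cone_overD; last exact: cone_over_ones.
by apply: cone_overZ; [rewrite subr_ge0|apply: dcone].
Qed.

Lemma berg_support : berg R w = Defs.support (@fan_of R line berg_cones).
Proof.
apply/seteqP; split=> v.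
  move=> /berg_cone_over[c cC cv]; exists (cone_over (@indic R line) (dset c)).
  by split=> //; exists (dset c); split=> //; apply/berg_conesP; exists c.
move=> [C [[s [/berg_conesP[c cC ->] ->]] cv]].
exact: (cone_berg char0 w_prim cC cv).
Qed.

Lemma berg_coarsest : coarsest_fan_structure (berg R w) (berg_fan R).
Proof.
exact: (separated_coarsest berg_separated berg_down berg_facets berg_support).
Qed.

End BergFan.

(** * Tropical points from curves *)
Lemma poly_nonroot (K : fieldType) (p : {poly K}) : [pchar K] =i pred0 -> p != 0 ->
  exists x, p.[x] != 0.
Proof.
move=> char0 p0; apply: contrapT => no.
have all0 x : p.[x] = 0 by apply: contrapT => /eqP px; apply: no; exists x.
have inj : injective (fun n : nat => n%:R : K).
  move=> m n /= E; wlog lt : m n E / (m <= n)%N => [H|].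
    by case: (leqP m n) => [/H|/ltnW /H H']; [apply|apply/esym/H'].
  have : (n - m)%:R == 0 :> K by rewrite natrB // E subrr.
  have -> : ((n - m)%:R == 0 :> K) = (n - m == 0)%N by exact: (pcharf0P K).1.
  by rewrite subn_eq0 => nm; apply/eqP; rewrite eqn_leq lt.
have roots : all (root p) [seq n%:R | n <- iota 0 (size p)].
  by apply/allP => _ /mapP[n _ ->]; rewrite rootE all0.
have un : uniq [seq n%:R : K | n <- iota 0 (size p)] by rewrite map_inj_uniq ?iota_uniq.
by have := max_poly_roots p0 roots un; rewrite size_map size_iota ltnn.
Qed.

(** Rounding down [N] times the coefficients changes each of the finitely many sums by at most the
    sum of the absolute values of [h], which a large [N] outweighs. *)
Lemma positive_approximation (R : realType) (T : finType) (I : eqType) (S : {set T})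
    (a : T -> R) (s : seq I) (h : I -> T -> R) :
  (forall F, F \in S -> 0 <= a F) ->
  (forall i, i \in s -> 0 < \sum_(F in S) a F * h i F) ->
  exists n : T -> nat, forall i, i \in s -> 0 < \sum_(F in S) (n F)%:R * h i F.
Proof.
move=> a0 pos.
pose nN (N : nat) F := Num.truncn (N%:R * a F).
suff [N0 H] : exists N0, forall N i, (N0 <= N)%N -> i \in s ->
    0 < \sum_(F in S) (nN N F)%:R * h i F.
  by exists (nN N0) => i; apply: H.
elim: s pos => [|i s IH] pos; first by exists 0%N.
have [|N1 H1] := IH; first by move=> j js; apply: pos; rewrite inE js orbT.
have di := pos i (mem_head _ _); set d := \sum_(F in S) _ in di.
pose b := \sum_(F in S) `|h i F|.
have b0 : 0 <= b by apply: sumr_ge0.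
pose N2 := (Num.truncn (b / d)).+1.
exists (maxn N1 N2) => N j; rewrite geq_max => /andP[N1N N2N].
rewrite inE => /predU1P[->|]; last exact: H1.
have bN : b < N%:R * d.
  rewrite -ltr_pdivrMr //; apply: lt_le_trans (truncnS_gt _) _.
  by rewrite ler_nat.
have : N%:R * d - b <= \sum_(F in S) (nN N F)%:R * h i F.
  rewrite /d /b mulr_sumr -sumrB; apply: ler_sum => F FS.
  have NaF : 0 <= N%:R * a F by rewrite mulr_ge0 ?a0.
  have /andP[lo hi] := truncn_itv NaF; rewrite -/(nN N F) in lo hi.
  rewrite mulrA lerBlDr -lerBlDl -mulrBl.
  apply: le_trans (ler_norm _) _; rewrite normrM ler_piMl //.
  rewrite ger0_norm ?subr_ge0 // lerBlDl; apply: le_trans (ltW hi) _.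
  by rewrite -natr1.
by apply: lt_le_trans; rewrite subr_gt0.
Qed.

Section Weight.
Variable R : realType.
Implicit Types (v : trop_vec R isoplane) (m : 'X_{1..#|{: isoplane}|}).

Lemma weightD v v' m : weight (v + v') m = weight v m + weight v' m.
Proof. by rewrite /weight -big_split; apply: eq_bigr => i _; rewrite ffunE mulrDr. Qed.

Lemma weightZ k v m : weight (k *: v) m = k * weight v m.
Proof.
by rewrite /weight mulr_sumr; apply: eq_bigr => i _; rewrite ffunE mulrCA.
Qed.

Lemma weight0 m : weight (0 : trop_vec R isoplane) m = 0.
Proof. by rewrite /weight big1 // => i _; rewrite ffunE mulr0. Qed.

Lemma weight_ones m : weight (ones R isoplane) m = (mdeg m)%:R.
Proof.
by rewrite /weight mdegE natr_sum; apply: eq_bigr => i _; rewrite onesE mulr1.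
Qed.

Lemma weight_mapA_comb (S : {set {set line}}) (a : {set line} -> R) t m :
  weight (mapA (comb S a t)) m =
  \sum_(F in S) a F * weight (mapA (indic R F)) m + t * (4 * (mdeg m)%:R).
Proof.
rewrite /comb mapAD weightD mapAZ mapA_ones 2!weightZ weight_ones; congr (_ + _).
apply: (big_ind2 (fun (x : trop_vec R line) y => weight (mapA x) m = y)).
- by rewrite mapA0 weight0.
- by move=> x y x' y' <- <-; rewrite mapAD weightD.
by move=> F _; rewrite mapAZ weightZ.
Qed.

End Weight.

Section MonomialCurve.
Variables (K : fieldType) (w : K).
Hypothesis char0 : [pchar K] =i pred0.
Hypothesis w_prim : 3.-primitive_root w.
Local Notation ev := (g32_eval w).
Local Notation monom := 'X_{1..#|{: isoplane}|}.

Lemma ev_sum (I : Type) (s : seq I) (P : pred I) (a : I -> K) (p : I -> 'rV[K]_4) l :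
  ev l (\sum_(i <- s | P i) a i *: p i) = \sum_(i <- s | P i) a i * ev l (p i).
Proof.
rewrite /g32_eval [RHS](eq_bigr (fun i => \sum_(k < 4) g32_form w l 0 k * (a i * p i 0 k))).
  rewrite exchange_big; apply: eq_bigr => k _; rewrite summxE mulr_sumr.
  by apply: eq_bigr => i _; rewrite mxE.
by move=> i _; rewrite mulr_sumr; apply: eq_bigr => k _; rewrite mulrCA.
Qed.

Lemma burkhardt_torus c : (forall l, ev l c != 0) ->
  burkhardt w (burkhardt_map w c) /\ forall W, burkhardt_map w c W != 0.
Proof.
move=> evc; have ne W : burkhardt_map w c W != 0.
  by rewrite ffunE; apply/prodf_neq0 => l _.
have nz : burkhardt_map w c != 0.
  have [W _] := idxW_onto (isT : 0 < 40)%N.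
  by apply/eqP => E; have := ne W; rewrite E ffunE eqxx.
by split=> //; split=> // d f _ H; apply: H.
Qed.

Definition curve_weight (N : line -> nat) (m : monom) : nat :=
  \sum_i m i * (\sum_(l : line | val l \subset val (enum_val i)) N l).

(* On the curve [c (t) = \sum_j y_j t ^ N j *: p_j], with [p_j] in the flat
   [N > N j], each form [u_l] is [t ^ N l] times a unit at [t = 0]. *)
Lemma integral_curve (N : line -> nat) (f : coord_poly K) (m1 : monom) :
  (forall j, exists p, ev j p != 0 /\ forall l, (N j < N l)%N -> ev l p = 0) ->
  m1 \in msupp f ->
  (forall m, m \in msupp f -> m != m1 -> (curve_weight N m1 < curve_weight N m)%N) ->
  exists y, [/\ burkhardt w y, (forall W, y W != 0) & poly_at f y != 0].
Proof.
move=> pts m1f min1.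
pose p j := projT1 (cid (pts j)).
have pj j : ev j (p j) != 0 by rewrite /p; case: cid => q /= [].
have p0 j l : (N j < N l)%N -> ev l (p j) = 0.
  by rewrite /p; case: cid => q /= [_]; apply.
(* With y_j = x^(idx j), the leading coefficient of the form of [l] along the curve is this
   polynomial in x. The powers being distinct, its coefficient at idx l is the value of the form of
   [l] at p_l, so it is nonzero and a single x serves all l. *)
pose H l : {poly K} := \sum_(j | N j == N l) ev l (p j) *: 'X^(idx j).
have H0 l : H l != 0.
  apply/eqP => /polyP /(_ (idx l)); rewrite coef0 coef_sum (bigD1 l) //= coefZ coefXn eqxx.
  rewrite mulr1 big1 => [/eqP|j /andP[_ jl]]; first by rewrite addr0 (negPf (pj l)).
  by rewrite coefZ coefXn (inj_eq idx_inj) eq_sym (negPf jl) mulr0.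
have [x] : exists x, (\prod_l H l).[x] != 0.
  by apply: poly_nonroot => //; apply/prodf_neq0 => l _.
rewrite horner_prod => /prodf_neq0 Hx.
pose G l : {poly K} := \sum_(j | (N l <= N j)%N) (x ^+ idx j * ev l (p j)) *: 'X^(N j - N l).
pose c t : 'rV[K]_4 := \sum_j (x ^+ idx j * t ^+ N j) *: p j.
have evc l t : ev l (c t) = t ^+ N l * (G l).[t].
  rewrite ev_sum (bigID (fun j => (N l <= N j)%N)) /= [X in _ + X]big1 ?addr0; last first.
    by move=> j; rewrite -ltnNge => /p0 ->; rewrite mulr0.
  rewrite horner_sum mulr_sumr; apply: eq_bigr => j lj.
  rewrite hornerZ hornerXn (_ : t ^+ N j = t ^+ N l * t ^+ (N j - N l)); last first.
    by rewrite -exprD subnKC.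
  by rewrite -!mulrA [RHS]mulrCA; congr (_ * _); congr (_ * _); rewrite mulrC.
have G0 l : (G l).[0] != 0.
  have := Hx l isT; congr (_ != _); rewrite !horner_sum.
  rewrite [RHS](bigID (fun j => N j == N l)) /= [X in _ = _ + X]big1 ?addr0.
    apply: eq_big => [j|j /eqP E]; first by case: eqP => [->|]; rewrite ?leqnn ?andbF.
    by rewrite !hornerZ !hornerXn E subnn expr0 mulr1 mulrC.
  move=> j /andP[lj jl]; rewrite hornerZ hornerXn expr0n subn_eq0.
  have -> : (N j <= N l)%N = false by apply/negbTE; rewrite -ltnNge ltn_neqAle eq_sym jl.
  by rewrite mulr0.
pose gW (W : isoplane) : {poly K} := \prod_(l : line | val l \subset val W) G l.
pose wt := curve_weight N.
(* The value of [f] along the curve is t^(wt m1) Q(t), and only the term of [m1] survives in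
   Q(0). *)
pose Q : {poly K} := \sum_(m <- msupp f) f@_m *:
  ('X^(wt m - wt m1) * \prod_i gW (enum_val i) ^+ m i).
have mapE t W : burkhardt_map w (c t) W =
    t ^+ (\sum_(l : line | val l \subset val W) N l) * (gW W).[t].
  rewrite ffunE horner_prod expr_sum -big_split; apply: eq_bigr => l _; exact: evc.
have wtm m : m \in msupp f -> (wt m1 <= wt m)%N.
  by move=> mf; have [->//|/(min1 m mf)/ltnW] := eqVneq m m1.
have QE t : poly_at f (burkhardt_map w (c t)) = t ^+ wt m1 * Q.[t].
  rewrite /poly_at mevalE horner_sum mulr_sumr.
  rewrite big_seq [RHS]big_seq; apply: eq_bigr => m mf.
  rewrite hornerZ hornerM hornerXn horner_prod [RHS]mulrCA [X in _ = _ * X]mulrA -exprD.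
  rewrite subnKC ?wtm // /wt /curve_weight expr_sum -big_split; congr (_ * _).
  apply: eq_bigr => i _; rewrite mapE exprMn -exprM [in RHS]mulnC horner_exp.
  by [].
have Q0 : Q.[0] != 0.
  rewrite horner_sum (bigD1_seq m1) ?msupp_uniq //= [X in _ + X]big_seq_cond [X in _ + X]big1 => [|m /andP[mf ne]].
    rewrite addr0 hornerZ hornerM subnn expr0 hornerC mul1r mulf_neq0 -?mcoeff_msupp //.
    rewrite horner_prod; apply/prodf_neq0 => i _; rewrite horner_exp expf_neq0 //.
    by rewrite horner_prod; apply/prodf_neq0 => l _.
  have lt := min1 m mf ne; rewrite hornerZ hornerM hornerXn expr0n subn_eq0 leqNgt.
  by rewrite lt mul0r mulr0.
have poly_neq0 (P : {poly K}) : P.[0] != 0 -> P != 0.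
  by apply: contra => /eqP ->; rewrite horner0.
have [t] : exists t, ('X * Q * \prod_l G l).[t] != 0.
  apply: poly_nonroot => //; apply: mulf_neq0.
    by apply: mulf_neq0; [rewrite polyX_eq0|apply: poly_neq0].
  by apply/prodf_neq0 => l _; apply: poly_neq0.
rewrite !hornerM hornerX horner_prod !mulf_eq0 !negb_or => /andP[/andP[t0 Qt] /prodf_neq0 Gt].
have [|by1 by2] := @burkhardt_torus (c t).
  by move=> l; rewrite evc mulf_neq0 ?expf_neq0 // Gt.
by exists (burkhardt_map w (c t)); split=> //; rewrite QE mulf_neq0 // expf_neq0.
Qed.

(** If [m1] were the only term of minimal weight, it would remain so for an integral point of the
    same Bergman cone, and the curve of that point would carry a torus point of the quartic where
    [f] does not vanish. *)
Lemma cone_trop (R : realType) c (v : trop_vec R isoplane) : c \in cones ->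
  cone_over (@indic R isoplane) (tset c) v -> trop_burkhardt R w v.
Proof.
move=> cC; rewrite -image_cone_dset // => -[_ [a [t [a0 ->]]] <-] d f fh f0 van.
rewrite -/(comb _ _ _); set v' := mapA _.
have [m0 m0f] : exists m, m \in msupp f.
  case E : (msupp f) => [|m s]; last by exists m; rewrite mem_head.
  by move: f0; rewrite -msupp_eq0 E.
have [m1 m1f min1] : exists2 m1, m1 \in msupp f &
    forall m, m \in msupp f -> weight v' m1 <= weight v' m.
  have tot : total (fun m m' => weight v' m <= weight v' m') by move=> i j; apply: le_total.
  have tr : transitive (fun m m' => weight v' m' <= weight v' m).
    by move=> j i k ij jk; apply: le_trans jk ij.
  have [|m1 m1f /allP H] := total_max (T := monom) (s := msupp f) (fun i j => tot j i) tr.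
    by apply/eqP => E; rewrite E in m0f.
  by exists m1.
have [/hasP[m2 m2f /andP[ne le21]]|/hasPn no] :=
    boolP (has (fun m => (m != m1) && (weight v' m <= weight v' m1)) (msupp f)).
  exists m1, m2; split=> //; first by rewrite eq_sym.
  by move=> m mf; split; [apply: min1|apply: le_trans le21 (min1 _ mf)].
(* All monomials of [f] have the same degree, so multiples of the all-one vector cancel in
   differences of weights. *)
pose h m F := weight (mapA (indic R F)) m - weight (mapA (indic R F)) m1.
have hE (b : {set line} -> R) t' m : m \in msupp f ->
    weight (mapA (comb (dset c) b t')) m - weight (mapA (comb (dset c) b t')) m1 =
    \sum_(F in dset c) b F * h m F.
  move=> mf; have deg m' : m' \in msupp f -> mdeg m' = d.
    by move/dhomogP: fh; apply.
  rewrite !weight_mapA_comb !deg // opprD addrACA subrr addr0 -sumrB.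
  by apply: eq_bigr => F _; rewrite mulrBr.
have [|n nP] := positive_approximation (s := [seq m <- msupp f | m != m1]) (h := h) a0.
  move=> m; rewrite mem_filter => /andP[ne mf]; rewrite -(hE a t) // subr_gt0 ltNge.
  by have := no m mf; rewrite ne.
pose N l := (\sum_(F in dset c) n F * (l \in F))%N.
pose vN := comb (dset c) (fun F => (n F)%:R) 0 : trop_vec R line.
have NE l : vN l = (N l)%:R.
  by rewrite combE addr0 natr_sum; apply: eq_bigr => F _; rewrite natrM.
have wN m : weight (mapA vN) m = (curve_weight N m)%:R.
  rewrite /weight natr_sum; apply: eq_bigr => i _; rewrite natrM mapAE natr_sum.
  by congr (_ * _); apply: eq_bigr => l _; rewrite NE.
have [j||m mf ne|y [yB yT]] := @integral_curve N f m1.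
- have cvN : cone_over (@indic R line) (dset c) vN.
    by exists (fun F => (n F)%:R), 0; split=> // F _; apply: ler0n.
  have [p [pj p0]] := superlevel_point char0 w_prim j cC cvN.
  by exists p; split=> // l lt; apply: p0; rewrite !NE ltr_nat.
- exact: m1f.
- rewrite -(ltr_nat R) -!wN -subr_gt0 hE //; apply: nP.
  by rewrite mem_filter ne.
by rewrite van ?eqxx.
Qed.

End MonomialCurve.

(** * Extension of valuations *)
Section LocalPairs.
Variable L : fieldType.
Implicit Types (R J : L -> Prop) (x : L).

Record local_pair R J : Prop := LocalPair {
  ring1 : R 1;
  ringB : forall x y, R x -> R y -> R (x - y);
  ringM : forall x y, R x -> R y -> R (x * y);
  ideal_sub : forall x, J x -> R x;
  ideal0 : J 0;
  idealD : forall x y, J x -> J y -> J (x + y);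
  idealM : forall x y, R x -> J y -> J (x * y);
  ideal_proper : ~ J 1 }.

Lemma ring_closed R J : local_pair R J ->
  [/\ R 0, forall x, R x -> R (- x), forall x y, R x -> R y -> R (x + y),
      forall x n, R x -> R (x ^+ n) & forall x, J x -> J (- x)].
Proof.
move=> lp; have r0 : R 0 by rewrite -(subrr 1); apply: (ringB lp); apply: (ring1 lp).
have rN x : R x -> R (- x) by rewrite -(sub0r x); apply: (ringB lp).
split=> //.
- by move=> x y xR /rN yR; rewrite -(opprK y); apply: (ringB lp).
- move=> x n xR; elim: n => [|n IH]; first by rewrite expr0; apply: (ring1 lp).
  by rewrite exprS; apply: (ringM lp).
move=> x Jx; rewrite -mulN1r; apply: (idealM lp) => //.
by apply: rN; apply: (ring1 lp).
Qed.

Lemma maximal_pair R0 J0 : local_pair R0 J0 -> exists R J,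
  [/\ local_pair R J, forall x, R0 x -> R x, forall x, J0 x -> J x
    & forall R' J', local_pair R' J' -> (forall x, R x -> R' x) -> (forall x, J x -> J' x) ->
        (forall x, R' x -> R x) /\ (forall x, J' x -> J x)].
Proof.
(* Ring and ideal are coded in one subset of [L * bool], to which Zorn's lemma for unions of chains
   applies; adjoining [R0] and [J0] to every subset also handles the empty chain. *)
move=> lp0; pose RS (S : set (L * bool)) x := S (x, true) \/ R0 x.
pose JS (S : set (L * bool)) x := S (x, false) \/ J0 x.
have [|A [PA maxA]] := @Zorn_bigcup (L * bool)%type (fun S => local_pair (RS S) (JS S)).
  move=> F PF tot.
  have [[S0 FS0]|no] := pselect (exists S, F S); last first.
    have RE : RS (\bigcup_(X in F) X)%classic = R0.
      apply/funext => x; apply/propext; split; last by right.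
      by case=> // -[S FS]; case: no; exists S.
    have JE : JS (\bigcup_(X in F) X)%classic = J0.
      apply/funext => x; apply/propext; split; last by right.
      by case=> // -[S FS]; case: no; exists S.
    by rewrite RE JE.
  set U := (\bigcup_(X in F) X)%classic.
  have RU x : RS U x -> exists2 S, F S & RS S x.
    by case=> [[S FS Sx]|xR0]; [exists S => //; left|exists S0 => //; right].
  have JU x : JS U x -> exists2 S, F S & JS S x.
    by case=> [[S FS Sx]|xR0]; [exists S => //; left|exists S0 => //; right].
  have UR S x : F S -> RS S x -> RS U x by move=> FS [Sx|]; [left; exists S|right].
  have UJ S x : F S -> JS S x -> JS U x by move=> FS [Sx|]; [left; exists S|right].
  have mono S T : (S `<=` T)%classic -> (forall x, RS S x -> RS T x) /\ (forall x, JS S x -> JS T x).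
    by move=> ST; split=> x [Sx|]; [left; apply: ST|right|left; apply: ST|right].
  have two S T : F S -> F T -> exists V, [/\ F V, (S `<=` V)%classic & (T `<=` V)%classic].
    by move=> FS FT; case: (tot _ _ FS FT) => ST; [exists T|exists S]; split.
  have lpS S : F S -> local_pair (RS S) (JS S) by move=> FS; apply: PF.
  split.
  - exact: UR FS0 (ring1 (lpS _ FS0)).
  - move=> x y /RU[S FS Sx] /RU[T FT Ty]; have [V [FV SV TV]] := two S T FS FT.
    apply: (UR _ _ FV); apply: (ringB (lpS _ FV)); first exact: (mono _ _ SV).1.
    exact: (mono _ _ TV).1.
  - move=> x y /RU[S FS Sx] /RU[T FT Ty]; have [V [FV SV TV]] := two S T FS FT.
    apply: (UR _ _ FV); apply: (ringM (lpS _ FV)); first exact: (mono _ _ SV).1.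
    exact: (mono _ _ TV).1.
  - by move=> x /JU[S FS Sx]; apply: (UR _ _ FS); apply: (ideal_sub (lpS _ FS)).
  - exact: UJ FS0 (ideal0 (lpS _ FS0)).
  - move=> x y /JU[S FS Sx] /JU[T FT Ty]; have [V [FV SV TV]] := two S T FS FT.
    apply: (UJ _ _ FV); apply: (idealD (lpS _ FV)); first exact: (mono _ _ SV).2.
    exact: (mono _ _ TV).2.
  - move=> x y /RU[S FS Sx] /JU[T FT Ty]; have [V [FV SV TV]] := two S T FS FT.
    apply: (UJ _ _ FV); apply: (idealM (lpS _ FV)); first exact: (mono _ _ SV).1.
    exact: (mono _ _ TV).2.
  by move=> /JU[S FS]; apply: (ideal_proper (lpS _ FS)).
exists (RS A), (JS A); split=> //; try by move=> x; right.
move=> R' J' lp' RR' JJ'.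
pose S' : set (L * bool) := fun z => if z.2 then R' z.1 else J' z.1.
have RE : RS S' = R'.
  by apply/funext => x; apply/propext; split; [case=> // xR; apply: RR'; right|left].
have JE : JS S' = J'.
  by apply/funext => x; apply/propext; split; [case=> // xR; apply: JJ'; right|left].
have PS' : local_pair (RS S') (JS S') by rewrite RE JE.
have AS' : (A `<=` S')%classic.
  by move=> [x []] Ax; [apply: RR'; left|apply: JJ'; left].
have S'A : (S' `<=` A)%classic.
  apply: contrapT => nS; apply: (maxA S') => //.
by split=> x xR; left; apply: S'A.
Qed.

Section MaximalPair.
Variables R J : L -> Prop.
Hypothesis lp : local_pair R J.
Hypothesis maxRJ : forall R' J', local_pair R' J' ->
  (forall x, R x -> R' x) -> (forall x, J x -> J' x) ->
  (forall x, R' x -> R x) /\ (forall x, J' x -> J x).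

Definition coefs_in (P : L -> Prop) (p : {poly L}) : Prop := forall i, P p`_i.

Lemma coefs_sum (P : L -> Prop) n (a : 'I_n -> L) : P 0 ->
  (forall x y, P x -> P y -> P (x + y)) -> (forall i, P (a i)) -> P (\sum_i a i).
Proof. by move=> P0 PD Pa; apply: big_ind. Qed.

(* If [J R[x]] is proper then [(R[x], J R[x])] is a local pair. *)
Lemma adjoin_or_unit x : R x \/ exists2 p, coefs_in J p & p.[x] = 1.
Proof.
have [rr0 rN rD rX JN] := ring_closed lp.
have [|no] := pselect (exists2 p, coefs_in J p & p.[x] = 1); first by right.
left; pose R' y := exists2 p, coefs_in R p & y = p.[x].
pose J' y := exists2 p, coefs_in J p & y = p.[x].
have RC y : R y -> coefs_in R y%:P by move=> Ry i; rewrite coefC; case: eqP.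
have JC y : J y -> coefs_in J y%:P.
  by move=> Jy i; rewrite coefC; case: eqP => // _; apply: (ideal0 lp).
have lp' : local_pair R' J'.
  split.
  - by exists 1%:P; rewrite ?hornerC //; apply/RC/(ring1 lp).
  - move=> y z [p pR ->] [q qR ->]; exists (p - q); rewrite ?hornerE //.
    by move=> i; rewrite coefB; apply: (ringB lp).
  - move=> y z [p pR ->] [q qR ->]; exists (p * q); rewrite ?hornerM //.
    by move=> i; rewrite coefM; apply: coefs_sum => // j; apply: (ringM lp).
  - by move=> y [p pJ ->]; exists p => // i; apply: (ideal_sub lp).
  - by exists 0; rewrite ?horner0 // => i; rewrite coef0; apply: (ideal0 lp).
  - move=> y z [p pJ ->] [q qJ ->]; exists (p + q); rewrite ?hornerD //.
    by move=> i; rewrite coefD; apply: (idealD lp).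
  - move=> y z [p pR ->] [q qJ ->]; exists (p * q); rewrite ?hornerM //.
    move=> i; rewrite coefM; apply: coefs_sum; first exact: (ideal0 lp).
      exact: (idealD lp).
    by move=> j; apply: (idealM lp).
  by move=> [p pJ /esym p1]; apply: no; exists p.
have RR' y : R y -> R' y by move=> Ry; exists y%:P; rewrite ?hornerC //; apply: RC.
have JJ' y : J y -> J' y by move=> Jy; exists y%:P; rewrite ?hornerC //; apply: JC.
have [H _] := maxRJ lp' RR' JJ'; apply: H.
exists 'X; rewrite ?hornerX // => i; rewrite coefX.
by case: (i == 1%N); [apply: (ring1 lp)|].
Qed.

(** Otherwise the inverse of 1 - j is a root of an equation p = 1 with coefficients in [J].
    Multiplying it by a power of 1 - j puts that power into [J], although it is congruent to 1
    modulo [J]. *)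
Lemma maximal_local j : J j -> R (1 - j)^-1.
Proof.
have [rr0 rN rD rX JN] := ring_closed lp.
move=> Jj; have Rj : R (1 - j) by apply: (ringB lp); [apply: (ring1 lp)|apply: (ideal_sub lp)].
have nz : 1 - j != 0.
  by apply/eqP => /subr0_eq E; apply: (ideal_proper lp); rewrite E.
have [//|[p pJ p1]] := adjoin_or_unit (1 - j)^-1.
have powJ n : J (1 - (1 - j) ^+ n).
  elim: n => [|n IH]; first by rewrite expr0 subrr; apply: (ideal0 lp).
  have -> : 1 - (1 - j) ^+ n.+1 = (1 - j) * (1 - (1 - j) ^+ n) + j.
    by rewrite exprS; ring.
  by apply: (idealD lp) => //; apply: (idealM lp).
have [] := ideal_proper lp.
rewrite -(subrK ((1 - j) ^+ size p) 1); apply: (idealD lp) => //.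
have -> : (1 - j) ^+ size p = (1 - j) ^+ size p * p.[(1 - j)^-1] by rewrite p1 mulr1.
rewrite horner_coef mulr_sumr; apply: coefs_sum.
- exact: (ideal0 lp).
- exact: (idealD lp).
move=> i; have -> : (1 - j) ^+ size p * (p`_i * (1 - j)^-1 ^+ i) =
    (1 - j) ^+ (size p - i) * p`_i.
  by rewrite (expfB _ (ltn_ord i)) exprVn mulrCA mulrC.
exact: (idealM lp (rX _ _ Rj) (pJ i)).
Qed.

(** Chevalley's argument: if neither x nor its inverse lay in [R], each would satisfy an equation
    with value 1 and coefficients in [J]. The longer equation can then always be shortened by means
    of the other. *)
Lemma maximal_valuation x : x != 0 -> R x \/ R x^-1.
Proof.
have [rr0 rN rD rX JN] := ring_closed lp.
move=> x0; have [|[p pJ p1]] := adjoin_or_unit x; first by left.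
have [|[q qJ q1]] := adjoin_or_unit x^-1; first by right.
exfalso; have [n le_n] := ubnP (size p + size q).
elim: n x x0 p q pJ qJ p1 q1 le_n => // n IH x x0 p q pJ qJ p1 q1 le_n.
wlog le_qp : x x0 p q pJ qJ p1 q1 le_n / (size q <= size p)%N => [H|].
  case: (leqP (size q) (size p)) => [|/ltnW] le; first exact: (H x x0 p q).
  apply: (H x^-1 _ q p) => //; first by rewrite invr_eq0.
    by rewrite invrK.
  by rewrite addnC.
set m := (size p).-1; have sp : size p = m.+1.
  rewrite /m prednK // lt0n size_poly_eq0; apply/eqP => p0.
  by move: p1; rewrite p0 horner0 => /esym/eqP; rewrite oner_eq0.
pose u := (1 - q`_0)^-1; have uR : R u by apply: maximal_local.
have nz : 1 - q`_0 != 0.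
  by apply/eqP => /subr0_eq E; apply: (ideal_proper lp); rewrite E.
(* Since 1 - q_0 is a unit of [R], the equation for the inverse becomes 1 = sum of c_k x^(-k) over k
   > 0, without constant term. *)
pose c k := if k == 0%N then 0 else u * q`_k.
have cJ k : J (c k).
  by rewrite /c; case: eqP => _; [apply: (ideal0 lp)|apply: (idealM lp)].
have c1 : \sum_(k < size q) c k * x^-1 ^+ k = 1.
  have E : \sum_(k < size q) q`_k * x^-1 ^+ k = 1 by rewrite -horner_coef.
  have q0 : (0 < size q)%N.
    rewrite lt0n size_poly_eq0; apply/eqP => q0.
    by move: q1; rewrite q0 horner0 => /esym/eqP; rewrite oner_eq0.
  case: (size q) q0 E => // s _; rewrite !big_ord_recl /c /= mul0r add0r expr0 mulr1 => E.
  transitivity (u * \sum_(i < s) q`_(lift ord0 i) * x^-1 ^+ lift ord0 i).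
    by rewrite mulr_sumr; apply: eq_bigr => i _; rewrite mulrA.
  have -> : \sum_(i < s) q`_(lift ord0 i) * x^-1 ^+ lift ord0 i = 1 - q`_0.
    by rewrite -E addrC addKr.
  exact: mulVf.
pose a := p`_m.
(* The leading term a x^m is multiplied by the sum of the c_k x^(-k), which is 1; this lowers its
   degree without producing negative exponents, as the degree of q is at most m. *)
pose p' := p - a *: 'X^m + \sum_(k < size q) (a * c k) *: 'X^(m - k).
have Rq k : R (c k) by apply: (ideal_sub lp).
apply: (IH x x0 p' q) => //.
- move=> i; rewrite coefD coefB coef_sum; apply: (idealD lp); first apply: (idealD lp) => //.
    rewrite coefZ coefXn mulr_natr; apply: JN.
    by case: eqP => _; [exact: pJ|exact: (ideal0 lp)].
  apply: coefs_sum; [exact: (ideal0 lp)|exact: (idealD lp)|move=> k].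
  rewrite coefZ coefXn mulr_natr; case: eqP => _; last exact: (ideal0 lp).
  exact: (idealM lp (ideal_sub lp (pJ m)) (cJ k)).
- rewrite 2!hornerD hornerN hornerZ hornerXn p1 horner_sum.
  have -> : \sum_(k < size q) ((a * c k) *: 'X^(m - k)).[x] = a * x ^+ m.
    rewrite -[RHS]mulr1 -c1 mulr_sumr; apply: eq_bigr => k _.
    have km : (k <= m)%N by rewrite -ltnS -sp (leq_trans (ltn_ord k)).
    rewrite hornerZ hornerXn exprVn (_ : x ^+ (m - k) = x ^+ m / x ^+ k).
      by rewrite -!mulrA; congr (_ * _); rewrite mulrCA.
    by apply: (mulIf (expf_neq0 k x0)); rewrite -exprD subnK // divfK // expf_neq0.
  by rewrite subrK.
apply: (@leq_trans (size p + size q)); last by rewrite -ltnS.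
rewrite ltn_add2r sp ltnS; apply/leq_sizeP => i mi.
rewrite coefD coefB coefZ coefXn coef_sum big1 ?addr0 => [|k _].
  have [->|ne] := eqVneq i m; first by rewrite mulr1 subrr.
  by rewrite mulr0 subr0 nth_default // sp ltn_neqAle eq_sym ne.
rewrite coefZ coefXn /c; case: (val k =P 0%N) => [->|k0]; first by rewrite mulr0 mul0r.
have -> : (i == m - k)%N = false; last by rewrite mulr0.
apply/negbTE/eqP => E.
have km : (k <= m)%N by rewrite -ltnS -sp (leq_trans (ltn_ord k)).
have k1 : (0 < k)%N by rewrite lt0n; apply/eqP.
by move: mi; rewrite E leqNgt ltn_subrL k1 (leq_trans k1 km).
Qed.

(** If the inverse of x is not in [R], the ideal J + x R is still proper, so maximality puts x into
    [J]. *)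
Lemma maximal_nonunit x : R x -> ~ R x^-1 -> J x.
Proof.
have [rr0 rN rD rX JN] := ring_closed lp.
move=> Rx nV; pose J' y := exists j r, [/\ J j, R r & y = j + x * r].
have J'1 : ~ J' 1.
  move=> [j [r [Jj Rr E]]]; apply: nV.
  have xr : x * r = 1 - j by rewrite E addrC addKr.
  have nz : 1 - j != 0.
    by apply/eqP => /subr0_eq E'; apply: (ideal_proper lp); rewrite E'.
  have -> : x^-1 = r * (1 - j)^-1.
    have r0 : r != 0 by apply: contra nz => /eqP r0; rewrite -xr r0 mulr0.
    by rewrite -xr invfM mulrCA divff // mulr1.
  by apply: (ringM lp) => //; apply: maximal_local.
have lp' : local_pair R J'.
  split=> //; try by [apply: (ring1 lp)|apply: (ringB lp)|apply: (ringM lp)].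
  - move=> _ [j [r [Jj Rr ->]]]; apply: rD; first exact: (ideal_sub lp).
    exact: (ringM lp).
  - by exists 0, 0; rewrite mulr0 addr0; split=> //; apply: (ideal0 lp).
  - move=> _ _ [j [r [Jj Rr ->]]] [j' [r' [Jj' Rr' ->]]]; exists (j + j'), (r + r').
    by split; [apply: (idealD lp)|apply: rD|rewrite mulrDr addrACA].
  move=> y _ Ry [j [r [Jj Rr ->]]]; exists (y * j), (y * r).
  by split; [apply: (idealM lp)|apply: (ringM lp)|rewrite mulrDr mulrCA].
have JJ' j : J j -> J' j by move=> Jj; exists j, 0; rewrite mulr0 addr0.
have [_ H] := maxRJ lp' (fun _ => id) JJ'; apply: H.
by exists 0, 1; rewrite mulr1 add0r; split=> //; [apply: (ideal0 lp)|apply: (ring1 lp)].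
Qed.

End MaximalPair.

Lemma valuation_extension R0 J0 : local_pair R0 J0 -> exists R J,
  [/\ local_pair R J, forall x, R0 x -> R x, forall x, J0 x -> J x,
      forall x, x != 0 -> R x \/ R x^-1 & forall x, R x -> ~ R x^-1 -> J x].
Proof.
move=> /maximal_pair[R [J [lp RR JJ mx]]]; exists R, J; split=> // x.
  exact: (maximal_valuation lp mx).
exact: (maximal_nonunit lp mx).
Qed.

End LocalPairs.

(** * Tropical points from valuations *)
Lemma expfz_sum (F : fieldType) (x : F) (I : Type) (s : seq I) (P : pred I) (n : I -> int) :
  x != 0 -> x ^ (\sum_(i <- s | P i) n i) = \prod_(i <- s | P i) x ^ n i.
Proof.
move=> x0; apply: (big_morph (fun n => x ^ n)) => [m m'|]; last exact: expr0z.
exact: expfzDr.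
Qed.

Lemma prod_expfz (F : fieldType) (I : Type) (s : seq I) (P : pred I) (x : I -> F) n :
  (\prod_(i <- s | P i) x i) ^ n = \prod_(i <- s | P i) x i ^ n.
Proof.
apply: (big_morph (fun x : F => x ^ n)) => [y z|]; [exact: expfzMl|exact: exp1rz].
Qed.

Lemma ring_expz (L : fieldType) (R J : L -> Prop) x n : local_pair R J ->
  R x -> R x^-1 -> R (x ^ n).
Proof.
move=> lp Rx RV; have [_ _ _ rX _] := ring_closed lp.
case: n => n; first exact: rX.
by rewrite NegzE -exprz_inv; apply: rX.
Qed.

Definition pos_part (a : int) : nat := if a is Posz n then n else 0%N.
Definition neg_part (a : int) : nat := if a is Negz n then n.+1 else 0%N.

Lemma pos_negE (a : int) : a = (pos_part a)%:Z - (neg_part a)%:Z.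
Proof. by case: a => n /=; rewrite ?subr0 // sub0r NegzE. Qed.

Lemma expfz_pos_neg (F : fieldType) (x : F) (a : int) :
  x ^ a = x ^+ pos_part a / x ^+ neg_part a.
Proof. by case: a => n /=; rewrite ?expr0 ?divr1 ?mul1r. Qed.

(* With [z l] the value of the level of [l], [X l / z l] is a unit and the product
   of the [z l ^ e l] is a product of nonnegative powers of elements of [R]. *)
Lemma flag_product (L : fieldType) (Rv Jv : L -> Prop) (T : finType) (X : T -> L)
    (M F : T -> nat) (e : T -> int) (i1 i2 i3 i4 : T) :
  let le i j := `[< Rv (X j / X i) >] in
  local_pair Rv Jv -> (forall i, X i != 0) -> total le ->
  le i4 i3 -> le i3 i2 -> le i2 i1 ->
  (forall l, [/\ (l == i1 <= M l)%N, (M l <= F l)%N & (F l <= 1)%N]) ->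
  (forall l, [/\ F l = 0%N -> le l i4 && le i4 l,
                 F l = 1%N -> M l = 0%N -> le l i3 && le i3 l
               & M l = 1%N -> l != i1 -> le l i2 && le i2 l]) ->
  0 <= \sum_l e l * (l == i1)%:Z -> 0 <= \sum_l e l * (M l)%:Z ->
  0 <= \sum_l e l * (F l)%:Z -> \sum_l e l = 0 ->
  Rv (\prod_l X l ^ e l).
Proof.
move=> le lp X0 tot l43 l32 l21 nest lev S1 S2 S3 sum0.
pose A := X i1 / X i2; pose B := X i2 / X i3; pose C := X i3 / X i4.
have RA : Rv A by apply/asboolP.
have RB : Rv B by apply/asboolP.
have RC : Rv C by apply/asboolP.
have ABC0 : [/\ A != 0, B != 0 & C != 0] by rewrite !mulf_neq0 ?invr_eq0.
have [A0 B0 C0] := ABC0.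
pose z l := A ^+ (l == i1) * B ^+ M l * C ^+ F l * X i4.
have z0 l : z l != 0 by rewrite !mulf_neq0 ?expf_neq0.
have unit l : Rv (X l / z l) /\ Rv (X l / z l)^-1.
  have U i : le l i && le i l -> Rv (X l / X i) /\ Rv (X l / X i)^-1.
    by move=> /andP[/asboolP H1 /asboolP H2]; rewrite invf_div.
  have zE : exists2 i, z l = X i & le l i && le i l.
    have [n1 n2 n3] := nest l; have [F0 M0 M1] := lev l.
    rewrite /z.
    have [E|ne] := eqVneq l i1.
      rewrite E eqxx in n1; rewrite E in n2 n3.
      have -> : M l = 1%N by rewrite E; apply/eqP; rewrite eqn_leq n1 (leq_trans n2 n3).
      have -> : F l = 1%N by rewrite E; apply/eqP; rewrite eqn_leq n3 (leq_trans n1 n2).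
      exists i1; last by rewrite E; have := tot i1 i1; rewrite orbb => ->.
      by rewrite !expr1 /A /B /C !mulrA !divfK.
    case: (M l) n2 M0 M1 => [|[|m]] n2 M0 M1; last by have := leq_trans n2 n3.
      case: (F l) n3 F0 M0 => [|[|m]] // _ F0 M0.
        by exists i4; rewrite ?expr0 ?mul1r // F0.
      by exists i3; rewrite ?M0 // !expr0 !mul1r expr1 divfK.
    have -> : F l = 1%N by apply/eqP; rewrite eqn_leq n3 n2.
    by exists i2; rewrite ?M1 // expr0 mul1r !expr1 /B /C mulrA !divfK.
  by have [i -> /U] := zE.
have -> : \prod_l X l ^ e l = \prod_l (X l / z l) ^ e l *
    (A ^ (\sum_l e l * (l == i1)%:Z) * B ^ (\sum_l e l * (M l)%:Z) *
     C ^ (\sum_l e l * (F l)%:Z) * X i4 ^ (\sum_l e l)).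
  rewrite !expfz_sum // -!big_split; apply: eq_bigr => l _ /=.
  transitivity ((X l / z l) ^ e l * z l ^ e l); first by rewrite -expfzMl divfK.
  congr (_ * _).
  have pe (x : L) (n : nat) m : (x ^+ n) ^ m = x ^ (m * n%:Z).
    by rewrite exprnP exprz_exp mulrC.
  by rewrite /z 3!expfzMl !pe.
have pw x n : Rv x -> 0 <= n -> Rv (x ^ n).
  by move=> Rx; case: n => // n _; have [_ _ _ rX _] := ring_closed lp; apply: rX.
apply: (ringM lp).
  apply: (big_ind Rv (ring1 lp) (ringM lp)) => l _.
  have [u1 u2] := unit l; exact: (ring_expz _ lp u1 u2).
rewrite sum0 expr0z mulr1; apply: (ringM lp); last exact: pw.
by apply: (ringM lp); apply: pw.
Qed.

Lemma big_index_enum (T : finType) (S : Type) (idx : S) (op : Monoid.com_law idx)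
    (f : T -> S) :
  \big[op/idx]_x f x = \big[op/idx]_(i < #|{: T}|) f (enum_val i).
Proof. by rewrite -big_enum_val; apply: eq_bigl => x; rewrite inE. Qed.

Lemma subf_div (F : fieldType) (a b c d : F) : b != 0 -> d != 0 ->
  a / b - c / d = (a * d - c * b) / (b * d).
Proof. by move=> b0 d0; field; rewrite b0 d0. Qed.

Section GenericPoint.
Variables (K : fieldType) (w : K) (R : realType).
Hypothesis char0 : [pchar K] =i pred0.
Hypothesis w_prim : 3.-primitive_root w.
Local Notation ev := (g32_eval w).
Local Notation monom := 'X_{1..#|{: isoplane}|}.
Local Notation Pm := {mpoly K[4]}.
Local Notation L := {fraction {mpoly K[4]}}.

Local Notation "x %:F" := (@FracField.tofrac _ x) (at level 1, format "x %:F").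

Definition linear_form (x : 'rV[K]_4) : Pm := \sum_(k < 4) x 0 k *: 'X_k.

Definition generic_plane (W : isoplane) : Pm :=
  \prod_(l : line | val l \subset val W) linear_form (g32_form w l).

Definition generic_point : #|{: isoplane}|.-tuple Pm :=
  [tuple generic_plane (enum_val i) | i < #|{: isoplane}|].

Definition gval (f : coord_poly K) : Pm := f \mPo generic_point.

Lemma linear_form_eval l (c : 'rV[K]_4) :
  (linear_form (g32_form w l)).@[fun k => c 0 k] = ev l c.
Proof.
by rewrite raddf_sum; apply: eq_bigr => k _; rewrite /= mevalZ mevalXU.
Qed.

Lemma gval_eval f (c : 'rV[K]_4) :
  (gval f).@[fun k => c 0 k] = poly_at f (burkhardt_map w c).
Proof.
rewrite /gval comp_mpoly_meval /poly_at; apply: meval_eq => i.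
rewrite tnth_mktuple ffunE rmorph_prod; apply: eq_bigr => l _.
exact: linear_form_eval.
Qed.

Lemma linear_form_neq0 l : linear_form (g32_form w l) != 0.
Proof.
have /rV0Pn[k lk] := form_neq0 char0 w_prim l.
apply/eqP => E; have := linear_form_eval l (delta_mx 0 k).
rewrite E meval0 /g32_eval (bigD1 k) //= mxE !eqxx mulr1 big1 => [/esym/eqP|j jk].
  by rewrite addr0 (negPf lk).
by rewrite mxE (negPf jk) andbF mulr0.
Qed.

Lemma generic_plane_neq0 W : generic_plane W != 0.
Proof. by apply/prodf_neq0 => l _; apply: linear_form_neq0. Qed.

Lemma gvalX_neq0 m : gval 'X_[m] != 0.
Proof.
rewrite /gval comp_mpolyX; apply/prodf_neq0 => i _; rewrite expf_neq0 //.
by rewrite tnth_mktuple generic_plane_neq0.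
Qed.

Lemma gvalB f g : gval (f - g) = gval f - gval g.
Proof. exact: comp_mpolyB. Qed.

Lemma gvalM f g : gval (f * g) = gval f * gval g.
Proof. by rewrite /gval rmorphM. Qed.

Variable v : trop_vec R isoplane.
Hypothesis tropv : trop_burkhardt R w v.

Definition weight_ge (e : R) (f : coord_poly K) : Prop :=
  forall m, m \in msupp f -> e <= weight v m.

(* The Laurent polynomials in the generic point of degree 0 whose monomials
   have weight at least [e]. *)
Definition filtration (e : R) (x : L) : Prop := exists (f : coord_poly K) (b : monom),
  [/\ f \is (mdeg b).-homog, weight_ge (weight v b + e) f
    & x = (gval f)%:F / (gval 'X_[b])%:F].

Lemma weightM (m m' : monom) : weight v (m + m')%MM = weight v m + weight v m'.
Proof.
by rewrite /weight -big_split; apply: eq_bigr => i _; rewrite mnmDE natrD mulrDl.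
Qed.

Lemma weight_geX m : weight_ge (weight v m) 'X_[m].
Proof. by move=> m'; rewrite msuppX inE => /eqP ->. Qed.

Lemma weight_geM e e' f g : weight_ge e f -> weight_ge e' g -> weight_ge (e + e') (f * g).
Proof.
move=> fe ge' m /msuppM_le /allpairsP[[m1 m2] [/= m1f m2g ->]].
by rewrite weightM lerD ?fe ?ge'.
Qed.

Lemma weight_geB e f g : weight_ge e f -> weight_ge e g -> weight_ge e (f - g).
Proof. by move=> fe ge m /msuppB_le; rewrite mem_cat => /orP[/fe|/ge]. Qed.

Lemma weight_geW e e' f : e <= e' -> weight_ge e' f -> weight_ge e f.
Proof. by move=> ee' fe m /fe; apply: le_trans. Qed.

Lemma homX (m : monom) : ('X_[m] : coord_poly K) \is (mdeg m).-homog.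
Proof. by rewrite dhomogX. Qed.

Lemma frac_neq0 m : (gval 'X_[m])%:F != 0 :> L.
Proof. by rewrite tofrac_eq0 gvalX_neq0. Qed.

Lemma filtrationB e x y : filtration e x -> filtration e y -> filtration e (x - y).
Proof.
move=> [f [b [fh fe ->]]] [g [c [gh ge ->]]].
exists (f * 'X_[c] - g * 'X_[b]), (b + c)%MM; split.
- rewrite mdegD; apply: rpredB; first exact: dhomogM fh (homX c).
  by rewrite addnC; exact: dhomogM gh (homX b).
- apply: weight_geB; rewrite weightM.
    by rewrite addrAC; apply: weight_geM => //; apply: weight_geX.
  by rewrite [weight v b + _]addrC addrAC; apply: weight_geM => //; apply: weight_geX.
have bc := frac_neq0 b; have cc := frac_neq0 c.
have tfB (p q : Pm) : (p - q)%:F = p%:F - q%:F by apply: rmorphB.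
rewrite (subf_div _ _ bc cc) gvalB mpolyXD !gvalM tfB !tofracM.
reflexivity.
Qed.

Lemma filtrationM e e' x y : filtration e x -> filtration e' y ->
  filtration (e + e') (x * y).
Proof.
move=> [f [b [fh fe ->]]] [g [c [gh ge ->]]].
exists (f * g), (b + c)%MM; split.
- by rewrite mdegD dhomogM.
- by rewrite weightM addrACA; apply: weight_geM.
by rewrite mpolyXD !gvalM !tofracM invfM mulrACA.
Qed.

Lemma filtrationW e e' x : e <= e' -> filtration e' x -> filtration e x.
Proof.
move=> ee' [f [b [fh fe ->]]]; exists f, b; split=> //.
by apply: weight_geW fe; rewrite lerD2l.
Qed.

Lemma filtration_const a : filtration 0 (a%:MP)%:F.
Proof.
exists (a *: 'X_[0]), 0%MM; split.
- by apply: rpredZ; apply: homX.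
- rewrite addr0 => m /msuppZ_le; exact: weight_geX.
by rewrite /gval comp_mpolyZ mpolyX0 comp_mpoly1 tofrac1 divr1 -mul_mpolyC mulr1.
Qed.

(* An element of positive weight equal to 1 would be a polynomial vanishing on
   the Burkhardt quartic with a unique term of minimal weight. *)
Lemma filtration_proper e : 0 < e -> ~ filtration e 1.
Proof.
move=> e0 [f [b [fh fe E]]].
have {}E : gval f = gval 'X_[b].
  apply/eqP; rewrite -tofrac_eq; apply/eqP.
  by rewrite -[LHS](divfK (frac_neq0 b)) -E mul1r.
have bf : b \notin msupp f.
  by apply/negP => /fe; rewrite gerDl leNgt e0.
pose g := f - 'X_[b].
have gb : g@_b = -1.
  by rewrite mcoeffB mcoeffX eqxx memN_msupp_eq0 // sub0r.
have g0 : g != 0.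
  by apply/eqP => g0; move/eqP: gb; rewrite g0 mcoeff0 eq_sym oppr_eq0 oner_eq0.
have gh : g \is (mdeg b).-homog by rewrite rpredB ?homX.
have van y : burkhardt w y -> (forall W, y W != 0) -> poly_at g y = 0.
  move=> [_ H] _; apply: H gh _ => c _.
  by rewrite -gval_eval gvalB E subrr meval0.
have [m1 [m2 [m1g m2g ne mn]]] := tropv gh g0 van.
have bg : b \in msupp g by rewrite mcoeff_msupp gb oppr_eq0 oner_eq0.
have [w1 w2] := mn b bg.
have ge m : m \in msupp g -> m != b -> weight v b < weight v m.
  move=> /msuppB_le; rewrite mem_cat msuppX inE => /orP[mf _|/eqP ->]; last by rewrite eqxx.
  by apply: lt_le_trans (fe m mf); rewrite ltrDl.
have [m1b|/(ge m1 m1g)] := eqVneq m1 b; last by rewrite ltNge w1.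
by have := ge m2 m2g; rewrite -m1b eq_sym ne m1b ltNge w2 => /(_ isT).
Qed.

Lemma filtration_pair : local_pair (filtration 0) (fun x => exists2 e, 0 < e & filtration e x).
Proof.
split.
- by rewrite -tofrac1 -mpolyC1; apply: filtration_const.
- by move=> x y; apply: filtrationB.
- by move=> x y fx fy; rewrite -[0]addr0; apply: filtrationM.
- by move=> x [e e0]; apply: filtrationW; apply: ltW.
- exists 1 => //; exists 0, 0%MM; split; first exact: rpred0.
    by move=> m; rewrite msupp0.
  by rewrite /gval raddf0 tofrac0 mul0r.
- move=> x y [e e0 fx] [e' e'0 fy]; exists (Num.min e e'); first by rewrite lt_min e0.
  have fN : filtration (Num.min e e') (- y).
    rewrite -[- y]sub0r; apply: filtrationB; last by apply: filtrationW fy; rewrite ge_min lexx orbT.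
    rewrite -(subrr y); apply: filtrationB; by apply: filtrationW fy; rewrite ge_min lexx orbT.
  rewrite -[y]opprK; apply: filtrationB fN.
  by apply: filtrationW fx; rewrite ge_min lexx.
- by move=> x y fx [e e0 fy]; exists e => //; rewrite -[e]add0r; apply: filtrationM.
by move=> [e e0]; apply: filtration_proper.
Qed.

(** Otherwise the quotient of the form of i by that of l lies in [Jv] for all i in [I]. Constants
    lie in [Rv], so the form of l divided by itself would lie in [Jv] too. *)
Lemma trop_flat_order (Rv Jv : L -> Prop) : local_pair Rv Jv ->
  (forall a : K, Rv (a%:MP)%:F) ->
  (forall x, x != 0 -> Rv x \/ Rv x^-1) -> (forall x, Rv x -> ~ Rv x^-1 -> Jv x) ->
  flat_order w (fun i j => `[< Rv ((linear_form (g32_form w j))%:F /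
                                  (linear_form (g32_form w i))%:F) >]).
Proof.
move=> lp RK vtot nonunit I l lI; apply: contrapT => no.
have X0 i : (linear_form (g32_form w i))%:F != 0 :> L.
  by rewrite tofrac_eq0 linear_form_neq0.
pose T (x : 'rV[K]_4) : L := (linear_form x)%:F / (linear_form (g32_form w l))%:F.
have lfD x y : linear_form (x + y) = linear_form x + linear_form y.
  by rewrite -big_split; apply: eq_bigr => k _; rewrite mxE scalerDl.
have lfZ a x : linear_form (a *: x) = a%:MP * linear_form x.
  by rewrite mulr_sumr; apply: eq_bigr => k _; rewrite mxE -scalerA mul_mpolyC.
have JI i : i \in I -> Jv (T (g32_form w i)).
  move=> iI; have nle : ~ Rv (T (g32_form w i))^-1.
    by move=> H; apply: no; exists i => //; apply/asboolP; rewrite -invf_div.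
  apply: nonunit => //.
  by case: (vtot (T (g32_form w i))) => //; rewrite mulf_neq0 ?invr_eq0.
have [u_ E] := sub_sumsmxP lI.
have JT : Jv (T (\sum_(i in I) u_ i *m <<g32_form w i>>%MS)).
  apply: (big_ind (fun x => Jv (T x))).
  - rewrite /T /linear_form big1 => [|k _]; last by rewrite mxE scale0r.
    by rewrite tofrac0 mul0r; apply: (ideal0 lp).
  - by move=> x y Jx Jy; rewrite /T lfD tofracD mulrDl; apply: (idealD lp).
  move=> i iI; have /sub_rVP[a ->] : (u_ i *m <<g32_form w i>> <= g32_form w i)%MS.
    by rewrite -(genmxE (g32_form w i)) submxMl.
  by rewrite /T lfZ tofracM -mulrA; apply: (idealM lp) => //; apply: JI.
by apply: (ideal_proper lp); move: JT; rewrite -E /T divff.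
Qed.

(** The cone is the one that the valuation assigns to the flag of the 40 forms. An integral
    functional [a] nonnegative on its image is read as a Laurent monomial in the coordinates; the
    monomial is in the valuation ring, which forces its v-weight to be nonnegative. *)
Lemma trop_halfspaces : exists2 c, c \in cones & forall a : isoplane -> int,
  \sum_W a W = 0 -> (forall r, r \in c -> 0 <= \sum_(W in vset (vert r)) a W) ->
  0 <= \sum_W (a W)%:~R * v W.
Proof.
have [Rv [Jv [lp RR JJ vtot nonunit]]] := valuation_extension filtration_pair.
pose X l : L := (linear_form (g32_form w l))%:F.
have X0 i : X i != 0 by rewrite tofrac_eq0 linear_form_neq0.
pose le i j := `[< Rv (X j / X i) >].
have tot : total le.
  move=> i j; have ne : X i / X j != 0 by rewrite mulf_neq0 ?invr_eq0.
  by apply/orP; case: (vtot _ ne) => H; [right|left; rewrite invf_div in H]; apply/asboolP.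
have tr : transitive le.
  move=> j i k /asboolP ij /asboolP jk; apply/asboolP.
  have -> : X k / X i = X k / X j * (X j / X i) by rewrite mulrA divfK.
  exact: (ringM lp).
have fo := trop_flat_order lp (fun a => RR _ (filtration_const a)) vtot nonunit.
have [c [d2 [d3 [i1 [i2 [i3 [i4 /=]]]]]]] := flat_order_flag char0 w_prim tot tr fo.
case=> cC [d2c d3c i1c] [l43 l32 l21] nest lev; exists c => // a a0 ac.
(* [e] is the transpose of A applied to [a], and also the exponent of the form of l in the monomial
   with exponents [a]. *)
pose e (l : line) := \sum_(W : isoplane | val l \subset val W) a W.
have pair (x : trop_vec R line) :
    \sum_l (e l)%:~R * x l = \sum_W (a W)%:~R * mapA x W.
  rewrite (eq_bigr (fun l : line => \sum_(W : isoplane | val l \subset val W) (a W)%:~R * x l)).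
    rewrite (exchange_big_dep xpredT) //=; apply: eq_bigr => W _.
    by rewrite mapAE mulr_sumr.
  by move=> l _; rewrite rmorph_sum mulr_suml.
have a0R : \sum_W (a W)%:~R = 0 :> R by rewrite -rmorph_sum a0.
have sum0 : \sum_l e l = 0.
  apply/eqP; rewrite -(intr_eq0 R) rmorph_sum; apply/eqP.
  transitivity (\sum_l (e l)%:~R * ones R line l : R).
    by apply: eq_bigr => l _; rewrite onesE mulr1.
  rewrite pair mapA_ones; transitivity (4%:R * \sum_W (a W)%:~R : R); last by rewrite a0R mulr0.
  rewrite mulr_sumr; apply: eq_bigr => W _.
  by rewrite ffunE onesE mulrC; congr (_ * _); exact: mulr1.
have ge_ray r : r \in c -> 0 <= \sum_l (e l)%:~R * indic R (rset r) l :> R.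
  move=> rc; rewrite pair mapA_ray ?(cones_lt cC) //.
  have -> : \sum_W (a W)%:~R * ((mult r)%:R *: indic R (vset (vert r)) +
      (shift r)%:R *: ones R isoplane) W =
      (mult r)%:R * (\sum_(W in vset (vert r)) a W)%:~R + (shift r)%:R * \sum_W (a W)%:~R :> R.
    rewrite rmorph_sum !mulr_sumr [X in _ = X + _]big_mkcond -big_split.
    apply: eq_bigr => W _; rewrite !ffunE indicE mulrDr; congr (_ + _); last first.
      by rewrite mulrCA; congr (_ * _); exact: mulr1.
    by rewrite mulrCA; case: (W \in _); [congr (_ * _); exact: mulr1|rewrite !mulr0].
  by rewrite a0R mulr0 addr0 mulr_ge0 ?ler0n // ler0z ac.
have ge_rays d : {subset d <= c} ->
    0 <= \sum_l e l * (count (fun r => l \in rset r) d)%:Z.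
  move=> dc; rewrite -(ler0z R) rmorph_sum /=.
  rewrite (eq_bigr (fun l : line => (e l)%:~R * (\sum_(r <- d) indic R (rset r)) l)) => [|l _]; last first.
    by rewrite rmorphM (count_rays R).
  rewrite (eq_bigr (fun l : line => \sum_(r <- d) (e l)%:~R * indic R (rset r) l)) => [|l _]; last first.
    by rewrite sum_ffunE mulr_sumr.
  by rewrite exchange_big big_seq sumr_ge0 // => r rd; apply/ge_ray/dc.
pose M l := count (fun r => l \in rset r) d2; pose F l := count (fun r => l \in rset r) d3.
have S1 : 0 <= \sum_l e l * (l == i1)%:Z.
  have := ge_rays [:: idx i1]; rewrite (eq_bigr (fun l : line => e l * (l == i1)%:Z)); first apply.
    by move=> r; rewrite inE => /eqP ->.
  by move=> l _; rewrite /= rset_a inE addn0.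
have S2 : 0 <= \sum_l e l * (M l)%:Z by apply: ge_rays.
have S3 : 0 <= \sum_l e l * (F l)%:Z by apply: ge_rays.
pose Y (W : isoplane) : L := (generic_plane W)%:F.
have Y0 W : Y W != 0 by rewrite tofrac_eq0 generic_plane_neq0.
have RY : Rv (\prod_W Y W ^ a W).
  have -> : \prod_W Y W ^ a W = \prod_l X l ^ e l.
    rewrite [RHS](eq_bigr (fun l : line => \prod_(W : isoplane | val l \subset val W) X l ^ a W)).
      rewrite (exchange_big_dep xpredT) //=; apply: eq_bigr => W _.
      by rewrite -prod_expfz /Y /generic_plane rmorph_prod.
    by move=> l _; rewrite expfz_sum.
  exact: (flag_product lp X0 tot l43 l32 l21 nest lev S1 S2 S3 sum0).
(* Were the weight negative, the inverse monomial, with numerator [b1] and denominator [b2] of equal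
   degree, would have positive weight and lie in [Jv]; its product with the monomial in [Rv] is
   1. *)
rewrite leNgt; apply/negP => neg.
pose b1 : monom := [multinom neg_part (a (enum_val i)) | i < #|{: isoplane}|].
pose b2 : monom := [multinom pos_part (a (enum_val i)) | i < #|{: isoplane}|].
have YE : \prod_W Y W ^ a W = (gval 'X_[b2])%:F / (gval 'X_[b1])%:F.
  rewrite /gval !comp_mpolyX !rmorph_prod -prodf_div /=.
  rewrite big_index_enum.
  apply: eq_bigr => i _; rewrite !mnmE !tnth_mktuple expfz_pos_neg !rmorphXn.
  by [].
have wE : weight v b1 - weight v b2 = - \sum_W (a W)%:~R * v W.
  rewrite /weight -sumrB -sumrN [RHS]big_index_enum.
  apply: eq_bigr => i _; rewrite !mnmE -mulrBl -mulNr; congr (_ * _).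
  by rewrite {3}[a _]pos_negE rmorphB opprB.
have dE : mdeg b1 = mdeg b2.
  apply/eqP; rewrite -(eqr_nat R) !mdegE !natr_sum -subr_eq0 -oppr_eq0 opprB -sumrB.
  rewrite -[X in _ == X]a0R [X in _ == X]big_index_enum; apply/eqP.
  apply: eq_bigr => i _; rewrite !mnmE {3}[a _]pos_negE.
  by rewrite rmorphB.
have Jinv : Jv ((gval 'X_[b1])%:F / (gval 'X_[b2])%:F).
  apply: JJ; exists (weight v b1 - weight v b2); first by rewrite wE oppr_gt0.
  exists 'X_[b1], b2; split=> //; first by rewrite -dE homX.
  by rewrite addrC subrK; apply: weight_geX.
apply: (ideal_proper lp).
have := idealM lp RY Jinv; rewrite YE.
have -> : (gval 'X_[b2])%:F / (gval 'X_[b1])%:F * ((gval 'X_[b1])%:F / (gval 'X_[b2])%:F) = 1 :> L.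
  by rewrite mulrA divfK ?frac_neq0 // divff ?frac_neq0.
by [].
Qed.

End GenericPoint.

(* A point satisfying the integral inequalities of a cone of a separated complex
   lies in the cone: integral functionals dual to its rays exist. *)
Lemma cone_of_halfspaces (R : realType) (X : finType) (Delta : {set {set {set X}}})
    (s : {set {set X}}) (v : trop_vec R X) : separated Delta -> s \in Delta ->
  (forall a : X -> int, \sum_x a x = 0 -> (forall G, G \in s -> 0 <= \sum_(x in G) a x) ->
     0 <= \sum_x (a x)%:~R * v x) ->
  cone_over (@indic R X) s v.
Proof.
move=> sep sD H.
pose al G : X -> int := if pselect (G \in s) is left Gs
  then projT1 (cid (dual_functional sep sD Gs)) else fun=> 0.
have alP G : G \in s -> \sum_x al G x = 0 /\
    forall G', G' \in s -> \sum_(x in G') al G x = (G' == G)%:R.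
  by move=> Gs; rewrite /al; case: pselect => // Gs'; case: cid.
pose b G : R := \sum_x (al G x)%:~R * v x.
have b0 G : G \in s -> 0 <= b G.
  move=> Gs; have [al0 al1] := alP G Gs; apply: H => // G' G's.
  by rewrite al1 // ler0n.
have van (a : X -> int) : \sum_x a x = 0 -> (forall G, G \in s -> \sum_(x in G) a x = 0) ->
    \sum_x (a x)%:~R * v x = 0.
  move=> a0 aG; apply/eqP; rewrite eq_le H ?andbT //; last by move=> G /aG ->.
  rewrite -oppr_ge0 -sumrN (eq_bigr (fun x => (- a x)%:~R * v x)).
    apply: (H (fun x => - a x)); first by rewrite sumrN a0 oppr0.
    by move=> G Gs; rewrite sumrN aG // oppr0.
  by move=> x _; rewrite rmorphN mulNr.
pose v' x := v x - \sum_(G in s) b G * (x \in G)%:R.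
have const x y : v' x = v' y.
  pose d z : int := (z == x)%:Z - (z == y)%:Z.
  have dsum (f : X -> R) : \sum_z (d z)%:~R * f z = f x - f y.
    have one t : \sum_z (z == t)%:R * f z = f t.
      rewrite (bigD1 t) //= eqxx mul1r big1 ?addr0 // => z /negPf ->.
      by rewrite mul0r.
    rewrite -(one x) -(one y) -sumrB; apply: eq_bigr => z _.
    by rewrite -mulrBl rmorphB.
  pose k (G : {set X}) := \sum_(z in G) d z.
  (* Subtracting the dual functionals makes [a] vanish on every member of [s], so the hypothesis
     applies to [a] and to its opposite. *)
  pose a z := d z - \sum_(G in s) k G * al G z.
  have dz0 : \sum_z d z = 0.
    apply/eqP; rewrite -(intr_eq0 R) rmorph_sum; apply/eqP.
    transitivity (\sum_z (d z)%:~R * 1 : R); last by rewrite (dsum (fun=> 1)) subrr.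
    by apply: eq_bigr => z _; rewrite mulr1.
  have a0 : \sum_z a z = 0.
    rewrite sumrB dz0 exchange_big big1 ?subrr // => G Gs.
    by rewrite -mulr_sumr; have [-> _] := alP G Gs; rewrite mulr0.
  have aG G : G \in s -> \sum_(z in G) a z = 0.
    move=> Gs; rewrite sumrB exchange_big (bigD1 G) //= -mulr_sumr.
    have [_ ->//] := alP G Gs; rewrite eqxx mulr1 [X in _ - (_ + X)]big1 ?addr0 ?subrr // => G' /andP[G's ne].
    rewrite -mulr_sumr; have [_ ->//] := alP G' G's.
    by rewrite eq_sym (negPf ne) mulr0.
  have := van a a0 aG.
  have -> : \sum_z (a z)%:~R * v z = \sum_z (d z)%:~R * v z - \sum_(G in s) (k G)%:~R * b G.
    rewrite (eq_bigr (fun z => (d z)%:~R * v z - \sum_(G in s) (k G)%:~R * (al G z)%:~R * v z)).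
      rewrite sumrB exchange_big; congr (_ - _); apply: eq_bigr => G _.
      by rewrite mulr_sumr; apply: eq_bigr => z _; rewrite mulrA.
    move=> z _; rewrite /a rmorphB mulrBl rmorph_sum mulr_suml; congr (_ - _).
    by apply: eq_bigr => G _; rewrite rmorphM.
  rewrite dsum => /eqP; rewrite subr_eq0 => /eqP E.
  have kE G : (k G)%:~R = (x \in G)%:R - (y \in G)%:R :> R.
    rewrite -(dsum (fun z => (z \in G)%:R)) rmorph_sum big_mkcond; apply: eq_bigr => z _.
    by case: (z \in G); rewrite ?mulr1 ?mulr0.
  have : v x - v y = \sum_(G in s) b G * (x \in G)%:R - \sum_(G in s) b G * (y \in G)%:R.
    by rewrite E -sumrB; apply: eq_bigr => G _; rewrite kE mulrC mulrBr.
  by rewrite /v'; lra.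
have [x0 _] : exists x : X, true by have [_ /(_ s sD)[x _]] := sep; exists x.
exists b, (v' x0); split => //; apply/combP => x.
by rewrite (const x0 x) addrC subrK.
Qed.

(** * The support of the tropical quartic and the theorem *)

Section Burkhardt.
Variables (K : fieldType) (w : K) (R : realType).
Hypothesis char0 : [pchar K] =i pred0.
Hypothesis w_prim : 3.-primitive_root w.

Lemma trop_burkhardtE : trop_burkhardt R w =
  (fun v => exists s, s \in trop_complex /\ cone_over (@indic R isoplane) s v).
Proof.
apply/seteqP; split=> v.
  move=> tv; have [c cC H] := trop_halfspaces char0 w_prim tv.
  exists (tset c); split; first exact: tset_complex.
  apply: (cone_of_halfspaces trop_separated (tset_complex cC)) => a a0 ac.
  by apply: H => // r rc; apply: ac; apply/tsetP; exists r.
move=> [s [/trop_complexP[c cC ->]]]; exact: (cone_trop char0 w_prim cC).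
Qed.

End Burkhardt.

Theorem theorem4p3 (K : closedFieldType) (w : K) (R : realType)
    (char0 : [pchar K] =i pred0) (w_prim : 3.-primitive_root w) :
  [/\ 
      coarsest_fan_structure (berg R w) (berg_fan R),
      exists (V : finType) (Delta : {set {set V}}) (g : V -> trop_vec R isoplane),
        [/\ fan_over Delta g (trop_burkhardt R w),
            (\max_(s in Delta) #|s| = 2.+1)%N,
            [/\ #|faces Delta 1| = 85%N, #|faces Delta 2| = 600%N
              & #|faces Delta 3| = 880%N]
          & 
            let cones k : set (set (trop_vec R isoplane)) :=
              (fun D => exists s, s \in faces Delta k /\ D = cone_over g s) in
            [/\ cones 1%N = trop_cones R (over_a :|: over_b),
                cones 2%N = trop_cones R (over_aa :|: over_ab)
              & cones 3%N = trop_cones R (over_aab :|: over_aaa)]],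
      [/\ census R over_a 40 2, #|berg_a| = 40%N, #|berg_h| = 40%N,
          census R over_b 45 2 & #|berg_b| = 90%N],
      [/\ census R over_aa 240 3 /\ census R over_ab 360 3,
          #|berg_aa| = 240%N /\ #|berg_ah| = 480%N
        & [/\ #|berg_ab| = 360%N, #|berg_bh| = 360%N & #|berg_abp| = 360%N]]
    & 
      [/\ census R over_aab 720 4 /\ census R over_aaa 160 3,
          #|berg_aab| = 1440%N /\ #|berg_abh| = 1440%N
        & #|berg_aah| = 480%N]].
Proof.
have [ca ch] := card_berg_ah_a.
split.
- exact: berg_coarsest.
- exists {set isoplane}, trop_complex, (@indic R isoplane); split.
  + apply: (separated_fan_over trop_separated trop_down _ (trop_burkhardtE R char0 w_prim)).
    apply/trop_complexP; exists [::]; last first.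
      by apply/esym/setP => G; rewrite [in RHS]finset.in_set0; apply/negbTE/negP; case/tsetP.
    exact/incone_cones.
  + exact: trop_complex_dim.
  + exact: card_trop_faces.
  move=> k; split.
  + exact: (trop_cones_faces R over_aE over_bE types_a_sub types_b_sub trop_faces1).
  + exact: (trop_cones_faces R over_aaE over_abE types_aa_sub types_ab_sub trop_faces2).
  exact: (trop_cones_faces R over_aabE over_aaaE types_aab_sub types_aaa_sub trop_faces3).
- by split=> //; [exact: over_a_census|exact: over_b_census|exact: card_berg_b].
- split; [split; [exact: over_aa_census|exact: over_ab_census]|exact: card_berg_aa_ah|].
  exact: card_berg_ab_bh_abp.
split; [split; [exact: over_aab_census|exact: over_aaa_census]|exact: card_berg_aab_abh|].
exact: card_berg_aah.
Qed.
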